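(* Let $\theta\in(0,1)$, let $D$ be a bounded domain of $\mathbb{R}^d$ and let $K\subset D$ be compact. Then there exists a constant $C_H$ depending on $K$, $D$ and $\lambda$, such that any bounded, nonnegative function $h$ which is harmonic in $D$ with respect to an operator $\mathcal{I}\in\mathfrak{L}^{\mathsf{sym}}_{\alpha}(\lambda)\cup\mathfrak{I}_{\alpha}(\theta,\lambda)$ satisfies $$h(x)\le C_H\,h(y)\qquad\text{for all } x,y\in K.$$
   Context: Fix $\alpha\in(1,2)$ and a nondecreasing function $\lambda:[0,\infty)\to(0,\infty)$; for a bounded domain $D$ put $\lambda_D=\inf\{\lambda(R):D\subset B_{R+1}\}$, where $B_R$ is the open ball of radius $R$ centered at $0$. $\mathfrak{L}_\alpha(\lambda)$ is the class of operators $$\mathcal{I}f(x)=b(x)\cdot\nabla f(x)+\int_{\mathbb{R}^d}\bigl(f(x+z)-f(x)-\mathbf{1}_{\{|z|\le1\}}\nabla f(x)\cdot z\bigr)\frac{k(x,z)}{|z|^{d+\alpha}}\,dz,\quad f\in C^2_b(\mathbb{R}^d),$$ with $b:\mathbb{R}^d\to\mathbb{R}^d$ and $k:\mathbb{R}^d\times\mathbb{R}^d\to(0,\infty)$ Borel measurable, such that for every bounded domain $D$: $|b(x)|\le\lambda_D$ and $\lambda_D^{-1}\le k(x,z)\le\lambda_D$ for all $x\in D$, $z\in\mathbb{R}^d$. $\mathfrak{L}^{\mathsf{sym}}_\alpha(\lambda)$ is the subclass with $k(x,z)=k(x,-z)$ for all $x,z$. $\mathfrak{I}_\alpha(\theta,\lambda)$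 is the subclass of $\mathfrak{L}_\alpha(\lambda)$ such that, for every bounded domain $D$, $\int_{\mathbb{R}^d}(|z|^{\alpha-\theta}\wedge1)\frac{|k(x,z)-k(x,0)|}{|z|^{d+\alpha}}\,dz\le\lambda_D$ for all $x\in D$. Standing assumption: for every initial distribution $\nu_0$ there is a strong Markov process $(X,\mathbb{P}_{\nu_0})$ with càdlàg paths associated with $\mathcal{I}$, i.e., $X_0\sim\nu_0$ and $f(X_t)-f(X_0)-\int_0^t\mathcal{I}f(X_s)\,ds$ is a martingale (with respect to the right-continuous filtration generated by $X$) for every $f\in C_b^2(\mathbb{R}^d)$; $\mathbb{P}_x,\mathbb{E}_x$ correspond to $\nu_0=\delta_x$. $\tau(A)=\inf\{t\ge0:X_t\notin A\}$. A measurable $h:\mathbb{R}^d\to\mathbb{R}$ is harmonic with respect to $\mathcal{I}$ in a domain $D$ if for every bounded subdomain $G\subset D$, $h(x)=\mathbb{E}_x[h(X_{\tau(G)})]$ for all $x\in G$, where $(X,\mathbb{P}_x)$ is a strong Markov process associated with $\mathcal{I}$. *)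

(* Defs.v *)
From HB Require Import structures.
From mathcomp Require Import all_boot all_order all_algebra.
From mathcomp Require Import all_classical all_reals all_analysis measurable_realfun.

Set Implicit Arguments.
Unset Strict Implicit.
Unset Printing Implicit Defensive.

Import Order.TTheory GRing.Theory Num.Theory.
Import numFieldNormedType.Exports.

Local Open Scope classical_set_scope.
Local Open Scope ring_scope.

Section borel_matrix.
Context (R : realType) (m n : nat).

Let G : set (set 'M[R]_(m, n)) := open.

Let sG0 : <<s G >> set0. Proof. exact: sigma_algebra0. Qed.

Let sGC A : <<s G >> A -> <<s G >> (~` A).
Proof. exact: sigma_algebraC. Qed.

Let sGU (F : (set 'M[R]_(m, n))^nat) :
  (forall i, <<s G >> (F i)) -> <<s G >> (\bigcup_i F i).
Proof. exact: sigma_algebra_bigcup. Qed.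

HB.instance Definition _ := @isMeasurable.Build (sigma_display G) 'M[R]_(m, n)
  <<s G >> sG0 sGC sGU.

End borel_matrix.

Section measurable_matrix.
Context (R : realType) (m n : nat).

Lemma measurable_mx_coord i j :
  measurable_fun setT (fun M : 'M[R]_(m, n) => M i j).
Proof.
apply: (measurability _ (RGenOpens.measurableE R)) => _ [_ [a [b ->]] <-].
rewrite setTI; apply: sub_sigma_algebra => /=.
apply: open_comp; last exact: interval_open.
by move=> M _; exact: coord_continuous.
Qed.

Lemma measurable_fun_mx d (T : measurableType d) (f : T -> 'M[R]_(m, n)) :
  (forall i j, measurable_fun setT (fun t => f t i j)) -> measurable_fun setT f.
Proof.
move=> mf; apply: (measurability _ (erefl (@measurable _ 'M[R]_(m, n)))).
move=> _ [A oA <-]; rewrite setTI.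
pose box (p : 'M[rat]_(m, n) * nat) : set 'M[R]_(m, n) :=
  ball (map_mx ratr p.1 : 'M[R]_(m, n)) p.2.+1%:R^-1.
pose F k := if unpickle k is Some p then
  (if `[< box p `<=` A >] then f @^-1` box p else set0) else set0.
suff -> : f @^-1` A = \bigcup_k F k.
  apply: bigcupT_measurable => k; rewrite /F.
  case: unpickle => // p; case: ifP => // _.
  rewrite (_ : _ @^-1` _ = \bigcap_(i in [set: 'I_m]) \bigcap_(j in [set: 'I_n])
     ((fun t => f t i j) @^-1` ball (ratr (p.1 i j) : R) p.2.+1%:R^-1)).
    apply: fin_bigcap_measurable => // i _; apply: fin_bigcap_measurable => // j _.
    by rewrite -[X in measurable X]setTI; apply: mf => //; exact: measurable_ball.
  apply/seteqP; split=> t.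
    by move=> [_ h] i _ j _; have := h i j; rewrite mxE.
  by move=> h; split=> // i j; rewrite mxE; exact: h.
apply/seteqP; split=> [t At|t [k _]]; last first.
  rewrite /F; case: unpickle => // p; case: ifP => // /asboolP; exact.
have /nbhs_ballP[e /= e0 eA] : nbhs (f t) A by exact: open_nbhs_nbhs.
have [k ke] : exists k : nat, k.+1%:R^-1 < e / 2 :> R.
  have e20 : 0 < e / 2 by rewrite divr_gt0.
  have /cvgrPdist_lt/(_ _ e20) [k _ /(_ k (leqnn _))] := @cvg_harmonic R.
  by rewrite sub0r normrN /= ger0_norm// => ?; exists k.
have k0 : 0 < k.+1%:R^-1 :> R by rewrite invr_gt0.
have /choice[q qP] : forall ij : 'I_m * 'I_n, exists q : rat,
    ball (f t ij.1 ij.2) k.+1%:R^-1 (ratr q).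
  move=> ij; have [r [Br [q _ qr]]] := @dense_rat R (ball (f t ij.1 ij.2) k.+1%:R^-1)
    (ex_intro _ _ (ballxx _ k0)) (ball_open _ _).
  by exists q; rewrite qr.
pose Q : 'M[rat]_(m, n) := \matrix_(i, j) q (i, j).
have fQ : ball (f t) k.+1%:R^-1 (map_mx ratr Q : 'M[R]_(m, n)).
  by split => // i j; rewrite !mxE; exact: (qP (i, j)).
exists (pickle (Q, k)) => //; rewrite /F pickleK asboolT; first exact: ball_sym.
move=> y hy; apply: eA; rewrite (splitr e).
by apply: (@ball_triangle _ _ (map_mx ratr Q : 'M[R]_(m, n))); apply: le_ball (ltW ke) _ _.
Qed.

End measurable_matrix.

Section lebesgue_rV.
Context (R : realType).

Section step.
Context (n : nat) (mu : {sigma_finite_measure set 'rV[R]_n -> \bar R}).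

Definition prepend (p : measurableTypeR R * 'rV[R]_n) : 'rV[R]_n.+1 :=
  row_mx ((p.1 : R)%:M : 'M[R]_1) p.2.

Let lam : {measure set (measurableTypeR R * 'rV[R]_n)%type -> \bar R} :=
  (@lebesgue_measure R \x mu)%E.

Let lam_sigma_finite : sigma_finite setT lam.
Proof.
have /sigma_finiteP[F [TF ndF Foo]] := sigma_finiteT (@lebesgue_measure R).
have /sigma_finiteP[G [TG ndG Goo]] := sigma_finiteT mu.
exists (fun k => F k `*` G k).
  rewrite -setXTT TF TG predeqE => -[x y]; split.
    move=> [/= [i _ Fix] [j _ Gjy]]; exists (maxn i j) => //; split.
    - by move: x Fix; exact/subsetPset/ndF/leq_maxl.
    - by move: y Gjy; exact/subsetPset/ndG/leq_maxr.
  by move=> [i _ []/= ? ?]; split; exists i.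
move=> k; have [? ?] := Foo k; have [? ?] := Goo k.
split; first exact: measurableX.
by rewrite /lam /= product_measure1E// lte_mul_pinfty// ge0_fin_numE.
Qed.

Let prepend_coord p i j : prepend p i j =
  if fintype.split (j : 'I_(1 + n)) is inr k then p.2 i k else p.1.
Proof.
rewrite /prepend mxE; case: fintype.split => k //.
by rewrite mxE ord1 (ord1 k) eqxx.
Qed.

Let mprepend : measurable_fun setT prepend.
Proof.
apply: measurable_fun_mx => i j; under eq_fun do rewrite prepend_coord.
case: fintype.split => k; first exact: measurable_fst.
exact: (measurableT_comp (measurable_mx_coord _ _)).
Qed.

Definition lebesgue_rV_step : set 'rV[R]_n.+1 -> \bar R := pushforward lam prepend.

Let mpre A : measurable A -> measurable (prepend @^-1` A).
Proof. by move=> mA; rewrite -[X in measurable X]setTI; exact: mprepend. Qed.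

Let step0 : lebesgue_rV_step set0 = 0%E.
Proof. by rewrite /lebesgue_rV_step /pushforward preimage_set0 measure0. Qed.

Let step_ge0 A : (0 <= lebesgue_rV_step A)%E.
Proof. exact: measure_ge0. Qed.

Let step_sigma_additive : semi_sigma_additive lebesgue_rV_step.
Proof.
move=> F mF tF mUF; rewrite /lebesgue_rV_step /pushforward preimage_bigcup.
apply: measure_semi_sigma_additive.
- by move=> k; exact: mpre.
- apply/trivIsetP => /= i j _ _ ij; rewrite -preimage_setI.
  by move/trivIsetP : tF => /(_ _ _ _ _ ij) ->//; rewrite preimage_set0.
- by rewrite -preimage_bigcup; exact: mpre.
Qed.

HB.instance Definition _ := isMeasure.Build _ _ _ lebesgue_rV_step
  step0 step_ge0 step_sigma_additive.

Let unprepend (v : 'rV[R]_n.+1) : measurableTypeR R * 'rV[R]_n :=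
  (v ord0 ord0, \row_j v ord0 (lift ord0 j)).

Let munprepend : measurable_fun setT unprepend.
Proof.
apply/measurable_fun_pairP; split; first exact: measurable_mx_coord.
apply: measurable_fun_mx => i j /=; under eq_fun do rewrite mxE.
exact: measurable_mx_coord.
Qed.

Let prependK : cancel prepend unprepend.
Proof.
move=> [x v]; congr pair.
  by rewrite prepend_coord; case: splitP => // k.
apply/rowP => j; rewrite mxE prepend_coord; case: splitP => /= k.
  by rewrite (ord1 k).
by rewrite /bump /= !add1n => -[kj]; congr (v _ _); apply/val_inj.
Qed.

Let step_sigma_finite : sigma_finite setT lebesgue_rV_step.
Proof.
have [F FT Ffin] := lam_sigma_finite.
exists (fun k => unprepend @^-1` F k); first by rewrite -preimage_bigcup -FT.
move=> k; have [mF Foo] := Ffin k; split.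
  by rewrite -[X in measurable X]setTI; exact: munprepend.
rewrite /lebesgue_rV_step /pushforward -comp_preimage.
by rewrite (_ : unprepend \o prepend = id)//; apply/funext => p; exact: prependK.
Qed.

HB.instance Definition _ := Measure_isSigmaFinite.Build _ _ _ lebesgue_rV_step
  step_sigma_finite.

End step.

Fixpoint lebesgue_rV n : {sigma_finite_measure set 'rV[R]_n -> \bar R} :=
  match n with
  | 0 => dirac (0 : 'rV[R]_0)
  | n.+1 => lebesgue_rV_step (lebesgue_rV n)
  end.

End lebesgue_rV.

Section euclidean.
Context (R : realType) (d : nat).
Implicit Types (x u v : 'rV[R]_d) (f : 'rV[R]_d -> R) (D : set 'rV[R]_d).

Definition dot u v : R := \sum_i u ord0 i * v ord0 i.

(* The library norm `|x| on 'rV[R]_d is the max norm. *)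
Definition enorm v : R := Num.sqrt (dot v v).

Definition eball (r : R) : set 'rV[R]_d := [set x | enorm x < r].

Definition domain D := [/\ open D, connected D & D !=set0].

Definition bounded_domain D := domain D /\ bounded_set D.

Definition partial (i : 'I_d) f x : R := 'D_(delta_mx ord0 i) f x.

Definition grad f x : 'rV[R]_d := \row_i partial i f x.

Definition is_C1 f := forall i,
  (forall x, derivable f x (delta_mx ord0 i)) /\ continuous (partial i f).

Definition is_Cb2 f := [/\ is_C1 f, forall i, is_C1 (partial i f),
  bounded_fun f, forall i, bounded_fun (partial i f) &
  forall i j, bounded_fun (partial j (partial i f))].

End euclidean.

Section operators.
Context (R : realType) (d : nat) (alpha theta : R) (lambda : R -> R).
Implicit Types (b : 'rV[R]_d -> 'rV[R]_d) (k : 'rV[R]_d -> 'rV[R]_d -> R).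

Definition generator b k (f : 'rV[R]_d -> R) (x : 'rV[R]_d) : R :=
  dot (b x) (grad f x) +
  \int[lebesgue_rV R d]_z
    ((f (x + z) - f x - \1_[set z | enorm z <= 1] z * dot (grad f x) z) *
     (k x z / enorm z `^ (d%:R + alpha))).

Definition lambda_dom (D : set 'rV[R]_d) : R :=
  inf [set lambda r | r in [set r | 0 <= r /\ D `<=` eball (r + 1)]].

Definition class_L b k :=
  [/\ measurable_fun setT b,
      measurable_fun setT (fun p : 'rV[R]_d * 'rV[R]_d => k p.1 p.2),
      forall x z, 0 < k x z &
      forall D, bounded_domain D -> forall x, D x ->
        enorm (b x) <= lambda_dom D /\
        forall z, (lambda_dom D)^-1 <= k x z <= lambda_dom D].

Definition class_Lsym b k := class_L b k /\ forall x z, k x z = k x (- z).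

Definition class_I b k := class_L b k /\
  forall D, bounded_domain D -> forall x, D x ->
  (\int[lebesgue_rV R d]_z
     (Num.min (enorm z `^ (alpha - theta)) 1 *
      (`|k x z - k x 0| / enorm z `^ (d%:R + alpha)))%:E
   <= (lambda_dom D)%:E)%E.

End operators.

Section processes.
Context (R : realType) (d : nat) (dO : measure_display)
  (Omega : measurableType dO).
(* Only the values X t with 0 <= t are ever used. *)
Context (X : R -> Omega -> 'rV[R]_d).
Implicit Types (t : R) (tau : Omega -> \bar R) (A : set Omega).

Definition cadlag (w : R -> 'rV[R]_d) :=
  (forall t, 0 <= t -> w s @[s --> t^'+] --> w t) /\
  (forall t, 0 < t -> cvg (w s @[s --> t^'-])).

Definition sigma_X (I : set R) : set (set Omega) :=
  <<s [set A | exists2 s, I s & exists2 B, measurable B & A = X s @^-1` B] >>.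

Definition filtration t : set (set Omega) :=
  \bigcap_(u in [set u | t < u]) sigma_X [set s | 0 <= s <= u].

Definition stopping_time tau := (forall w, (0 <= tau w)%E) /\
  forall t, 0 <= t -> filtration t [set w | (tau w <= t%:E)%E].

Definition stopped_sigma tau : set (set Omega) :=
  [set A | sigma_X [set s | 0 <= s] A /\
    forall t, 0 <= t -> filtration t (A `&` [set w | (tau w <= t%:E)%E])].

Definition martingale (Q : probability Omega R) (M : R -> Omega -> R) :=
  [/\ forall t, 0 <= t -> forall B, measurable B ->
        filtration t (M t @^-1` B),
      forall t, 0 <= t -> Q.-integrable setT (EFin \o M t) &
      forall s t, 0 <= s -> s <= t -> forall A, filtration s A ->
        (\int[Q]_(w in A) (M t w)%:E = \int[Q]_(w in A) (M s w)%:E)%E].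

Definition exit_time (G : set 'rV[R]_d) (w : Omega) : \bar R :=
  ereal_inf [set t%:E | t in [set t | 0 <= t /\ ~ G (X t w)]].

Context (P : probability 'rV[R]_d R -> probability Omega R).

Definition P_ (x : 'rV[R]_d) : probability Omega R :=
  P (dirac x : probability 'rV[R]_d R).

Definition strong_markov :=
  (forall t B, 0 <= t -> measurable B ->
     measurable_fun setT (fun x => P_ x (X t @^-1` B))) /\
  (forall nu tau A t B, stopping_time tau -> stopped_sigma tau A -> 0 <= t ->
     measurable B ->
     P nu [set w | [/\ A w, (tau w < +oo)%E & B (X (fine (tau w) + t) w)]] =
     (\int[P nu]_(w in A `&` [set w | tau w < +oo])
       P_ (X (fine (tau w)) w) (X t @^-1` B))%E).

Definition associated (L : ('rV[R]_d -> R) -> 'rV[R]_d -> R) :=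
  forall nu : probability 'rV[R]_d R,
  (forall B, measurable B -> P nu (X 0 @^-1` B) = nu B) /\
  forall f, is_Cb2 f -> martingale (P nu) (fun t w =>
    f (X t w) - f (X 0 w)
    - \int[@lebesgue_measure R]_(s in `[0, t]) L f (X s w)).

Definition strong_markov_process_for L :=
  [/\ forall t, 0 <= t -> measurable_fun setT (X t),
      forall w, cadlag (X ^~ w), strong_markov & associated L].

(* X has no value at time +oo, hence the restriction to finite exit times.
   The exit time is in general only measurable for the completion of P_ x; the
   library's integral is built from suprema over the simple functions below the
   positive and negative parts, so it agrees with the integral against the
   completed measure. *)
Definition harmonic_for (h : 'rV[R]_d -> R) (D : set 'rV[R]_d) :=
  measurable_fun setT h /\
  forall G, bounded_domain G -> G `<=` D -> forall x, G x ->
    (h x)%:E = (\int[P_ x]_(w in [set w | exit_time G w < +oo])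
                  (h (X (fine (exit_time G w)) w))%:E)%E.

End processes.

(* Main.v *)
(* Start the process at x0, let S be its exit time from the box of radius s
   around x0, capped at a small multiple of s^alpha. Since alpha > 1, Taylor's
   formula bounds the generator on a cut-off squared distance by
   C s^-alpha, drift included, so E[S] is comparable to s^alpha. Applying
   optional stopping to smooth functions supported away from the box then shows
   that the law of the exit position far from x0 is comparable to
   s^alpha |y - x0|^-(d+alpha) dy. Let w(z) = (1+|z|)^-(d+alpha) and let W be
   the integral of h w.

   Lower bound: the jump kernel from y is at least a multiple of w away from y,
   and the mass near y is reached through an intermediate ball; hence
   W <= C h(y) for y in K.

   Upper bound: let N be the supremum of h(x) rho(x)^d over a small ball B, where
   rho is the distance to the complement of B. On a small ball next to x of
   radius comparable to rho(x), either h exceeds h(x)/2 on half of the volume, so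
   that h(x) rho(x)^d <= C W, or the process enters the part where h <= h(x)/2
   with probability at least q, and the mean value property gives
   h(x) rho(x)^d <= (1 - q/4) N + C W. Hence N <= C W. *)
Require Import Defs.
From HB Require Import structures.
From mathcomp Require Import all_boot all_order all_algebra.
From mathcomp Require Import all_classical all_reals all_analysis measurable_realfun.
From mathcomp Require Import ring lra.

Set Implicit Arguments.
Unset Strict Implicit.
Unset Printing Implicit Defensive.

Import Order.TTheory GRing.Theory Num.Theory.
Import numFieldNormedType.Exports.
Import HBNNSimple.

Local Open Scope classical_set_scope.
Local Open Scope ring_scope.

(** * Lower integrals and Lebesgue measure on row vectors *)

(** The exit time of a ball is an infimum over uncountably many times and may fail to be measurable,
    so no estimate integrates it directly. Exit times are read off dyadic grids instead: these are
    measurable by construction, decrease to the exit from a closed box, and agree path by path with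
    the true exit from a ball once the path jumps far enough. The way back to the true exit uses
    only the monotonicity of the integral. The exponent [d] in the weight of [h] is forced. With [s]
    comparable to the distance to the boundary, both error terms scale as [s^-d]: one through the
    volume [s^d] of the set where [h] is large, the other through the mean exit time [s^alpha]
    multiplied by the size [s^-(d+alpha)] of the kernel relative to [w]. Boundedness of [h] makes
    the supremum [N] finite, so that [(1 - q/4) N] can be absorbed; the bound itself leaves no trace
    in the constant. *)

Section lower_integral.
Context d (T : measurableType d) (R : realType) (mu : {measure set T -> \bar R}).
Implicit Types (D : set T).
Local Open Scope ereal_scope.

(* The library integral is a difference of two suprema over simple functions,
   so its monotonicity needs no measurability. *)
Lemma ge0_le_lower_integral D (f g : T -> \bar R) :
  (forall x, D x -> 0 <= f x) -> (forall x, D x -> f x <= g x) ->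
  \int[mu]_(x in D) f x <= \int[mu]_(x in D) g x.
Proof.
move=> f0 fg; rewrite !ge0_integralE//; last first.
  by move=> x Dx; exact: le_trans (f0 _ Dx) (fg _ Dx).
apply: ereal_sup_le => _ [h hf <-]; exists h => //= x; apply: le_trans (hf x) _; rewrite /patch.
by case: ifPn => // /[!inE]; exact: fg.
Qed.

Lemma le_lower_integral D (f g : T -> \bar R) :
  (forall x, D x -> f x <= g x) ->
  \int[mu]_(x in D) f x <= \int[mu]_(x in D) g x.
Proof.
move=> fg; rewrite integralE [leRHS]integralE; apply: leeB;
  apply: ge0_le_lower_integral => x Dx //; have fgx := fg _ Dx.
- by rewrite !funeposE ge_max !le_max fgx lexx orbT.
- by rewrite !funenegE ge_max !le_max leeN2 fgx lexx orbT.
Qed.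

End lower_integral.

Lemma open_measurable_rV (R : realType) n (A : set 'rV[R]_n) : open A -> measurable A.
Proof. by move=> oA; apply: sub_sigma_algebra. Qed.

Lemma open_ball_rV (R : realType) n (a : 'rV[R]_n) r : open (ball a r).
Proof. exact: (@ball_open R 'rV[R]_n). Qed.

Section translation.
Context (R : realType).
Local Open Scope ereal_scope.

Lemma measurable_addr_measurableTypeR (a : R) :
  measurable_fun setT ((fun t => (a + t)%R) : measurableTypeR R -> measurableTypeR R).
Proof. exact: measurable_funD. Qed.

(** The pushforward under the shift agrees with Lebesgue measure on half-open intervals, and these
    determine it. *)
Lemma lebesgue_measure_translation (a : R) (A : set (measurableTypeR R)) : measurable A ->
  lebesgue_measure ((fun t => (a + t)%R : measurableTypeR R) @^-1` A) =
  lebesgue_measure A.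
Proof.
move=> mA; have mphi := measurable_addr_measurableTypeR a.
apply/esym; pose phi : measurableTypeR R -> measurableTypeR R := fun t => (a + t)%R.
rewrite -[RHS]/(pushforward lebesgue_measure phi A).
apply: lebesgue_measure_unique => //= _ [[u v]] _ <-.
rewrite /pushforward.
rewrite (_ : phi @^-1` _ = `](u - a)%R, (v - a)%R]%classic); last first.
  by apply/seteqP; split=> x; rewrite /= !in_itv/= /phi; lra.
rewrite /= !lebesgue_measure_itv/= !lte_fin ltrD2r.
by case: ifPn => // _; rewrite -!EFinD; congr EFin; lra.
Qed.

Lemma measurable_addl_rV n (a : 'rV[R]_n) :
  measurable_fun setT (fun z : 'rV[R]_n => (a + z)%R).
Proof.
apply: measurable_fun_mx => i j; under eq_fun do rewrite mxE.
by apply: measurable_funD => //; exact: measurable_mx_coord.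
Qed.

Lemma prependE n (x : R) (v : 'rV[R]_n) j : prepend (x, v) ord0 j =
  if fintype.split (j : 'I_(1 + n)) is inr k then v ord0 k else x.
Proof.
rewrite /prepend mxE; case: fintype.split => k //.
by rewrite mxE (ord1 k) eqxx.
Qed.

Lemma measurable_prepend n : measurable_fun setT (@prepend R n).
Proof.
apply: measurable_fun_mx => i j.
rewrite ord1 (_ : (fun t => _) = (fun t : measurableTypeR R * 'rV[R]_n =>
  if fintype.split (j : 'I_(1 + n)) is inr k then t.2 ord0 k else t.1)); last first.
  by apply/funext => -[x v]; rewrite prependE.
case: fintype.split => k; first exact: measurable_fst.
exact: (measurableT_comp (measurable_mx_coord _ _)).
Qed.

Lemma prependD n (x y : R) (u v : 'rV[R]_n) :
  prepend ((x + y)%R, (u + v)%R) = (prepend (x, u) + prepend (y, v))%R.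
Proof. by apply/rowP => j; rewrite [RHS]mxE !prependE; case: fintype.split => k //; rewrite mxE. Qed.

Lemma prepend_surj n (a : 'rV[R]_n.+1) :
  a = prepend (a ord0 ord0, \row_j a ord0 (lift ord0 j)).
Proof.
apply/rowP => j; rewrite prependE; case: splitP => k jk.
  by congr (a _ _); apply/val_inj; rewrite /= jk ord1.
by rewrite mxE; congr (a _ _); apply/val_inj; rewrite /= jk.
Qed.

(** Induction on the dimension: through [prepend] the shift acts separately on the first coordinate
    and on the rest, and a product measure is determined by rectangles. *)
Lemma lebesgue_rV_translation n (a : 'rV[R]_n) A : measurable A ->
  lebesgue_rV R n ((fun z => (a + z)%R) @^-1` A) = lebesgue_rV R n A.
Proof.
elim: n a A => [a A mA|n IH a A mA] /=.
  by rewrite (_ : _ @^-1` _ = A)//; apply/seteqP; split=> z /=;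
    rewrite (thinmx0 (a + z)%R) (thinmx0 z).
rewrite [a]prepend_surj; set a0 := a _ _; set a' := \row__ _.
pose phi (p : measurableTypeR R * 'rV[R]_n) : measurableTypeR R * 'rV[R]_n :=
  ((a0 + p.1)%R, (a' + p.2)%R).
have mphi : measurable_fun setT phi.
  apply/measurable_fun_pairP; split.
    exact: (measurableT_comp (measurable_addr_measurableTypeR a0)).
  by apply: (measurableT_comp (measurable_addl_rV a')).
rewrite /lebesgue_rV_step /pushforward.
rewrite (_ : prepend (n:=n) @^-1` _ = phi @^-1` (prepend (n:=n) @^-1` A)); last first.
  by apply/seteqP; split => -[x v] /=; rewrite /phi /= prependD.
have mpA : measurable (prepend (n:=n) @^-1` A).
  by rewrite -[X in measurable X]setTI; exact: measurable_prepend.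
rewrite -[LHS]/(pushforward (lebesgue_measure \x lebesgue_rV R n) phi _).
apply/esym/product_measure_unique => // U V mU mV.
rewrite /= /pushforward.
rewrite (_ : phi @^-1` _ =
  ((fun t => (a0 + t)%R) @^-1` U) `*` ((fun t => (a' + t)%R) @^-1` V)) //.
rewrite product_measure1E //.
- by congr (_ * _); [exact: lebesgue_measure_translation|exact: IH].
- by rewrite -[X in measurable X]setTI; exact: (measurable_addr_measurableTypeR a0).
- by rewrite -[X in measurable X]setTI; exact: (measurable_addl_rV a').
Qed.

Lemma ge0_integral_translation n (a : 'rV[R]_n) (f : 'rV[R]_n -> \bar R) :
  measurable_fun setT f -> (forall x, 0 <= f x) ->
  \int[lebesgue_rV R n]_z f (a + z)%R = \int[lebesgue_rV R n]_z f z.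
Proof.
move=> mf f0; have ma := measurable_addl_rV a.
transitivity (\int[pushforward (lebesgue_rV R n) (fun z => (a + z)%R)]_z f z).
  by rewrite ge0_integral_pushforward.
by apply: eq_measure_integral => // A mA _; exact: lebesgue_rV_translation.
Qed.

(** Balls of the max norm are cubes, hence products; this is what makes their volume exactly
    [(2 * r) ^+ n]. *)
Lemma mx_ball_prepend n (a : 'rV[R]_n.+1) (r : R) :
  prepend (n:=n) @^-1` ball a r =
  ball (a ord0 ord0) r `*` ball (\row_j a ord0 (lift ord0 j) : 'rV[R]_n) r.
Proof.
apply/seteqP; split=> -[x v] /=.
  move=> [r0 h]; split => /=.
    have := h ord0 ord0; rewrite prependE; case: splitP => //.
  split => // i j; have := h ord0 (lift ord0 j); rewrite prependE ord1 mxE.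
  case: splitP => k; first by rewrite (ord1 k).
  by rewrite (ord1 i) /= /bump /= !add1n => -[/ord_inj ->].
move=> [b0 [r0 bv]]; split => // i j; rewrite ord1 prependE; case: splitP => k jk.
  by rewrite (_ : j = ord0)//; apply/val_inj; rewrite /= jk ord1.
have := bv ord0 k; rewrite mxE; rewrite (_ : lift ord0 k = j)//.
by apply/val_inj; rewrite /= jk.
Qed.

Lemma lebesgue_rV_ball n (a : 'rV[R]_n) (r : R) : (0 < r)%R ->
  lebesgue_rV R n (ball a r) = ((2 * r) ^+ n)%:E.
Proof.
move=> r0; elim: n a => [a|n IH a] /=.
  by rewrite diracE expr0 mem_set//; split => // i [].
rewrite /lebesgue_rV_step /pushforward mx_ball_prepend.
rewrite [LHS]product_measure1E//=; first 1 last.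
- exact: measurable_ball.
- by apply: open_measurable_rV; exact: open_ball_rV.
by rewrite IH lebesgue_measure_ball ?ltW// -EFinM exprS mulr2n; congr EFin; ring.
Qed.

End translation.

(** * The stable kernel *)

Section dyadic.
Context (R : realType).

Lemma nneseries_geometric_le (c q : R) (u : nat -> \bar R) :
  0 <= c -> 0 <= q < 1 -> (forall k, 0 <= u k)%E -> (forall k, u k <= (c * q ^+ k)%:E)%E ->
  (\sum_(k <oo) u k <= (c / (1 - q))%:E)%E.
Proof.
move=> c0 /andP[q0 q1] u0 ucq; apply: lime_le.
  by apply: is_cvg_nneseries => n _ _; exact: u0.
near=> n; apply: le_trans (lee_sum _ (fun i _ => ucq i)) _.
rewrite sumEFin lee_fin big_mkord -mulr_sumr ler_wpM2l//.
rewrite -[leRHS]mul1r ler_pdivlMr ?subr_gt0//.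
have := subrX1 q n; set S := \sum_(_ < _) _ => e.
suff -> : S * (1 - q) = 1 - q ^+ n by rewrite gerBl exprn_ge0.
by rewrite -[1 - q ^+ n]opprB e; ring.
Unshelve. all: by end_near. Qed.

(** [f] is dominated by the series of the [b k] on the sets [F k], which may overlap: one term of
    the series suffices at each point. The lower integral lets [f] be arbitrary, and only the
    dominating series is integrated term by term. *)
Lemma integral_cover_le d (T : measurableType d) (mu : {measure set T -> \bar R})
    (D : set T) (f : T -> R) (F : nat -> set T) (b : nat -> R) (c q : R) :
  0 <= c -> 0 <= q < 1 -> measurable D ->
  (forall k, measurable (F k)) -> (forall k, 0 <= b k) ->
  (forall k, ((b k)%:E * mu (F k) <= (c * q ^+ k)%:E)%E) ->
  (forall x, D x -> 0 <= f x) ->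
  (forall x, D x -> f x <= 0 \/ exists2 k, F k x & f x <= b k) ->
  (\int[mu]_(x in D) (f x)%:E <= (c / (1 - q))%:E)%E.
Proof.
move=> c0 q01 mD mF b0 bF f0 cov.
have u0 k x : (0 <= (b k * \1_(F k) x)%:E)%E by rewrite lee_fin mulr_ge0.
apply: (@le_trans _ _ (\int[mu]_(x in D) \sum_(k <oo) (b k * \1_(F k) x)%:E)%E).
  apply: ge0_le_lower_integral => x Dx; first by rewrite lee_fin f0.
  have [fx0|[k Fk fk]] := cov _ Dx.
    by apply: (@le_trans _ _ 0%E); [rewrite lee_fin|apply: nneseries_ge0].
  apply: (@le_trans _ _ (b k * \1_(F k) x)%:E).
    by rewrite lee_fin indicE mem_set// mulr1.
  rewrite (nneseries_split 0 k.+1)//.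
  rewrite add0n big_nat_recr//=.
  rewrite -[leLHS]add0e -addeA leeD//.
    by apply: sume_ge0 => *; exact: u0.
  by rewrite leeDl// nneseries_ge0.
rewrite integral_nneseries//; last first.
  by move=> k; apply/measurable_EFinP/measurable_funM => //; exact: measurable_indic.
apply: nneseries_geometric_le => // k.
  by apply: integral_ge0 => x _; exact: u0.
apply: le_trans (bF k); under eq_integral do rewrite EFinM.
rewrite ge0_integralZl//; first 1 last.
- exact/measurable_EFinP/measurable_indic.
- by rewrite lee_fin.
rewrite integral_indic//.
by apply: lee_wpmul2l; [rewrite lee_fin|apply: le_measure; rewrite ?inE//; exact: measurableI].
Qed.

Lemma measurable_normr_ge n (r : R) : measurable [set z : 'rV[R]_n | r <= `|z|].
Proof.
rewrite (_ : [set _ | _] = ~` ball (0 : 'rV[R]_n) r); last first.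
  apply/seteqP; split=> z /=; rewrite -ball_normE /= sub0r normrN.
    by move=> rz; apply/negP; rewrite -leNgt.
  by move/negP; rewrite -leNgt.
by apply: measurableC; apply: open_measurable_rV; exact: open_ball_rV.
Qed.

Lemma powR_lt1 (a p : R) : 0 < a < 1 -> 0 < p -> a `^ p < 1.
Proof.
move=> /andP[a0 a1] p0; rewrite -(powRr1 (ltW a0)) -powRrM mul1r.
rewrite /powR gt_eqF// expR_lt1 nmulr_llt0// ln_lt0// a0//.
Qed.

Section kernel.
Context (d : nat) (alpha : R).
Hypothesis alpha12 : 1 < alpha < 2.

Let alpha_gt1 : 1 < alpha. Proof. by case/andP: alpha12. Qed.
Let alpha_lt2 : alpha < 2. Proof. by case/andP: alpha12. Qed.

(** The stable kernel in the max norm, comparable with the Euclidean one up to the factor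
    [d^(d+alpha)]. The conventions for powers and inverses at 0 give it the value 0 there
    ([jker0]). *)
Definition jker (v : 'rV[R]_d) : R := (`|v| `^ (d%:R + alpha))^-1.

Lemma jker_ge0 v : 0 <= jker v.
Proof. by rewrite invr_ge0 powR_ge0. Qed.

Let shell (r : R) : set 'rV[R]_d := ball 0 (2 * r) `&` [set z | r <= `|z|].

Let mshell r : measurable (shell r).
Proof.
apply: measurableI; last exact: measurable_normr_ge.
by apply: open_measurable_rV; exact: open_ball_rV.
Qed.

Let shell_bound p (r : R) : 0 < r ->
  ((((2 * r) ^+ p / r `^ (d%:R + alpha))%R)%:E * lebesgue_rV R d (shell r) <=
   ((2 ^+ p * 4 ^+ d * (r ^+ p / r `^ alpha))%R)%:E)%E.
Proof.
move=> r0.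
apply: (@le_trans _ _ ((((2 * r) ^+ p / r `^ (d%:R + alpha))%R)%:E *
    lebesgue_rV R d (ball (0%R : 'rV[R]_d) (2 * r)%R))%E).
  apply: lee_wpmul2l.
    by rewrite lee_fin divr_ge0 ?powR_ge0// exprn_ge0// mulr_ge0// ltW.
  apply: le_measure; rewrite ?inE; [exact: mshell| |by move=> x []].
  by apply: open_measurable_rV; exact: open_ball_rV.
rewrite lebesgue_rV_ball ?mulr_gt0// -EFinM lee_fin powRD; last first.
  by rewrite (gt_eqF r0) implybT.
rewrite (powR_mulrn _ (ltW r0)) !exprMn.
have rd0 : r ^+ d != 0 by rewrite expf_neq0 // gt_eqF.
have ra0 : r `^ alpha != 0 by rewrite gt_eqF// powR_gt0.
rewrite le_eqVlt; apply/orP; left; apply/eqP.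
have -> : 4 ^+ d = 2 ^+ d * 2 ^+ d :> R by rewrite -exprMn; congr (_ ^+ _); ring.
by field; rewrite rd0 ra0.
Qed.

Let shell_jker p (r : R) z : 0 < r -> shell r z ->
  `|z| ^+ p * jker z <= (2 * r) ^+ p / r `^ (d%:R + alpha).
Proof.
move=> r0 [/=]; rewrite -ball_normE /= sub0r normrN => z2 rz.
rewrite /jker ler_pM ?exprn_ge0 ?invr_ge0 ?powR_ge0//.
  by rewrite lerXn2r ?nnegrE ?normr_ge0 ?mulr_ge0// ltW.
have dalpha : 0 <= d%:R + alpha by rewrite addr_ge0// (le_trans ler01)// ltW.
rewrite lef_pV2 ?posrE ?powR_gt0//; last exact: lt_le_trans rz.
by rewrite ge0_ler_powR ?nnegrE// ltW.
Qed.

Let exists_dyadic (a b : R) : 0 < a -> exists k, b < a * 2 ^+ k.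
Proof.
move=> a0; exists (Num.bound (`|b| / a)).
have h : `|b| / a < (Num.bound (`|b| / a))%:R.
  by rewrite archi_boundP// divr_ge0// ltW.
rewrite mulrC -ltr_pdivrMr//; apply: le_lt_trans (lt_trans h _).
  by rewrite ler_wpM2r ?invr_ge0 ?ler_norm// ltW.
by rewrite -natrX ltr_nat ltn_expl.
Qed.

Let powR_exprn (c p : R) k : 0 < c -> (c ^+ k) `^ p = (c `^ p) ^+ k.
Proof.
by move=> c0; rewrite -(powR_mulrn k (ltW c0)) -powRrM mulrC powRrM powR_mulrn// powR_ge0.
Qed.

(** Cut the cube into dyadic shells shrinking to 0. The shell at scale [r] contributes at most a
    multiple of [r^(2-alpha)], a geometric sequence of ratio [2^-(2-alpha)], which is below 1
    because [alpha < 2]. *)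
Lemma near_integral_jker : exists2 C, 0 < C & forall s : R, 0 < s ->
  (\int[lebesgue_rV R d]_(z in ball (0%R : 'rV[R]_d) s)
     (`|z| ^+ 2 * jker z)%:E <= (C * (s ^+ 2 / s `^ alpha))%:E)%E.
Proof.
have h0 : 0 < 2^-1 :> R by rewrite invr_gt0.
pose q := (2^-1) `^ (2 - alpha) : R.
have q01 : 0 < q < 1 by rewrite powR_gt0//= powR_lt1 ?subr_gt0// h0//=; lra.
have /andP[q0 q1] := q01.
have qE : q = (2^-1) ^+ 2 / (2^-1) `^ alpha.
  by rewrite -(powR_mulrn _ (ltW h0)) -powRN -powRD// (gt_eqF h0) implybT.
exists (2 ^+ 2 * 4 ^+ d * q / (1 - q)).
  by rewrite divr_gt0 ?subr_gt0// !mulr_gt0// exprn_gt0.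
move=> s s0; pose r k := s * 2^-1 ^+ k.+1.
have r0 k : 0 < r k by rewrite mulr_gt0// exprn_gt0.
rewrite mulrAC.
apply: (@integral_cover_le _ _ _ _ _ (fun k => shell (r k))
  (fun k => (2 * r k) ^+ 2 / (r k) `^ (d%:R + alpha))) => //.
- by rewrite !mulr_ge0 ?invr_ge0 ?powR_ge0 ?exprn_ge0// ltW.
- by rewrite ltW.
- by apply: open_measurable_rV; exact: open_ball_rV.
- by move=> k; rewrite divr_ge0 ?powR_ge0// exprn_ge0// mulr_ge0// ltW.
- move=> k; apply: le_trans (shell_bound _ (r0 k)) _; rewrite lee_fin.
  rewrite le_eqVlt; apply/orP; left; apply/eqP; rewrite /r.
  rewrite (powRM _ (ltW s0) (exprn_ge0 _ (ltW h0))) powR_exprn// exprMn.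
  transitivity (2 ^+ 2 * 4 ^+ d * (s ^+ 2 / s `^ alpha) * q ^+ k.+1); last first.
    by rewrite [q ^+ k.+1]exprSr; ring.
  have -> : q ^+ k.+1 = (2^-1 ^+ k.+1) ^+ 2 / (2^-1 `^ alpha) ^+ k.+1.
    by rewrite qE expr_div_n -!exprM mulnC.
  rewrite invfM; ring.
- by move=> z _; rewrite mulr_ge0 ?exprn_ge0// jker_ge0.
- move=> z zs; have [->|z0] := eqVneq z 0.
    by left; rewrite normr0 expr0n mul0r.
  have {zs} : `|z| < s by move: zs; rewrite -ball_normE /= sub0r normrN.
  rewrite -normr_gt0 in z0; move=> zs; right.
  have ex : exists k, s * 2^-1 ^+ k.+1 <= `|z|.
    have [k kz] := exists_dyadic s z0; exists k.
    rewrite exprVn ler_pdivrMr ?exprn_gt0// ltW// (lt_le_trans kz)//.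
    by rewrite ler_wpM2l ?ltW// ltr_eXn2l// ltr1n.
  (* Minimality of [k] supplies the outer radius of the shell; for [k = 0] it is the hypothesis that
     [z] lies in the ball. *)
  have [k kz kmin] := ex_minnP ex; have krz : shell (r k) z.
    split => //=; rewrite -ball_normE /= sub0r normrN.
    have -> : 2 * r k = s * 2^-1 ^+ k by rewrite /r exprS; field.
    case: k kz kmin => [|k] _ kmin; first by rewrite expr0 mulr1.
    by rewrite ltNge; apply/negP => /kmin; rewrite ltnn.
  by exists k => //; exact: shell_jker.
Qed.

(** Same dyadic sum over growing shells. With the weight [|z|] the ratio is [2^(1-alpha)], so here
    [alpha > 1] is decisive. *)
Lemma far_integral_jker : exists2 C, 0 < C & forall s : R, 0 < s ->
  (\int[lebesgue_rV R d]_(z in [set z | (s <= `|z|)%R])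
     (`|z| * jker z)%:E <= (C * (s / s `^ alpha))%:E)%E.
Proof.
have h0 : 0 < 2^-1 :> R by rewrite invr_gt0.
pose q := (2^-1) `^ (alpha - 1) : R.
have q01 : 0 < q < 1 by rewrite powR_gt0//= powR_lt1 ?subr_gt0// h0//=; lra.
have /andP[q0 q1] := q01.
have qE : q = 2 / 2 `^ alpha.
  rewrite /q -(powR_inv1 (ler0n _ 2)) -powRrM mulN1r opprB powRD ?powRr1 ?powRN//.
  by rewrite pnatr_eq0 implybT.
exists (2 ^+ 1 * 4 ^+ d / (1 - q)).
  by rewrite divr_gt0 ?subr_gt0// !mulr_gt0// exprn_gt0.
move=> s s0; pose r k := s * 2 ^+ k.
have r0 k : 0 < r k by rewrite mulr_gt0// exprn_gt0.
rewrite mulrAC.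
apply: (@integral_cover_le _ _ _ _ _ (fun k => shell (r k))
  (fun k => (2 * r k) ^+ 1 / (r k) `^ (d%:R + alpha))) => //.
- by rewrite !mulr_ge0 ?invr_ge0 ?powR_ge0 ?exprn_ge0// ltW.
- by rewrite ltW.
- exact: measurable_normr_ge.
- by move=> k; rewrite divr_ge0 ?powR_ge0// exprn_ge0// mulr_ge0// ltW.
- move=> k; apply: le_trans (shell_bound _ (r0 k)) _; rewrite lee_fin.
  rewrite le_eqVlt; apply/orP; left; apply/eqP; rewrite /r.
  rewrite (powRM _ (ltW s0) (exprn_ge0 _ (ler0n _ _))) powR_exprn// !expr1 qE expr_div_n invfM; ring.
- by move=> z _; rewrite mulr_ge0 ?jker_ge0.
- move=> z /= zs; right.
  have ex : exists k, `|z| < s * 2 ^+ k.+1.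
    have [k kz] := exists_dyadic `|z| s0; exists k; rewrite (lt_le_trans kz)//.
    by rewrite ler_wpM2l ?ltW// ltr_eXn2l// ltr1n.
  have [k kz kmin] := ex_minnP ex; have krz : shell (r k) z.
    split; first by rewrite -ball_normE /= sub0r normrN /r mulrCA -exprS.
    case: k kz kmin => [|k] _ kmin; first by rewrite /= /r expr0 mulr1.
    by rewrite /= /r leNgt; apply/negP => /kmin; rewrite ltnn.
  by exists k => //; rewrite -[`|z|]expr1; apply: shell_jker.
Qed.

End kernel.
End dyadic.

(** * Test functions of class C^2_b *)

Section calculus.
Context (R : realType) (d : nat).
Implicit Types (f g : 'rV[R]_d -> R) (x v : 'rV[R]_d).

(** Reduces directional derivatives to one variable, where the chain rule and the mean value theorem
    are available. *)
Lemma is_derive_lineP f x v (df : R) :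
  is_derive x v f df <-> is_derive (0 : R) 1 (fun t : R => f (t *: v + x)) df.
Proof.
have e : (fun h : R => h^-1 *: ((f \o shift x) (h *: v) - f x)) =
    (fun h : R => h^-1 *: (((fun t : R => f (t *: v + x)) \o shift 0) (h *: (1 : R))
       - f (0 *: v + x))).
  by apply/funext => h /=; rewrite addr0 scale0r add0r [h *: 1]mulr1.
split=> -[d1 d2]; split.
- by move: d1; rewrite /derivable e.
- by rewrite -d2 /derive e.
- by move: d1; rewrite /derivable -e.
- by rewrite -d2 /derive -e.
Qed.

Lemma is_derive_line f x v (t : R) (df : R) :
  is_derive (t *: v + x) v f df -> is_derive t 1 (fun t : R => f (t *: v + x)) df.
Proof.
move/is_derive_lineP => h.
rewrite (_ : (fun t : R => f (t *: v + x)) =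
  (fun u : R => f (u *: v + (t *: v + x))) \o (fun u => u - t)); last first.
  by apply/funext => u /=; rewrite scalerBl addrA subrK.
rewrite -[df]mulr1; apply: is_derive1_comp; first by rewrite subrr.
by rewrite -[1 in X in is_derive _ _ _ X]subr0; apply: is_deriveB.
Qed.

(** Rescaling the segment to [[0, 1]] avoids a case distinction on the sign of [t]; accordingly only
    [|c| <= |t|] is recorded. *)
Lemma line_mvt f x v (df : 'rV[R]_d -> R) (t : R) :
  (forall y, is_derive y v f (df y)) ->
  exists2 c : R, `|c| <= `|t| & f (t *: v + x) - f x = t * df (c *: v + x).
Proof.
move=> fdf.
pose F (u : R) := f ((t * u) *: v + x).
pose dF (u : R) := t * df ((t * u) *: v + x).
have FdF (u : R) : is_derive u 1 F (dF u).
  rewrite /dF mulrC; apply: (@is_derive1_comp _ (fun t => f (t *: v + x)) ( *%R t)).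
    exact/is_derive_line.
  by rewrite -[t in X in is_derive _ _ _ X]mulr1; apply: is_deriveZ.
have cF : {within `[0, 1], continuous F}.
  by apply: derivable_within_continuous => u _.
have [c c01] := MVT_segment ler01 (fun u _ => FdF u) cF.
rewrite /F /dF mulr0 mulr1 scale0r add0r subr0 mulr1 => ->.
exists (t * c) => //; move: c01; rewrite in_itv/= => /andP[c0 c1].
by rewrite normrM (ger0_norm c0) ler_piMr.
Qed.

Local Notation e i := (delta_mx ord0 i : 'rV[R]_d).

Lemma partial_is_derive f i x : is_C1 f -> is_derive x (e i) f (partial i f x).
Proof. by move=> /(_ i)[/(_ x) + _]; exact: derivableP. Qed.

(** The point is moved one coordinate at a time, so that the mean value theorem along axes is enough
    and full differentiability never enters. *)
Lemma C1_lipschitz_path f (a : R) x (z : 'I_d -> R) (s : seq 'I_d) :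
  is_C1 f -> (forall i y, `|partial i f y| <= a) ->
  `|f (\sum_(i <- s) z i *: e i + x) - f x| <= a * \sum_(i <- s) `|z i|.
Proof.
move=> f1 fa; elim: s => [|i s IH]; first by rewrite !big_nil add0r subrr normr0 mulr0.
rewrite !big_cons -addrA; set y := _ + x.
have [c _ fc] := line_mvt y (z i) (fun y => partial_is_derive i y f1).
rewrite -[_ - f x](subrKA (f y)) fc mulrDr (le_trans (ler_normD _ _))// lerD//.
by rewrite normrM mulrC ler_wpM2r.
Qed.

(** Adding one axis step of length [z i] from [y] costs [z i] times the variation of the [i]-th
    partial derivative between [x] and a point of that step; this variation is Lipschitz-small by
    the bound on second derivatives. *)
Lemma C1_taylor_path f (a : R) x (z : 'I_d -> R) (s : seq 'I_d) : 0 <= a ->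
  is_C1 f -> (forall i, is_C1 (partial i f)) ->
  (forall i j y, `|partial j (partial i f) y| <= a) ->
  `|f (\sum_(i <- s) z i *: e i + x) - f x - \sum_(i <- s) partial i f x * z i| <=
     a * (\sum_(i <- s) `|z i|) ^+ 2.
Proof.
move=> a0 f1 f2 fa; elim: s => [|i s IH].
  by rewrite !big_nil add0r subrr subr0 normr0 expr0n mulr0.
rewrite !big_cons -(addrA (z i *: e i)); set y := _ + x; set S := \sum_(_ <- _) `|_| in IH *.
have [c cz fc] := line_mvt y (z i) (fun y => partial_is_derive i y f1).
have S0 : 0 <= S by apply: sumr_ge0.
have [c' _ pc] := line_mvt y c (fun y => partial_is_derive i y (f2 i)).
have py := C1_lipschitz_path x z s (f2 i) (fa i).
set L := \sum_(_ <- _) partial _ _ _ * _ in IH *.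
rewrite (_ : _ - _ = (f y - f x - L) + z i * (partial i f (c *: e i + y) - partial i f x)); last first.
  have -> : f (z i *: e i + y) = z i * partial i f (c *: e i + y) + f y.
    by rewrite -fc subrK.
  by move: (f y) => fy; ring.
apply: le_trans (ler_normD _ _) _.
(* Expanding the new square leaves exactly the room needed: the induction hypothesis takes
   [a * S ^+ 2], the new step takes the rest. *)
rewrite (_ : a * _ = a * S ^+ 2 + `|z i| * (a * (`|z i| + S) + a * S)); last ring.
apply: lerD => //; rewrite normrM ler_wpM2l//.
rewrite -[_ - partial i f x](subrKA (partial i f y)) mulrDr.
rewrite (le_trans (ler_normD _ _))// -addrA lerD//; last first.
  by rewrite (le_trans py)// lerDl mulr_ge0.
by rewrite pc normrM mulrC ler_pM.
Qed.

Lemma sumr_le_const (F : 'I_d -> R) a : (forall i, F i <= a) -> \sum_i F i <= d%:R * a.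
Proof.
move=> Fa; apply: le_trans (ler_sum _ (fun i _ => Fa i)) _.
by rewrite sumr_const card_ord mulr_natl.
Qed.

Let sum_delta (z : 'rV[R]_d) : z = \sum_i z ord0 i *: e i.
Proof. exact: row_sum_delta. Qed.

Lemma coord_le_norm (z : 'rV[R]_d) i : `|z ord0 i| <= `|z|.
Proof.
rewrite [leRHS]/Num.norm /= mx_normrE.
by apply/bigmax_geP; right => /=; exists (ord0, i).
Qed.

Lemma sum_coord_le (z : 'rV[R]_d) : \sum_i `|z ord0 i| <= d%:R * `|z|.
Proof. by apply: sumr_le_const; exact: coord_le_norm. Qed.

Lemma C1_lipschitz f (a : R) x z : 0 <= a -> is_C1 f ->
  (forall i y, `|partial i f y| <= a) -> `|f (x + z) - f x| <= a * (d%:R * `|z|).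
Proof.
move=> a0 f1 fa; rewrite {1}[z]sum_delta [x + _]addrC.
apply: le_trans (C1_lipschitz_path _ _ _ f1 fa) _.
by rewrite ler_wpM2l// sum_coord_le.
Qed.

Lemma C2_taylor f (a : R) x z : 0 <= a -> is_C1 f ->
  (forall i, is_C1 (partial i f)) ->
  (forall i j y, `|partial j (partial i f) y| <= a) ->
  `|f (x + z) - f x - dot (grad f x) z| <= a * (d%:R * `|z|) ^+ 2.
Proof.
move=> a0 f1 f2 fa; rewrite {1}[z]sum_delta [x + _]addrC /dot.
under [X in _ - X]eq_bigr do rewrite mxE.
apply: le_trans (C1_taylor_path _ _ _ a0 f1 f2 fa) _.
rewrite ler_wpM2l// lerXn2r ?nnegrE ?sumr_ge0//.
exact: sum_coord_le.
Qed.

Lemma dot_grad_le f (a : R) x z : 0 <= a -> (forall i y, `|partial i f y| <= a) ->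
  `|dot z (grad f x)| <= a * (d%:R * `|z|).
Proof.
move=> a0 fa; apply: le_trans (ler_norm_sum _ _ _) _.
apply: le_trans (_ : a * \sum_i `|z ord0 i| <= _); last first.
  by rewrite ler_wpM2l// sum_coord_le.
rewrite mulr_sumr; apply: ler_sum => i _; rewrite mxE normrM mulrC.
by rewrite ler_wpM2r.
Qed.

Lemma dotC (u v : 'rV[R]_d) : dot u v = dot v u.
Proof. by apply: eq_bigr => i _; rewrite mulrC. Qed.

Lemma enorm_ge0 (v : 'rV[R]_d) : 0 <= enorm v.
Proof. exact: sqrtr_ge0. Qed.

Lemma norm_le_enorm (v : 'rV[R]_d) : `|v| <= enorm v.
Proof.
rewrite [leLHS]/Num.norm /= mx_normrE; apply/bigmax_leP; split => [|[i j] _ /=].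
  exact: enorm_ge0.
rewrite -sqrtr_sqr; apply: ler_wsqrtr; rewrite ord1 /dot (bigD1 j)//= -expr2.
by rewrite lerDl sumr_ge0// => k _; rewrite -expr2 sqr_ge0.
Qed.

Lemma enorm_le_norm (v : 'rV[R]_d) : enorm v <= d%:R * `|v|.
Proof.
rewrite -[leRHS]ger0_norm ?mulr_ge0// -sqrtr_sqr; apply: ler_wsqrtr.
apply: le_trans (_ : d%:R * `|v| ^+ 2 <= _).
  apply: sumr_le_const => i.
  rewrite -expr2 -real_normK ?num_real// lerXn2r ?nnegrE//.
  exact: coord_le_norm.
rewrite exprMn ler_wpM2r ?sqr_ge0// -natrX ler_nat expnS expn1.
by case: (d) => // n; rewrite leq_pmulr.
Qed.

End calculus.

Section test_functions.
Context (R : realType) (d : nat).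
Implicit Types (f g : 'rV[R]_d -> R) (x y : 'rV[R]_d).
Local Notation e i := (delta_mx ord0 i : 'rV[R]_d).

Lemma bounded_funP (T : Type) (f : T -> R) :
  bounded_fun f <-> exists M : R, forall t, `|f t| <= M.
Proof.
split=> [[M [_ fM]]|[M fM]].
  by exists (M + 1) => t; apply: (fM (M + 1)) => //; rewrite ltrDl.
by exists M; split=> [|N MN t _]; [exact: num_real|exact: le_trans (fM t) (ltW MN)].
Qed.

Lemma lipschitz_continuous f (a : R) :
  (forall x z, `|f (x + z) - f x| <= a * `|z|) -> continuous f.
Proof.
move=> fa x; apply/(@cvgrPdist_lt _ _ _ (nbhs x)) => eps eps0; apply/nbhs_ballP.
have a0 : 0 < `|a| + 1 by rewrite ltr_wpDl.
exists (eps / (`|a| + 1)) => /=; first by rewrite divr_gt0.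
move=> y; rewrite -ball_normE /= => xy; rewrite distrC -[y in X in X < _](subrKC x).
rewrite (le_lt_trans (fa _ _))//; apply: le_lt_trans (_ : (`|a| + 1) * `|y - x| < _).
  by rewrite ler_wpM2r// (le_trans (ler_norm _))// lerDl.
by rewrite -ltr_pdivlMl// mulrC distrC.
Qed.

Lemma C1_continuous f (a : R) : is_C1 f -> (forall i y, `|partial i f y| <= a) ->
  continuous f.
Proof.
move=> f1 fa; apply: (@lipschitz_continuous _ (`|a| * d%:R)) => x z.
rewrite -mulrA; apply: C1_lipschitz => // i y.
exact: le_trans (fa i y) (ler_norm _).
Qed.

(** Continuity is demanded of the second derivatives alone: bounded partial derivatives make a
    function Lipschitz, so continuity of the first derivatives follows. *)
Lemma is_Cb2I f (g : 'I_d -> 'rV[R]_d -> R) (h : 'I_d -> 'I_d -> 'rV[R]_d -> R) (M : R) :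
  (forall i x, is_derive x (e i) f (g i x)) ->
  (forall i j x, is_derive x (e j) (g i) (h i j x)) ->
  (forall i j, continuous (h i j)) ->
  (forall x, `|f x| <= M) -> (forall i x, `|g i x| <= M) ->
  (forall i j x, `|h i j x| <= M) ->
  [/\ is_Cb2 f, forall i, partial i f = g i &
    forall i j, partial j (partial i f) = h i j].
Proof.
move=> fg gh ch fM gM hM.
have pf i : partial i f = g i by apply/funext => x; exact: derive_val.
have pg i j : partial j (g i) = h i j by apply/funext => x; exact: derive_val.
have g1 i : is_C1 (g i).
  by move=> j; split => [x|]; [exact: ex_derive|rewrite pg; exact: ch].
have f1 : is_C1 f.
  move=> i; split => [x|]; first exact: ex_derive.
  by rewrite pf; apply: (C1_continuous (g1 i)) => j y; rewrite pg.
split => // [|i j]; last by rewrite pf pg.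
split => // [i|||].
- by rewrite pf.
- by apply/bounded_funP; exists M.
- by move=> i; apply/bounded_funP; exists M => x; rewrite pf.
- by move=> i j; apply/bounded_funP; exists M => x; rewrite pf pg.
Qed.

Lemma finite_bound (I : finType) (T : Type) (f : I -> T -> R) :
  (forall i, exists M : R, forall t, `|f i t| <= M) ->
  exists2 M : R, 0 <= M & forall i t, `|f i t| <= M.
Proof.
move=> /choice[M fM]; exists (\sum_i `|M i|); first exact: sumr_ge0.
move=> i t; rewrite (le_trans (fM i t))// (bigD1 i)//= (le_trans (ler_norm _))//.
by rewrite lerDl sumr_ge0.
Qed.

Lemma is_Cb2_bound f : is_Cb2 f -> exists2 M : R, 0 <= M &
  [/\ forall x, `|f x| <= M, forall i x, `|partial i f x| <= M &
      forall i j x, `|partial j (partial i f) x| <= M].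
Proof.
move=> [_ _ /bounded_funP[M fM] f1 f2].
have [M1 M10 fM1] := finite_bound (fun i => (bounded_funP _).1 (f1 i)).
have [M2 M20 fM2] := @finite_bound _ _ (fun ij : 'I_d * 'I_d => partial ij.2 (partial ij.1 f))
  (fun ij => (bounded_funP _).1 (f2 ij.1 ij.2)).
have M'0 : 0 <= `|M| + M1 + M2 by rewrite !addr_ge0.
exists (`|M| + M1 + M2) => //; split => [x|i x|i j x].
- by rewrite (le_trans (fM x))// (le_trans (ler_norm _))// -addrA lerDl addr_ge0.
- by rewrite (le_trans (fM1 i x))// addrAC lerDr addr_ge0.
- by rewrite (le_trans (fM2 (i, j) x))// lerDr addr_ge0.
Qed.

Lemma is_Cb2_continuous f : is_Cb2 f -> continuous f.
Proof.
move=> fC; have [M _ [_ fM _]] := is_Cb2_bound fC.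
by case: fC => f1 _ _ _ _; exact: (C1_continuous f1 fM).
Qed.

Lemma is_Cb2_derive f i x : is_Cb2 f -> is_derive x (e i) f (partial i f x).
Proof. by case=> f1 *; exact: partial_is_derive. Qed.

Lemma is_Cb2_derive2 f i j x : is_Cb2 f ->
  is_derive x (e j) (partial i f) (partial j (partial i f) x).
Proof. by case=> _ f2 *; exact: partial_is_derive. Qed.

Lemma is_Cb2_continuous2 f i j : is_Cb2 f -> continuous (partial j (partial i f)).
Proof. by case=> _ /(_ i)/(_ j)[]. Qed.

Lemma is_Cb2D f g : is_Cb2 f -> is_Cb2 g -> is_Cb2 (f \+ g).
Proof.
move=> fC gC; have [M M0 [fM f1 f2]] := is_Cb2_bound fC.
have [N N0 [gN g1 g2]] := is_Cb2_bound gC.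
have dg i x : is_derive x (e i) (f \+ g) ((partial i f \+ partial i g) x).
  by apply: is_deriveD; exact: is_Cb2_derive.
have dh i j x : is_derive x (e j) (partial i f \+ partial i g)
    ((partial j (partial i f) \+ partial j (partial i g)) x).
  by apply: is_deriveD; exact: is_Cb2_derive2.
have ch i j : continuous (partial j (partial i f) \+ partial j (partial i g)).
  by move=> x; apply: continuousD; exact: is_Cb2_continuous2.
have b0 x : `|(f \+ g) x| <= M + N by rewrite (le_trans (ler_normD _ _))// lerD.
have b1 i x : `|(partial i f \+ partial i g) x| <= M + N.
  by rewrite (le_trans (ler_normD _ _))// lerD.
have b2 i j x : `|(partial j (partial i f) \+ partial j (partial i g)) x| <= M + N.
  by rewrite (le_trans (ler_normD _ _))// lerD.
by have [] := is_Cb2I dg dh ch b0 b1 b2.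
Qed.

Lemma is_Cb2_cst (c : R) : is_Cb2 (fun _ : 'rV[R]_d => c).
Proof.
have z (x : 'rV[R]_d) : `|cst 0 x : R| <= `|c| by rewrite normr0.
by have [] := @is_Cb2I (cst c) (fun=> cst 0) (fun=> fun=> cst 0) `|c|
  (fun i x => is_derive_cst _ _ _) (fun i j x => is_derive_cst _ _ _)
  (fun i j => @cst_continuous _ _ _) (fun=> lexx _) (fun=> z) (fun=> fun=> z).
Qed.

Lemma is_Cb2_sum n (F : nat -> 'rV[R]_d -> R) : (forall k, is_Cb2 (F k)) ->
  is_Cb2 (fun y => \sum_(k < n) F k y).
Proof.
move=> FC; elim: n => [|n IH].
  by under eq_fun do rewrite big_ord0; exact: is_Cb2_cst.
rewrite (_ : (fun _ => _) = (fun y => \sum_(k < n) F k y) \+ F n).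
  exact: is_Cb2D IH (FC n).
by apply/funext => y; rewrite big_ord_recr.
Qed.

Lemma continuous_bounded_itv (g : R -> R) (M : R) : continuous g ->
  exists2 B : R, 0 <= B & forall u, `|u| <= M -> `|g u| <= B.
Proof.
move=> cg; have [M0|M0] := ltP M 0.
  by exists 0 => // u uM; have := le_lt_trans uM M0; rewrite normr_lt0.
have cng : {within `[(- M), M], continuous (fun u => `|g u|)}.
  apply: continuous_subspaceT => u; apply: continuous_comp; first exact: cg.
  exact: norm_continuous.
have [|c _ gc] := EVT_max _ cng; first lra.
by exists `|g c| => // u; rewrite ler_norml => uM; apply: gc; rewrite in_itv.
Qed.

(** [T] may be unbounded: [f] takes values in a compact interval, on which [T], [T1] and [T2] are
    bounded by continuity. *)
Lemma is_Cb2_comp f (T T1 T2 : R -> R) : is_Cb2 f ->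
  (forall u, is_derive u (1 : R) T (T1 u)) -> (forall u, is_derive u (1 : R) T1 (T2 u)) ->
  continuous T2 -> is_Cb2 (T \o f).
Proof.
move=> fC TT1 T12 cT2; have [M M0 [fM f1 f2]] := is_Cb2_bound fC.
have derive_cont (F F' : R -> R) : (forall u, is_derive u (1 : R) F (F' u)) -> continuous F.
  by move=> FF' u; apply/differentiable_continuous; rewrite -derivable1_diffP.
have [B B0 TB] := continuous_bounded_itv M (derive_cont _ _ TT1).
have [B1 B10 TB1] := continuous_bounded_itv M (derive_cont _ _ T12).
have [B2 B20 TB2] := continuous_bounded_itv M cT2.
have comp (F F' : R -> R) i x : (forall u, is_derive u (1 : R) F (F' u)) ->
    is_derive x (e i) (F \o f) (F' (f x) * partial i f x).
  move=> FF'; apply/is_derive_lineP.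
  apply: (@is_derive1_comp _ F (fun t : R => f (t *: e i + x))).
    by rewrite scale0r add0r.
  exact/is_derive_lineP/is_Cb2_derive.
pose C := B + B1 * M + (B2 * M * M + B1 * M).
pose g i x := T1 (f x) * partial i f x.
pose h i j x := T1 (f x) * partial j (partial i f) x +
    partial i f x * (T2 (f x) * partial j f x).
have dg i x : is_derive x (e i) (T \o f) (g i x) by exact: comp.
have dh i j x : is_derive x (e j) (g i) (h i j x).
  exact: is_deriveM (comp _ _ j x T12) (is_Cb2_derive2 i j x fC).
have ch i j : continuous (h i j).
  have cf := is_Cb2_continuous fC.
  have c1 k : continuous (partial k f) by case: fC => /(_ k)[].
  rewrite (_ : h i j = ((T1 \o f) \* partial j (partial i f)) \+
    (partial i f \* ((T2 \o f) \* partial j f)))//.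
  move=> x; apply: continuousD; apply: continuousM.
  - by apply: continuous_comp; [exact: cf|exact: derive_cont T12 _].
  - exact: is_Cb2_continuous2.
  - exact: c1.
  - apply: continuousM; last exact: c1.
    by apply: continuous_comp; [exact: cf|exact: cT2].
have bT x : `|(T \o f) x| <= C.
  rewrite (le_trans (TB _ (fM x)))// /C -addrA lerDl.
  by rewrite !addr_ge0 ?mulr_ge0.
have bg i x : `|g i x| <= C.
  rewrite normrM; apply: le_trans (_ : B1 * M <= _).
    by rewrite ler_pM// TB1.
  by rewrite /C addrAC lerDr !addr_ge0 ?mulr_ge0.
have bh i j x : `|h i j x| <= C.
  rewrite (le_trans (ler_normD _ _))//.
  apply: le_trans (_ : B2 * M * M + B1 * M <= _); last first.
    by rewrite /C lerDr !addr_ge0 ?mulr_ge0.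
  rewrite addrC lerD// !normrM.
    by rewrite mulrC ler_pM ?mulr_ge0// ler_pM// TB2.
  by rewrite ler_pM// TB1.
by have [] := is_Cb2I dg dh ch bT bg bh.
Qed.

End test_functions.

(** * One-variable profiles with explicit derivatives *)

Section one_dim.
Context (R : realType).

Lemma is_derive_continuous (F F' : R -> R) :
  (forall u, is_derive u (1 : R) F (F' u)) -> continuous F.
Proof. by move=> FF' u; apply/differentiable_continuous; rewrite -derivable1_diffP. Qed.

(** This is [u^2 / (1 + u^2)]: quadratic at 0, increasing in [|u|] towards 1, and rational, so that
    its derivatives are explicit and globally bounded. *)
Definition rat_step (u : R) : R := 1 - (1 + u ^+ 2)^-1.
Definition rat_step1 (u : R) : R := 2 * u * (1 + u ^+ 2)^-1 ^+ 2.
Definition rat_step2 (u : R) : R := (2 - 6 * u ^+ 2) * (1 + u ^+ 2)^-1 ^+ 3.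

Let den_gt0 (u : R) : 0 < 1 + u ^+ 2.
Proof. by rewrite ltr_pwDl// sqr_ge0. Qed.

Let den_ge1 (u : R) : 1 <= 1 + u ^+ 2.
Proof. by rewrite lerDl sqr_ge0. Qed.

Let is_derive_sqr (u : R) : is_derive u (1 : R) (fun v => v ^+ 2) (2 * u).
Proof.
have -> : (fun v : R => v ^+ 2) = (@id R) ^+ 2 by apply/funext => v.
by apply: is_derive_eq; rewrite /GRing.scale /= mulr1 expr1 mulr_natl.
Qed.

Let is_derive_denV (u : R) : is_derive u (1 : R) (fun v => (1 + v ^+ 2)^-1)
  (- (2 * u) * (1 + u ^+ 2)^-1 ^+ 2).
Proof.
have h : is_derive u (1 : R) (fun v => 1 + v ^+ 2) (2 * u).
  rewrite -[2 * u]add0r.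
  exact: (is_deriveD (is_derive_cst (1 : R) u (1 : R)) (is_derive_sqr u)).
have := @is_deriveV R (fun v => 1 + v ^+ 2) u (2 * u) 1 (lt0r_neq0 (den_gt0 u)) h.
by rewrite /GRing.scale /= -exprVn mulNr mulrC mulNr.
Qed.

Lemma is_derive_rat_step (u : R) : is_derive u 1 rat_step (rat_step1 u).
Proof.
have := is_deriveB (is_derive_cst (1 : R) u (1 : R)) (is_derive_denV u).
by rewrite sub0r -mulNr opprK.
Qed.

Lemma is_derive_rat_step1 (u : R) : is_derive u 1 rat_step1 (rat_step2 u).
Proof.
have dV := is_deriveM (is_derive_denV u) (is_derive_denV u).
have d2 : is_derive u (1 : R) (fun v : R => 2 * v) 2.
  by apply: is_derive_eq; rewrite /GRing.scale /= mulr1.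
have := is_deriveM d2 dV.
rewrite (_ : _ * _ = rat_step1); last by apply/funext => v; rewrite /rat_step1 expr2.
move=> h; apply: is_derive_eq; rewrite /GRing.scale /= /rat_step2.
rewrite (_ : (_ * _ : R -> R) u = (1 + u ^+ 2)^-1 * (1 + u ^+ 2)^-1)//.
by field; rewrite gt_eqF.
Qed.

Lemma continuous_rat_step2 : continuous rat_step2.
Proof.
have cV : continuous (fun v : R => (1 + v ^+ 2)^-1).
  exact: is_derive_continuous is_derive_denV.
rewrite (_ : rat_step2 = (fun v => 2 - 6 * v ^+ 2) \* 
   ((fun v : R => (1 + v ^+ 2)^-1) \* ((fun v : R => (1 + v ^+ 2)^-1) \* (fun v : R => (1 + v ^+ 2)^-1))))//.
move=> u; apply: continuousM.
  apply: (@is_derive_continuous _ (fun v => 0 - 6 * (2 * v))) => {}u.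
  have := is_deriveB (is_derive_cst (2 : R) u (1 : R)) (is_deriveZ 6 (is_derive_sqr u)).
  by [].
by apply: continuousM; [exact: cV|apply: continuousM; exact: cV].
Qed.

Lemma rat_step1_bound u : `|rat_step1 u| <= 1.
Proof.
rewrite /rat_step1 exprVn normrM normfV (ger0_norm (exprn_ge0 _ (ltW (den_gt0 u)))).
rewrite ler_pdivrMr ?exprn_gt0// mul1r ler_norml.
have := den_ge1 u; have : 0 <= (u - 1) ^+ 2 by exact: sqr_ge0.
have : 0 <= (u + 1) ^+ 2 by exact: sqr_ge0.
by move=> h1 h2 h3; apply/andP; split; nra.
Qed.

Lemma rat_step2_bound u : `|rat_step2 u| <= 8.
Proof.
rewrite /rat_step2 exprVn normrM normfV (ger0_norm (exprn_ge0 _ (ltW (den_gt0 u)))).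
rewrite ler_pdivrMr ?exprn_gt0// ler_norml.
have h : 1 + u ^+ 2 <= (1 + u ^+ 2) ^+ 3 by rewrite ler_eXnr.
have h2 := sqr_ge0 u.
by apply/andP; split; lra.
Qed.

Lemma rat_step_ge0 u : 0 <= rat_step u.
Proof. by rewrite subr_ge0 invf_le1. Qed.

Lemma rat_step_lt1 u : rat_step u < 1.
Proof. by rewrite ltrBlDl ltrDr invr_gt0. Qed.

Lemma rat_step0 : rat_step 0 = 0.
Proof. by rewrite /rat_step expr0n addr0 invr1 subrr. Qed.

Lemma rat_step_le_sqr u : rat_step u <= u ^+ 2.
Proof.
rewrite /rat_step lerBlDr -[leLHS](mulfV (lt0r_neq0 (den_gt0 u))) -subr_ge0.
rewrite (_ : _ - _ = (u ^+ 2) ^+ 2 / (1 + u ^+ 2)); first by rewrite divr_ge0 ?sqr_ge0 ?ltW.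
by field; rewrite gt_eqF.
Qed.

Lemma rat_step_mono u v : `|u| <= `|v| -> rat_step u <= rat_step v.
Proof.
move=> uv; rewrite lerD2l lerN2 lef_pV2 ?posrE// lerD2l.
by rewrite -real_normK ?num_real// -[leRHS]real_normK ?num_real// lerXn2r ?nnegrE.
Qed.

Lemma rat_step_half u : 1 <= `|u| -> 2^-1 <= rat_step u.
Proof.
move=> u1; have <- : rat_step 1 = 2^-1 by rewrite /rat_step expr1n; field.
by apply: rat_step_mono; rewrite normr1.
Qed.

(** A quadratic remainder determines the derivative; this treats the gluing point of the piecewise
    functions below together with all other points. *)
Lemma is_derive_quadratic (F : R -> R) (x l K : R) :
  (forall h, `|h| <= 1 -> `|F (x + h) - F x - l * h| <= K * h ^+ 2) ->
  is_derive x 1 F l.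
Proof.
move=> FK.
have cl : h^-1 *: ((F \o shift x) (h *: (1 : R)) - F x) @[h --> (0 : R)^'] --> l.
  apply/cvgrPdist_le => /= eps eps0; near=> h.
  have h0 : h != 0 by near: h; exact: nbhs_dnbhs_neq.
  have h1 : `|h| <= 1.
    near: h; apply: dnbhs0_le; exact: ltr01.
  have he : `|h| <= eps / (`|K| + 1).
    by near: h; apply: dnbhs0_le; rewrite divr_gt0// ltr_wpDl.
  have -> : l - h^-1 *: (F (h *: 1 + x) - F x) = - h^-1 * (F (x + h) - F x - l * h).
    by rewrite [h *: 1]mulr1 [x + h]addrC /GRing.scale /=; field.
  rewrite normrM normrN normfV ler_pdivrMl ?normr_gt0// (le_trans (FK _ h1))//.
  rewrite -real_normK ?num_real// expr2 mulrCA ler_wpM2l//.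
  move: he; rewrite ler_pdivlMr ?ltr_wpDl// mulrC; apply: le_trans.
  by rewrite ler_wpM2r// (le_trans (ler_norm _))// lerDl.
by split; [apply/cvg_ex; exists l|exact/cvg_lim].
Unshelve. all: by end_near. Qed.

(** The cube is the first power of the positive part that is twice continuously differentiable. *)
Definition cube_pos (u : R) : R := Num.max u 0 ^+ 3.
Definition cube_pos1 (u : R) : R := 3 * Num.max u 0 ^+ 2.
Definition cube_pos2 (u : R) : R := 6 * Num.max u 0.

Lemma is_derive_cube_pos (u : R) : is_derive u 1 cube_pos (cube_pos1 u).
Proof.
apply: (@is_derive_quadratic _ _ _ (3 * `|u| + 4)) => h h1.
rewrite /cube_pos /cube_pos1.
case: (leP 0 u) => u0; case: (leP 0 (u + h)) => uh0.
- rewrite (ger0_norm u0).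
  rewrite (_ : _ - _ = (3 * u + h) * h ^+ 2); last ring.
  rewrite normrM (ger0_norm (sqr_ge0 _)) ler_wpM2r ?sqr_ge0//.
  by rewrite (le_trans (ler_normD _ _))// ger0_norm ?mulr_ge0//; lra.
- have k1 : - h <= 1 by move: h1; rewrite ler_norml; lra.
  rewrite (ger0_norm u0) expr0n /= sub0r.
  have a1 : u ^+ 2 * (- h) <= u * h ^+ 2.
    have : 0 <= u * (- h) * (- h - u) by rewrite !mulr_ge0//; lra.
    by nra.
  have a2 : u ^+ 3 <= u ^+ 2 * (- h) by rewrite exprSr ler_wpM2l ?sqr_ge0//; lra.
  have a3 : 0 <= u ^+ 3 by rewrite exprn_ge0.
  have a4 := sqr_ge0 h.
  by rewrite ler_norml; apply/andP; split; lra.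
- have k1 : h <= 1 by move: h1; rewrite ler_norml; lra.
  rewrite expr0n /= expr0n /= mulr0 mul0r !subr0.
  have a1 : (u + h) ^+ 3 <= h ^+ 2.
    rewrite exprS; apply: le_trans (_ : 1 * (u + h) ^+ 2 <= _).
      by rewrite ler_wpM2r ?sqr_ge0//; lra.
    by rewrite mul1r lerXn2r ?nnegrE//; lra.
  rewrite ger0_norm ?exprn_ge0// (le_trans a1)//.
  by rewrite ler_peMl ?sqr_ge0//; have := normr_ge0 u; lra.
- by rewrite !expr0n /= mulr0 mul0r !subr0 normr0 mulr_ge0 ?sqr_ge0 ?addr_ge0 ?mulr_ge0.
Qed.

Lemma is_derive_cube_pos1 (u : R) : is_derive u 1 cube_pos1 (cube_pos2 u).
Proof.
apply: (@is_derive_quadratic _ _ _ 9) => h h1.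
rewrite /cube_pos1 /cube_pos2.
have hh := sqr_ge0 h.
case: (leP 0 u) => u0; case: (leP 0 (u + h)) => uh0; rewrite ler_norml; apply/andP; split; nra.
Qed.

Lemma continuous_cube_pos2 : continuous cube_pos2.
Proof.
rewrite (_ : cube_pos2 = cst 6 \* (fun u => Num.max u 0))// => u.
apply: continuousM; first exact: cst_continuous.
by apply: (@continuous_max _ _ id (cst 0)); [exact: cvg_id|exact: cst_continuous].
Qed.

End one_dim.

(** * Bumps, and approximation of open sets by test functions *)

Section bumps.
Context (R : realType) (d : nat).
Implicit Types (x y a : 'rV[R]_d).
Local Notation e i := (delta_mx ord0 i : 'rV[R]_d).

(* A smooth bounded substitute for the squared distance to [a] at scale [s]. *)
Definition sqdist a (s : R) y : R := \sum_i rat_step (s^-1 * (y ord0 i - a ord0 i)).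

Let coord_derive (F F' : R -> R) (c t : R) y i j :
  (forall u, is_derive u (1 : R) F (F' u)) ->
  is_derive y (e j) (fun y => F (c * (y ord0 i - t)))
    ((j == i)%:R * (c * F' (c * (y ord0 i - t)))).
Proof.
move=> FF'; apply/is_derive_lineP; rewrite mulrA mulrC.
rewrite (_ : (fun u : R => _) =
  F \o (fun u : R => c * (j == i)%:R * u + c * (y ord0 i - t))); last first.
  by apply/funext => u /=; rewrite !mxE eqxx/= eq_sym; congr F; ring.
apply: is_derive1_comp.
  by rewrite mulr0 add0r.
have h1 := is_deriveZ (c * (j == i)%:R) (is_derive_id (0 : R) (1 : R)).
have h2 := is_derive_cst (c * (y ord0 i - t)) (0 : R) (1 : R).
have := is_deriveD h1 h2.
by rewrite addr0 /GRing.scale /= mulr1 mulrC.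
Qed.

Let sqdist1 a (s : R) j y : R := s^-1 * rat_step1 (s^-1 * (y ord0 j - a ord0 j)).
Let sqdist2 a (s : R) j k y : R :=
  (k == j)%:R * (s^-1 * s^-1 * rat_step2 (s^-1 * (y ord0 j - a ord0 j))).

Let sum_pick (F : 'I_d -> R) j : \sum_i (j == i)%:R * F i = F j.
Proof.
rewrite (bigD1 j)//= eqxx mul1r big1 ?addr0// => i ij.
by rewrite eq_sym (negbTE ij) mul0r.
Qed.

Let sqdist_derive a (s : R) j y : is_derive y (e j) (sqdist a s) (sqdist1 a s j y).
Proof.
have h i := coord_derive s^-1 (a ord0 i) y i j (@is_derive_rat_step R).
have := is_derive_sum h.
rewrite sum_pick (_ : \sum_(i < d) _ = sqdist a s)//.
by apply/funext => z; rewrite fct_sumE.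
Qed.

Let sqdist_derive2 a (s : R) j k y :
  is_derive y (e k) (sqdist1 a s j) (sqdist2 a s j k y).
Proof.
have h := coord_derive s^-1 (a ord0 j) y j k (@is_derive_rat_step1 R).
have := is_deriveZ s^-1 h.
by rewrite /sqdist2 /GRing.scale /= mulrCA !mulrA.
Qed.

(** Each summand is [rat_step] of a coordinate divided by [s], so every derivative costs a factor
    [s^-1]; mixed second derivatives vanish, and 8 is the bound on [rat_step2]. This scaling is what
    yields mean exit times of order [s^alpha]. *)
Lemma sqdist_Cb2 a (s : R) : 0 < s -> [/\ is_Cb2 (sqdist a s),
  forall i y, `|partial i (sqdist a s) y| <= s^-1 &
  forall i j y, `|partial j (partial i (sqdist a s)) y| <= 8 * s^-1 ^+ 2].
Proof.
move=> s0; have si0 : 0 <= s^-1 by rewrite invr_ge0 ltW.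
have b0 y : `|sqdist a s y| <= d%:R.
  apply: le_trans (ler_norm_sum _ _ _) _; rewrite -[leRHS]mulr1.
  by apply: sumr_le_const => i; rewrite ger0_norm ?rat_step_ge0// ltW// rat_step_lt1.
have b1 i y : `|sqdist1 a s i y| <= s^-1.
  by rewrite normrM (ger0_norm si0) ler_piMr// rat_step1_bound.
have b2 i j y : `|sqdist2 a s i j y| <= 8 * s^-1 ^+ 2.
  rewrite normrM normr_nat; apply: le_trans (_ : 1 * `|s^-1 * s^-1 *
      rat_step2 (s^-1 * (y ord0 i - a ord0 i))| <= _).
    by rewrite ler_wpM2r// lern1; case: (_ == _).
  rewrite mul1r normrM -expr2 (ger0_norm (sqr_ge0 _)) mulrC ler_wpM2r ?sqr_ge0//.
  exact: rat_step2_bound.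
have c2 i j : continuous (sqdist2 a s i j).
  rewrite (_ : sqdist2 a s i j = cst ((j == i)%:R * (s^-1 * s^-1)) \*
    (@rat_step2 R \o ( *%R s^-1 \o (fun y => y ord0 i - a ord0 i)))); last first.
    by apply/funext => y; rewrite /sqdist2 mulrA.
  move=> y; apply: continuousM; first exact: cst_continuous.
  apply: continuous_comp; last exact: continuous_rat_step2.
  apply: continuous_comp; last exact: mulrl_continuous.
  by apply: continuousB; [exact: coord_continuous|exact: cst_continuous].
pose M := d%:R + s^-1 + 8 * s^-1 ^+ 2.
have M1 : 0 <= 8 * s^-1 ^+ 2 by rewrite mulr_ge0 ?sqr_ge0.
have dd : 0 <= d%:R :> R by [].
have [||||||h1 h2 h3] := @is_Cb2I _ _ (sqdist a s) (sqdist1 a s) (sqdist2 a s) M.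
- by [].
- by [].
- by [].
- by move=> y; apply: le_trans (b0 y) _; rewrite /M; lra.
- by move=> i y; apply: le_trans (b1 i y) _; rewrite /M; lra.
- by move=> i j y; apply: le_trans (b2 i j y) _; rewrite /M; lra.
by split => // [i y|i j y]; rewrite ?h3 ?h2.
Qed.

Lemma sqdist_ge0 a s y : 0 <= sqdist a s y.
Proof. by apply: sumr_ge0 => i _; exact: rat_step_ge0. Qed.

Lemma sqdistxx a s : sqdist a s a = 0.
Proof. by apply: big1 => i _; rewrite subrr mulr0 rat_step0. Qed.

Lemma sqdist_far a s y : 0 < s -> s <= `|y - a| -> 2^-1 <= sqdist a s y.
Proof.
move=> s0 sy.
have [[i j] /= ij] : exists ij, `|y - a| = `|(y - a) ij.1 ij.2|.
  by apply: mx_norm_neq0; rewrite gt_eqF// (lt_le_trans s0).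
apply: le_trans (_ : rat_step (s^-1 * (y ord0 j - a ord0 j)) <= _).
  have si : 0 <= s^-1 by rewrite invr_ge0 ltW.
  apply: rat_step_half; rewrite normrM (ger0_norm si) ler_pdivlMl// mulr1.
  by move: ij; rewrite (ord1 i) !mxE => <-.
by rewrite /sqdist (bigD1 j)//= lerDl sumr_ge0// => k _; exact: rat_step_ge0.
Qed.

Lemma sqdist_near a s y (r : R) : 0 < s -> `|y - a| <= r -> sqdist a s y <= d%:R * (r / s) ^+ 2.
Proof.
move=> s0 yr; have si : 0 <= s^-1 by rewrite invr_ge0 ltW.
have r0 : 0 <= r by rewrite (le_trans _ yr).
apply: sumr_le_const => i; apply: le_trans (rat_step_le_sqr _) _.
rewrite -real_normK ?num_real// lerXn2r ?nnegrE//.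
  by rewrite mulr_ge0.
rewrite normrM mulrC (ger0_norm si) ler_wpM2r//.
by apply: le_trans yr; have := coord_le_norm (y - a) i; rewrite !mxE.
Qed.

(** Supported where [sqdist] is below [1/2], hence inside the ball of radius [s] by [sqdist_far]. *)
Definition bump a (s : R) y : R := cube_pos (2^-1 - sqdist a s y).

Lemma bump_Cb2 a (s : R) : 0 < s -> is_Cb2 (bump a s).
Proof.
move=> s0; have [h _ _] := sqdist_Cb2 a s0.
have dl (u : R) : is_derive u (1 : R) (fun u : R => 2^-1 - u) (- 1).
  have := is_deriveB (is_derive_cst (2^-1 : R) u (1 : R)) (is_derive_id u (1 : R)).
  by rewrite sub0r.
apply: (@is_Cb2_comp _ _ _ (fun u => cube_pos (2^-1 - u)) (fun u => cube_pos1 (2^-1 - u) * - 1)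
  (fun u => cube_pos2 (2^-1 - u) * - 1 * - 1) h) => [u|u|].
- exact: (is_derive1_comp (is_derive_cube_pos _) (dl u)).
- have := is_deriveZ (- 1) (is_derive1_comp (is_derive_cube_pos1 _) (dl u)).
  rewrite /GRing.scale /= mulrC; rewrite (_ : (-1 \*: _) = (fun u => cube_pos1 (2^-1 - u) * - 1))//.
  by apply/funext => v /=; rewrite mulrC.
- rewrite (_ : (fun _ => _) = (@cube_pos2 R \o (fun u => 2^-1 - u))); last first.
    by apply/funext => v /=; rewrite !mulrN1 opprK.
  move=> u; apply: continuous_comp; last exact: continuous_cube_pos2.
  exact: (is_derive_continuous dl).
Qed.

Lemma bump_ge0 a s y : 0 <= bump a s y.
Proof. by rewrite exprn_ge0// le_max lexx orbT. Qed.

Lemma bump_gt0 a s y : (0 < bump a s y) = (sqdist a s y < 2^-1).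
Proof.
rewrite /bump /cube_pos; case: (leP (2^-1 - sqdist a s y) 0).
  by rewrite subr_le0 expr0n /= ltxx ltNge => ->.
by rewrite subr_gt0 => h; rewrite h exprn_gt0// subr_gt0.
Qed.

End bumps.

Section open_approximation.
Context (R : realType) (d : nat).
Implicit Types (U : set 'rV[R]_d) (x y a : 'rV[R]_d).

Lemma continuous_measurable_rV (f : 'rV[R]_d -> R) :
  continuous f -> measurable_fun setT f.
Proof.
move=> cf; apply: (measurability _ (RGenOpens.measurableE R)) => _ [_ [a [b ->]] <-].
rewrite setTI; apply: open_measurable_rV.
by apply: open_comp => //; exact: interval_open.
Qed.

Lemma is_Cb2_measurable (f : 'rV[R]_d -> R) : is_Cb2 f -> measurable_fun setT f.
Proof. by move=> fC; apply: continuous_measurable_rV; exact: is_Cb2_continuous. Qed.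

Lemma rat_rV_dense y (r : R) : 0 < r ->
  exists Q : 'rV[rat]_d, `|y - map_mx ratr Q| < r.
Proof.
move=> r0.
have /choice[q qP] : forall j : 'I_d, exists q : rat, ball (y ord0 j) r (ratr q).
  move=> j; have [t [Bt [q _ qt]]] := @dense_rat R (ball (y ord0 j) r)
    (ex_intro _ _ (ballxx _ r0)) (ball_open _ _).
  by exists q; rewrite qt.
exists (\row_j q j).
suff : ball y r (map_mx ratr (\row_j q j) : 'rV[R]_d) by rewrite -ball_normE.
by split => // i j; rewrite !mxE ord1; exact: qP.
Qed.

(** The bumps of all balls inside [U] with rational centre and radius [1/(n+1)], enumerated by the
    pickling of countable types; codes of nothing and balls not inside [U] give the zero
    function. *)
Let slot U (k : nat) y : R :=
  if unpickle k is Some p then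
    (let: (Q, n) := (p : 'rV[rat]_d * nat) in
     let s := n.+1%:R^-1 in let a := map_mx ratr Q : 'rV[R]_d in
     if `[< ball a s `<=` U >] then bump a s y else 0)
  else 0.

Let slot_Cb2 U k : is_Cb2 (slot U k).
Proof.
rewrite /slot; case: unpickle => [[Q n]|]; last exact: is_Cb2_cst.
case: asbool; last exact: is_Cb2_cst.
by apply: bump_Cb2; rewrite invr_gt0.
Qed.

Let slot_ge0 U k y : 0 <= slot U k y.
Proof.
rewrite /slot; case: unpickle => [[Q n]|] //; case: ifP => // _.
exact: bump_ge0.
Qed.

Let slot_out U k y : ~ U y -> slot U k y = 0.
Proof.
move=> Uy; rewrite /slot; case: unpickle => [[Q n]|] //; case: ifP => // /asboolP sU.
apply/eqP; rewrite eq_le bump_ge0 andbT leNgt bump_gt0; apply/negP => h.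
apply/Uy/sU; rewrite -ball_normE /= distrC ltNge; apply/negP => /sqdist_far.
by rewrite invr_gt0 ltr0Sn => /(_ isT); rewrite leNgt h.
Qed.

Let slot_in U y : open U -> U y -> exists k, 0 < slot U k y.
Proof.
move=> oU Uy.
have /nbhs_ballP[eps /= eps0 eU] : nbhs y U by exact: open_nbhs_nbhs.
have [n ne] : exists n : nat, n.+1%:R^-1 < eps / 2 :> R.
  have e20 : 0 < eps / 2 by rewrite divr_gt0.
  have /cvgrPdist_lt/(_ _ e20) [n _ /(_ n (leqnn _))] := @cvg_harmonic R.
  by rewrite sub0r normrN /= ger0_norm// => ?; exists n.
pose s : R := n.+1%:R^-1; have s0 : 0 < s by rewrite invr_gt0.
(* A centre within [s / (2 * c)] of [y] gives [sqdist] at most [d / (2 * c)^2], which is below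
   [1/2]. *)
pose c : R := d%:R + 1; have c1 : 1 <= c by rewrite lerDr.
have c0 : 0 < c by exact: lt_le_trans c1.
have [Q yQ] := rat_rV_dense y (divr_gt0 s0 (mulr_gt0 (ltr0n _ 2) c0)).
exists (pickle (Q, n)); rewrite /slot pickleK asboolT; last first.
  move=> z; rewrite -ball_normE /= => Qz; apply: eU; rewrite -ball_normE /=.
  rewrite -(subrKA (map_mx ratr Q : 'rV[R]_d)) (le_lt_trans (ler_normD _ _))//.
  rewrite (splitr eps) ltrD ?(lt_trans Qz)// (lt_trans yQ)// (le_lt_trans _ ne)//.
  by rewrite -/s ler_pdivrMr ?mulr_gt0// ler_peMr ?(ltW s0)//; lra.
rewrite bump_gt0; apply: le_lt_trans (sqdist_near s0 (ltW yQ)) _.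
rewrite -/s (_ : s / (2 * c) / s = (2 * c)^-1); last first.
  by field; rewrite !gt_eqF.
have cc : c <= c ^+ 2 by rewrite ler_eXnr.
rewrite exprVn ltr_pdivrMr ?exprn_gt0 ?mulr_gt0// exprMn.
by rewrite /c in cc *; have : 0 <= d%:R :> R by []; lra.
Qed.

(** Partial sums of the slots are test functions, vanish outside [U] and are eventually bounded
    below by some positive number at each point of [U]. Multiplying by [n] and applying [rat_step]
    pushes them up to 1 while keeping monotonicity and the bound by 1. *)
Lemma open_approximation U : open U ->
  exists f : nat -> 'rV[R]_d -> R, [/\ forall n, is_Cb2 (f n),
    forall n y, 0 <= f n y <= 1, forall n y, ~ U y -> f n y = 0,
    forall y, nondecreasing_seq (fun n => f n y) &
    forall y, f n y @[n --> \oo] --> (\1_U y : R)].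
Proof.
move=> oU; pose G n y := \sum_(k < n) slot U k y.
have G0 n y : 0 <= G n y by apply: sumr_ge0.
have Gnd y : {homo G ^~ y : m n / (m <= n)%N >-> m <= n}.
  by apply: homo_leq => // [|n]; [exact: le_trans|rewrite /G big_ord_recr/= lerDl].
pose f n y := rat_step (n%:R * G n y).
have fnd y : nondecreasing_seq (fun n => f n y).
  move=> m n mn; apply: rat_step_mono; rewrite !ger0_norm ?mulr_ge0//.
  by rewrite ler_pM// ?ler_nat ?Gnd.
have fout n y : ~ U y -> f n y = 0.
  by move=> Uy; rewrite /f /G big1 ?mulr0 ?rat_step0// => k _; exact: slot_out.
have dl (n : nat) (u : R) : is_derive u (1 : R) ( *%R n%:R) n%:R.
  by have := is_deriveZ n%:R (is_derive_id u (1 : R)); rewrite /GRing.scale /= mulr1.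
exists f; split => //.
- move=> n.
  apply: (@is_Cb2_comp _ _ (G n) (fun u => rat_step (n%:R * u))
    (fun u => n%:R * rat_step1 (n%:R * u)) (fun u => n%:R * (n%:R * rat_step2 (n%:R * u)))).
  + exact: is_Cb2_sum.
  + by move=> u; rewrite mulrC; exact: (is_derive1_comp (is_derive_rat_step (n%:R * u)) (dl n u)).
  + move=> u; have := is_deriveZ n%:R (is_derive1_comp (is_derive_rat_step1 (n%:R * u)) (dl n u)).
    by rewrite /GRing.scale /= [_ * n%:R]mulrC.
  + rewrite (_ : (fun _ => _) = cst n%:R \* (cst n%:R \* (@rat_step2 R \o *%R n%:R)))// => u.
    apply: continuousM; first exact: cst_continuous.
    apply: continuousM; first exact: cst_continuous.
    apply: continuous_comp; last exact: continuous_rat_step2.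
    exact: mulrl_continuous.
- by move=> n y; rewrite rat_step_ge0 ltW ?rat_step_lt1.
move=> y; rewrite indicE; case: (boolP (y \in U)); last first.
  rewrite notin_setE => Uy; rewrite (_ : (fun n => f n y) = cst 0); first exact: cvg_cst.
  by apply/funext => n; rewrite fout.
rewrite inE => /(slot_in oU)[k gk].
pose c := slot U k y.
apply/cvgrPdist_le => /= eps eps0; near=> n.
have nk : (k < n)%N by near: n; exact: nbhs_infty_gt.
have cG : c <= G n y.
  apply: le_trans (Gnd y _ _ nk); rewrite /G big_ord_recr/= lerDr.
  by apply: sumr_ge0.
have n1 : (0 < n)%N by exact: leq_ltn_trans nk.
rewrite ger0_norm ?subr_ge0 ?(ltW (rat_step_lt1 _))// /f /rat_step opprB addrC subrK.
(* The gap to 1 is [1 / (1 + v^2)] with [v = n * G n y >= n * c], and [n <= n^2]. *)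
apply: le_trans (_ : (n%:R * c ^+ 2)^-1 <= _).
  rewrite lef_pV2 ?posrE ?mulr_gt0 ?exprn_gt0 ?ltr0n//; last first.
    by rewrite ltr_pwDl// sqr_ge0.
  apply: le_trans (_ : (n%:R * c) ^+ 2 <= _).
    by rewrite exprMn ler_wpM2r ?sqr_ge0// ler_eXnr// ler1n.
  apply: le_trans (_ : (n%:R * G n y) ^+ 2 <= _); last by rewrite lerDr.
  by rewrite lerXn2r ?nnegrE ?mulr_ge0 ?(ltW gk)// ler_wpM2l.
rewrite invfM ler_pdivrMl ?ltr0n// -ler_pdivrMr//.
near: n; exact: nbhs_infty_ger.
Unshelve. all: by end_near. Qed.

End open_approximation.

(** * Dyadic exit times and optional stopping *)

Section path_exit.
Context (R : realType) (d : nat).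
Implicit Types (w : R -> 'rV[R]_d) (F : set 'rV[R]_d).

Lemma right_continuousP w (u : R) : w s @[s --> u^'+] --> w u ->
  forall eps, 0 < eps -> exists2 del, 0 < del &
    forall v, u <= v < u + del -> `|w u - w v| < eps.
Proof.
move=> /(@cvgrPdist_lt _ _ _ (u^'+)) h eps eps0; have [del /= del0 hd] := h eps eps0.
exists del => // v /andP[].
rewrite le_eqVlt => /predU1P[<- _|uv vd]; first by rewrite subrr normr0.
by apply: hd => //=; rewrite distrC ger0_norm ?subr_ge0 ?(ltW uv)//; lra.
Qed.

Definition grid (t : R) (n j : nat) : R := t * j%:R / (2 ^ n)%:R.

(** If the path stays in [F] on the grid, [find] returns the length [2 ^ n], which designates the
    time [t]: this is the cap. The position at time [t] itself is never tested. *)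
Definition first_exit_index F t n w : nat :=
  find (fun j => ~~ `[< F (w (grid t n j)) >]) (iota 0 (2 ^ n)).

(* The first time of the dyadic grid of mesh [t / 2 ^ n] at which the path is
   outside [F], capped at [t]. *)
Definition grid_exit F t n w : R := grid t n (first_exit_index F t n w).

(** The limit of the grid exits from the right, so that right continuity of the path carries
    positions to the limit and measurability is inherited from countably many times. *)
Definition dyadic_exit F t w : R := inf (range (fun n => grid_exit F t n w)).

Section fixed.
Context (F : set 'rV[R]_d) (t : R) (w : R -> 'rV[R]_d).
Hypothesis t0 : 0 < t.
Hypothesis clF : closed F.
Hypothesis rcw : forall u, 0 <= u -> w s @[s --> u^'+] --> w u.

Lemma grid_max n : grid t n (2 ^ n) = t.
Proof. by rewrite /grid mulfK// pnatr_eq0 expn_eq0. Qed.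

Lemma grid_ge0 n j : 0 <= grid t n j.
Proof. by rewrite /grid !mulr_ge0// ?invr_ge0// ltW. Qed.

Lemma le_grid n i j : (i <= j)%N -> grid t n i <= grid t n j.
Proof. by move=> ij; rewrite /grid ler_wpM2r ?invr_ge0// ler_wpM2l ?ler_nat// ltW. Qed.

Lemma lt_grid_max n j : grid t n j < t -> (j < 2 ^ n)%N.
Proof. by move=> h; rewrite ltnNge; apply/negP => /(le_grid n); rewrite grid_max leNgt h. Qed.

Lemma gridS n j : grid t n.+1 (2 * j) = grid t n j.
Proof. by rewrite /grid expnS !natrM; field; rewrite pnatr_eq0 expn_eq0. Qed.

Lemma first_exit_index_le n : (first_exit_index F t n w <= 2 ^ n)%N.
Proof. by rewrite -[leqRHS](size_iota 0) find_size. Qed.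

Lemma first_exit_index_min n j : (j < first_exit_index F t n w)%N -> F (w (grid t n j)).
Proof.
move=> jn; have jN := leq_trans jn (first_exit_index_le n).
by have := before_find 0%N jn; rewrite nth_iota// add0n => /negbFE/asboolP.
Qed.

Lemma first_exit_indexP n : (first_exit_index F t n w < 2 ^ n)%N ->
  ~ F (w (grid t n (first_exit_index F t n w))).
Proof.
move=> h.
have := @nth_find _ 0%N (fun j => ~~ `[< F (w (grid t n j)) >]) (iota 0 (2 ^ n)).
rewrite has_find size_iota => /(_ h).
by rewrite nth_iota// add0n => /asboolPn.
Qed.

Lemma first_exit_index_ub n j : (j < 2 ^ n)%N -> ~ F (w (grid t n j)) ->
  (first_exit_index F t n w <= j)%N.
Proof. by move=> jN nF; rewrite leqNgt; apply/negP => /first_exit_index_min. Qed.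

Lemma grid_exit_ge0 n : 0 <= grid_exit F t n w.
Proof. exact: grid_ge0. Qed.

Lemma grid_exit_le n : grid_exit F t n w <= t.
Proof. by rewrite -[leRHS](grid_max n) le_grid// first_exit_index_le. Qed.

(** The grids are nested: a grid time outside [F] is still a candidate at the next level. *)
Lemma grid_exit_noninc : nonincreasing_seq (fun n => grid_exit F t n w).
Proof.
apply/nonincreasing_seqP => n.
have := first_exit_index_le n; rewrite leq_eqVlt => /predU1P[e|h].
  by rewrite [leRHS]/grid_exit e grid_max grid_exit_le.
rewrite -[leRHS]gridS le_grid// first_exit_index_ub//.
  by rewrite expnS ltn_pmul2l.
by rewrite gridS; exact: first_exit_indexP.
Qed.

Let has_lb : has_lbound (range (fun n => grid_exit F t n w)).
Proof. by exists 0 => _ [n _ <-]; exact: grid_exit_ge0. Qed.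

Lemma grid_exit_cvg : grid_exit F t n w @[n --> \oo] --> dyadic_exit F t w.
Proof. exact: nonincreasing_cvgn grid_exit_noninc has_lb. Qed.

Lemma dyadic_exit_le_grid n : dyadic_exit F t w <= grid_exit F t n w.
Proof. by apply: ge_inf => //; exists n. Qed.

Lemma dyadic_exit_ge0 : 0 <= dyadic_exit F t w.
Proof.
by apply: lb_le_inf; [exists (grid_exit F t 0 w), 0%N|move=> _ [n _ <-]; exact: grid_exit_ge0].
Qed.

Lemma dyadic_exit_le : dyadic_exit F t w <= t.
Proof. exact: le_trans (dyadic_exit_le_grid 0) (grid_exit_le 0). Qed.

Lemma grid_dense (u v : R) : 0 <= u -> u < v -> exists n j, u <= grid t n j < v.
Proof.
move=> u0 uv.
have h : t / (v - u) < (Num.bound (t / (v - u)))%:R.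
  by rewrite archi_boundP// divr_ge0 ?(ltW t0)// subr_ge0 ltW.
set n := Num.bound _ in h; exists n, (Num.truncn (u * (2 ^ n)%:R / t)).+1.
have N0 : 0 < (2 ^ n)%:R :> R by rewrite ltr0n expn_gt0.
have /truncn_itv/andP[k1 k2] : 0 <= u * (2 ^ n)%:R / t.
  by rewrite mulr_ge0 ?invr_ge0 ?(ltW t0)// mulr_ge0// ltW.
have e : u * (2 ^ n)%:R / t * t / (2 ^ n)%:R = u by field; rewrite !gt_eqF.
rewrite /grid; apply/andP; split.
  by rewrite -[leLHS]e ler_wpM2r ?invr_ge0 ?(ltW N0)// mulrC ler_wpM2l ?(ltW t0)// ltW.
rewrite -natr1 mulrDr mulr1 mulrDl.
have a1 : t * (Num.truncn (u * (2 ^ n)%:R / t))%:R / (2 ^ n)%:R <= u.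
  by rewrite -[leRHS]e ler_wpM2r ?invr_ge0 ?(ltW N0)// mulrC ler_wpM2r ?(ltW t0).
have a2 : t / (2 ^ n)%:R < v - u.
  rewrite ltr_pdivrMr// -ltr_pdivrMl ?subr_gt0// mulrC (lt_trans h)//.
  by rewrite ltr_nat ltn_expl.
lra.
Qed.

(** Since [F] is closed and the path right continuous, being outside [F] at [u] persists for a short
    while and is seen at some grid time, which would then precede the infimum. *)
Lemma before_dyadic_exit u : 0 <= u -> u < dyadic_exit F t w -> F (w u).
Proof.
move=> u0 uS; apply: contrapT => nF.
have : open (~` F) by exact: closed_openC.
move=> oF; have /nbhs_ballP[eps /= eps0 eF] : nbhs (w u) (~` F) by exact: open_nbhs_nbhs.
have [del del0 hd] := right_continuousP (rcw u0) eps0.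
have [|n [j /andP[j1 j2]]] := @grid_dense u (Num.min (u + del) (dyadic_exit F t w)) u0.
  by rewrite lt_min uS ltrDl del0.
move: j2; rewrite lt_min => /andP[j2 j3].
have jF : ~ F (w (grid t n j)).
  by apply: eF; rewrite -ball_normE /=; apply: hd; rewrite j1 j2.
have jN : (j < 2 ^ n)%N by exact: lt_grid_max (lt_le_trans j3 dyadic_exit_le).
have := le_trans (dyadic_exit_le_grid n) (le_grid n (first_exit_index_ub jN jF)).
by rewrite leNgt j3.
Qed.

Lemma grid_exit_path_cvg eps : 0 < eps ->
  \forall n \near \oo, `|w (dyadic_exit F t w) - w (grid_exit F t n w)| < eps.
Proof.
move=> eps0; have [del del0 hd] := right_continuousP (rcw dyadic_exit_ge0) eps0.
have /cvgrPdist_lt/(_ _ del0) := grid_exit_cvg.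
apply: filterS => n h; apply: hd; rewrite dyadic_exit_le_grid/=.
by move: h; rewrite ltr_norml => /andP[h1 h2]; lra.
Qed.

(** Before the cap the grid exits are positions outside [F], and they converge to the exit position,
    which therefore cannot be interior to [F]. It may still lie on the boundary, hence the open
    [V]. *)
Lemma dyadic_exit_lt_max V : open V -> V `<=` F -> dyadic_exit F t w < t ->
  ~ V (w (dyadic_exit F t w)).
Proof.
move=> oV VF St VS.
have /nbhs_ballP[eps /= eps0 eV] : nbhs (w (dyadic_exit F t w)) V by exact: open_nbhs_nbhs.
have h1 := grid_exit_path_cvg eps0.
have h2 : \forall n \near \oo, grid_exit F t n w < t.
  by apply: (cvgr_lt _ grid_exit_cvg).
have [n [{}h1 {}h2]] := filter_ex (filterI h1 h2).
apply: (@first_exit_indexP n); first exact: lt_grid_max h2.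
by apply/VF/eV; rewrite -ball_normE.
Qed.

End fixed.
End path_exit.

Section stopped_integral.
Context (R : realType).
Local Notation mu := (@lebesgue_measure R).

Let step (S hi C u : R) : R := hi + (C - hi) * \1_(`[S, +oo[%classic) u.

Let stepE1 (S hi C u : R) : u < S -> step S hi C u = hi.
Proof. by move=> uS; rewrite /step indicE memNset ?mulr0 ?addr0//= in_itv/= andbT leNgt uS. Qed.

Let stepE2 (S hi C u : R) : S <= u -> step S hi C u = C.
Proof. by move=> uS; rewrite /step indicE mem_set ?mulr1 ?subrKC//= in_itv/= andbT. Qed.

Let step_integrable S hi C (s : R) : mu.-integrable `[0, s]%classic (EFin \o step S hi C).
Proof.
apply: measurable_bounded_integrable => //.
- rewrite /= lebesgue_measure_itv/=; case: ifPn => // _.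
  by rewrite -EFinD ltry.
- apply: measurable_funD => //; apply: measurable_funM => //.
- exists (`|hi| + `|C|); split; first exact: num_real.
  move=> M hM u _; apply: le_trans (_ : `|step S hi C u| <= _) (ltW hM).
  by have [h|h] := ltP u S; [rewrite stepE1// lerDl|rewrite stepE2// lerDr].
Qed.

Let step_Rintegral (S hi C s : R) : 0 <= S <= s ->
  \int[mu]_(u in `[0, s]) step S hi C u = hi * S + C * (s - S).
Proof.
move=> /andP[S0 Ss].
have e : `[0, s]%classic = `[0, S[%classic `|` `[S, s]%classic.
  by rewrite -itv_bndbnd_setU// bnd_simp.
rewrite e Rintegral_setU//=; last 2 first.
- by rewrite -e; exact: step_integrable.
- rewrite disj_set2E; apply/eqP/seteqP; split => // u [] /=; rewrite !in_itv/=; lra.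
congr (_ + _).
  rewrite (@eq_Rintegral _ _ _ _ _ (cst hi)); last first.
    by move=> u; rewrite inE/= in_itv/= => /andP[_ uS]; rewrite stepE1.
  rewrite Rintegral_cst//= lebesgue_measure_itv/= lte_fin.
  by case: ltP => h /=; rewrite ?subr0//; congr (_ * _); lra.
rewrite (@eq_Rintegral _ _ _ _ _ (cst C)); last first.
  by move=> u; rewrite inE/= in_itv/= => /andP[Su _]; rewrite stepE2.
rewrite Rintegral_cst//= lebesgue_measure_itv/= lte_fin.
by case: ltP => h //=; congr (_ * _); lra.
Qed.

(** [g] is squeezed between two step functions with a jump at [S]. Monotonicity of the integral
    needs no measurability, and the squeeze also shows that the integral of [g] is finite. *)
Lemma le_stopped_Rintegral (g : R -> R) (S s lo hi C : R) : 0 <= S <= s ->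
  (forall u : R, 0 <= u < S -> lo <= g u <= hi) ->
  (forall u : R, S <= u <= s -> `|g u| <= C) ->
  lo * S - C * (s - S) <= \int[mu]_(u in `[0, s]) g u <= hi * S + C * (s - S).
Proof.
move=> Ss gS gC.
have fin c1 c2 : (\int[mu]_(u in `[0%R, s]) (step S c1 c2 u)%:E)%E \is a fin_num.
  exact: integrable_fin_num (step_integrable S c1 c2 s).
have lb : (\int[mu]_(u in `[0%R, s]) (step S lo (- C)%R u)%:E <= \int[mu]_(u in `[0%R, s]) (g u)%:E)%E.
  apply: le_lower_integral => u /=; rewrite in_itv/= lee_fin => /andP[u0 us].
  have [uS|Su] := ltP u S; first by rewrite stepE1//; have /andP[] := gS _ (introT andP (conj u0 uS)).
  by rewrite stepE2//; have := gC u; rewrite Su us ler_norml => /(_ isT)/andP[].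
have ub : (\int[mu]_(u in `[0%R, s]) (g u)%:E <= \int[mu]_(u in `[0%R, s]) (step S hi C u)%:E)%E.
  apply: le_lower_integral => u /=; rewrite in_itv/= lee_fin => /andP[u0 us].
  have [uS|Su] := ltP u S; first by rewrite stepE1//; have /andP[] := gS _ (introT andP (conj u0 uS)).
  by rewrite stepE2//; have := gC u; rewrite Su us ler_norml => /(_ isT)/andP[].
have fg : (\int[mu]_(u in `[0%R, s]) (g u)%:E)%E \is a fin_num.
  by rewrite fin_numElt (lt_le_trans _ lb) ?(le_lt_trans ub)//; move: (fin lo (- C)) (fin hi C);
    rewrite !fin_numElt => /andP[? ?] /andP[].
rewrite -mulNr -step_Rintegral// -step_Rintegral//.
by rewrite /Rintegral !fine_le.
Qed.

End stopped_integral.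

Section filtration_lemmas.
Context (R : realType) (d : nat) (dO : measure_display) (Omega : measurableType dO).
Context (X : R -> Omega -> 'rV[R]_d).
Hypothesis mX : forall t, 0 <= t -> measurable_fun setT (X t).

Lemma sigma_X_setC I A : sigma_X X I A -> sigma_X X I (~` A).
Proof. exact: sigma_algebraC. Qed.

Lemma sigma_X_setI I A B : sigma_X X I A -> sigma_X X I B -> sigma_X X I (A `&` B).
Proof.
move=> hA hB; set G := [set A | exists2 s, I s & exists2 B, measurable B & A = X s @^-1` B].
exact: (@measurableI _ (g_sigma_algebraType G) A B).
Qed.

Lemma sigma_X_setT I : sigma_X X I setT.
Proof.
by rewrite -setC0; apply: sigma_X_setC; exact: sigma_algebra0.
Qed.

Lemma filtration_measurable t A : 0 <= t -> filtration X t A -> measurable A.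
Proof.
move=> t0 /(_ (t + 1)) /=; rewrite ltrDl ltr01 => /(_ isT).
apply: smallest_sub; first exact: sigma_algebra_measurable.
move=> _ [s /= /andP[s0 _] [B mB ->]].
by rewrite -[X in measurable X]setTI; exact: mX.
Qed.

Lemma filtrationI t A B : filtration X t A -> filtration X t B -> filtration X t (A `&` B).
Proof. by move=> hA hB u tu; apply: sigma_X_setI; [exact: hA|exact: hB]. Qed.

Lemma filtrationC t A : filtration X t A -> filtration X t (~` A).
Proof. by move=> hA u tu; apply: sigma_X_setC; exact: hA. Qed.

Lemma filtrationT t : filtration X t setT.
Proof. by move=> u tu; exact: sigma_X_setT. Qed.

Lemma filtration_preimage s t B : 0 <= s <= t -> measurable B ->
  filtration X t (X s @^-1` B).
Proof.
move=> /andP[s0 st] mB u /= tu; apply: sub_gen_smallest; exists s; last by exists B.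
by rewrite /= s0 ltW// (le_lt_trans st).
Qed.

Lemma filtration_forall_lt t (A : nat -> set Omega) n :
  (forall i, (i < n)%N -> filtration X t (A i)) ->
  filtration X t [set w | forall i, (i < n)%N -> A i w].
Proof.
elim: n => [|n IH] h.
  by rewrite (_ : [set _ | _] = setT)//; [exact: filtrationT|apply/seteqP].
rewrite (_ : [set _ | _] = [set w | forall i, (i < n)%N -> A i w] `&` A n).
  by apply: filtrationI; [apply: IH => i ni; apply: h; exact: ltnW|exact: h].
apply/seteqP; split=> w.
  by move=> /= hw; split; [move=> i /ltnW; exact: hw|exact: hw].
by move=> [/= hw An] i; rewrite ltnS leq_eqVlt => /predU1P[->|/hw].
Qed.

End filtration_lemmas.

Section exit_level.
Context (R : realType) (d : nat) (dO : measure_display) (Omega : measurableType dO).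
Context (X : R -> Omega -> 'rV[R]_d) (F : set 'rV[R]_d) (t : R).
Hypothesis clF : closed F.
Hypothesis t0 : 0 < t.

Let J n w := first_exit_index F t n (X ^~ w).

Lemma closed_measurable_rV (A : set 'rV[R]_d) : closed A -> measurable A.
Proof. by move=> clA; rewrite -[A]setCK; apply: measurableC; apply: open_measurable_rV; exact: closed_openC. Qed.

Let mF : measurable F.
Proof. exact: closed_measurable_rV. Qed.

Definition exit_level n j : set Omega := [set w | J n w = j].

(** The event is read off the positions at grid times up to the [j]-th: inside [F] strictly before,
    outside at [j]. For [j = 2 ^ n] the second condition is void, in accordance with the cap. *)
Lemma level_filtration n j : (j <= 2 ^ n)%N -> filtration X (grid t n j) (exit_level n j).
Proof.
move=> jN.
have fF i : (i <= j)%N -> filtration X (grid t n j) (X (grid t n i) @^-1` F).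
  by move=> ij; apply: filtration_preimage => //; rewrite grid_ge0//= le_grid.
rewrite (_ : exit_level n j = [set w | forall i, (i < j)%N -> F (X (grid t n i) w)] `&`
  [set w | (j < 2 ^ n)%N -> ~ F (X (grid t n j) w)]).
  apply: filtrationI.
    by apply: (@filtration_forall_lt _ _ _ _ _ _ (fun i => X (grid t n i) @^-1` F)) => i /ltnW; exact: fF.
  case: ltnP => h.
    rewrite (_ : [set _ | _] = ~` (X (grid t n j) @^-1` F)).
      by apply: filtrationC; exact: fF.
    by apply/seteqP; split=> w /=; [exact|].
  by rewrite (_ : [set _ | _] = setT)//; [exact: filtrationT|apply/seteqP].
apply/seteqP; split=> w /=.
  move=> <-; split => [i|]; first exact: first_exit_index_min.
  exact: first_exit_indexP.
move=> [h1 h2]; apply/eqP; rewrite eqn_leq; apply/andP; split.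
  move: jN; rewrite leq_eqVlt => /predU1P[->|jN]; first exact: first_exit_index_le.
  by apply: first_exit_index_ub => //; exact: h2.
rewrite leqNgt; apply/negP => Jj; apply: (first_exit_indexP _ (h1 _ Jj)).
exact: leq_trans Jj jN.
Qed.

End exit_level.

Section optional_stopping.
Context (R : realType) (d : nat) (dO : measure_display) (Omega : measurableType dO).
Context (X : R -> Omega -> 'rV[R]_d) (Q : probability Omega R).
Context (F : set 'rV[R]_d) (t : R) (M : R -> Omega -> R).
Hypothesis mX : forall t, 0 <= t -> measurable_fun setT (X t).
Hypothesis clF : closed F.
Hypothesis t0 : 0 < t.
Hypothesis martM : martingale X Q M.

Let J n w := first_exit_index F t n (X ^~ w).

Let level n j : set Omega := exit_level X F t n j.

Let cut n a j : set Omega := level n j `&` [set w | `|M (grid t n j) w| <= a].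

Let cut_filtration n a j : (j <= 2 ^ n)%N -> filtration X (grid t n j) (cut n a j).
Proof.
move=> jN; apply: filtrationI; first exact: level_filtration.
have [adM _ _] := martM.
rewrite (_ : [set _ | _] = M (grid t n j) @^-1` `[(- a), a]%classic).
  by apply: adM => //; exact: grid_ge0.
by apply/seteqP; split => w /=; rewrite in_itv/= ler_norml.
Qed.

Definition stopped n w := M (grid_exit F t n (X ^~ w)) w.

(* Both truncations below are taken on the same event, which belongs to the
   stopped sigma-algebra: this replaces uniform integrability. *)
Definition stopped_trunc n a w := if `|stopped n w| <= a then stopped n w else 0.
Definition final_trunc n a w := if `|stopped n w| <= a then M t w else 0.

(** The events [cut n a j] are disjoint in [j], so at most one summand survives, that of the actual
    exit index. *)
Let truncE (N : nat -> Omega -> R) n a w :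
  (if `|stopped n w| <= a then N (J n w) w else 0) =
  \sum_(j < (2 ^ n).+1) (N j \_ (cut n a j)) w.
Proof.
have JN : (J n w < (2 ^ n).+1)%N by rewrite ltnS first_exit_index_le.
rewrite (bigD1 (Ordinal JN))//= big1 ?addr0; last first.
  move=> i iJ; rewrite patchE memNset// => -[/= e _].
  by move/negP: iJ; apply; apply/eqP/val_inj => /=.
rewrite patchE; case: ifPn => h; first by rewrite mem_set.
by rewrite memNset// => -[_ /=]; apply/negP.
Qed.

Let mM s : 0 <= s -> measurable_fun setT (M s).
Proof.
move=> s0; have [_ /(_ _ s0) + _] := martM.
by move=> /(measurable_int Q)/measurable_EFinP.
Qed.

Let mcut n a j : (j <= 2 ^ n)%N -> measurable (cut n a j).
Proof.
by move=> jN; apply: (filtration_measurable mX _ (cut_filtration a jN)); exact: grid_ge0.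
Qed.

Let ordN n (j : 'I_(2 ^ n).+1) : (j <= 2 ^ n)%N. Proof. by rewrite -ltnS. Qed.

Let mtrunc (N : nat -> Omega -> R) n a :
  (forall j, (j <= 2 ^ n)%N -> measurable_fun setT (N j)) ->
  measurable_fun setT (fun w => if `|stopped n w| <= a then N (J n w) w else 0).
Proof.
move=> mN; under eq_fun do rewrite truncE.
apply: measurable_sum => j; apply/measurable_restrict => //; first exact: mcut.
by rewrite setTI; apply: measurable_funTS; exact: mN.
Qed.

Lemma measurable_stopped_trunc n a : measurable_fun setT (stopped_trunc n a).
Proof. by apply: (@mtrunc (fun j => M (grid t n j))) => j _; apply: mM; exact: grid_ge0. Qed.

Lemma measurable_final_trunc n a : measurable_fun setT (final_trunc n a).
Proof. by apply: (@mtrunc (fun j => M t)) => j _; apply: mM; exact: ltW. Qed.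

(** Optional stopping for a time with finitely many values: the truncation looks only at the
    martingale at the stopping time, so each [cut] is known at its grid time and the martingale
    property applies there. *)
Lemma stopped_trunc_mean n a :
  (\int[Q]_w (stopped_trunc n a w)%:E = \int[Q]_w (final_trunc n a w)%:E)%E.
Proof.
have [_ iM mart] := martM.
have intN s j : 0 <= s -> (j <= 2 ^ n)%N -> Q.-integrable setT (EFin \o (M s \_ (cut n a j))).
  move=> s0 jN; rewrite -restrict_EFin; apply/(integrable_mkcond _ (mcut a jN)).
  by apply: (integrableS _ _ _ (iM _ s0)) => //; exact: mcut.
have e (s : nat -> R) : (forall j, (j <= 2 ^ n)%N -> 0 <= s j) ->
    (\int[Q]_w (\sum_(j < (2 ^ n).+1) (M (s j) \_ (cut n a j)) w)%:E =
    \sum_(j < (2 ^ n).+1) \int[Q]_(w in cut n a j) (M (s j) w)%:E)%E.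
  move=> s0; under eq_integral do rewrite -sumEFin.
  rewrite integral_sum//; last by move=> j; apply: intN; [exact: s0|].
  apply: eq_bigr => j _; rewrite [RHS]integral_mkcond.
  by apply: eq_integral => w _; rewrite restrict_EFin.
rewrite /stopped_trunc /final_trunc /stopped.
under eq_integral do rewrite (truncE (fun j => M (grid t n j))).
rewrite (e (grid t n)); last by move=> j _; exact: grid_ge0.
under [RHS]eq_integral do rewrite (truncE (fun j => M t)).
rewrite (e (fun=> t)); last by move=> j _; exact: ltW.
apply: eq_bigr => j _; apply/esym/mart.
- exact: grid_ge0.
- by rewrite -[leRHS](grid_max t n) le_grid.
- exact: cut_filtration.
Qed.

End optional_stopping.

Section measurable_exit.
Context (R : realType) (d : nat) (dO : measure_display) (Omega : measurableType dO).
Context (X : R -> Omega -> 'rV[R]_d) (F : set 'rV[R]_d) (t : R).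
Hypothesis mX : forall t, 0 <= t -> measurable_fun setT (X t).
Hypothesis rcX : forall w u, 0 <= u -> X s w @[s --> u^'+] --> X u w.
Hypothesis clF : closed F.
Hypothesis t0 : 0 < t.

Let J n w := first_exit_index F t n (X ^~ w).

Lemma measurable_at_exit_index (N : nat -> Omega -> R) n :
  (forall j, measurable_fun setT (N j)) ->
  measurable_fun setT (fun w => N (first_exit_index F t n (X ^~ w)) w).
Proof.
move=> mN.
rewrite (_ : (fun _ => _) = (fun w => \sum_(j < (2 ^ n).+1)
    (N j \_ [set w | J n w = j]) w)); last first.
  apply/funext => w; have JN : (J n w < (2 ^ n).+1)%N by rewrite ltnS first_exit_index_le.
  rewrite (bigD1 (Ordinal JN))//= big1 ?addr0; last first.
    move=> i iJ; rewrite patchE memNset// => /= e.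
    by move/negP: iJ; apply; apply/eqP/val_inj => /=.
  by rewrite patchE mem_set.
apply: measurable_sum => j; apply/measurable_restrict => //.
  have jN : (j <= 2 ^ n)%N by rewrite -ltnS.
  apply: (filtration_measurable mX (grid_ge0 t0 n j)).
  exact: level_filtration.
by rewrite setTI; exact: measurable_funTS.
Qed.

Lemma measurable_dyadic_exit : measurable_fun setT (fun w => dyadic_exit F t (X ^~ w)).
Proof.
apply: (@measurable_fun_cvg _ _ _ _ (fun n w => grid_exit F t n (X ^~ w))) => // [n|w _].
  by apply: (@measurable_at_exit_index (fun j _ => grid t n j)) => j; exact: measurable_cst.
exact: grid_exit_cvg.
Qed.

Lemma measurable_at_dyadic_exit :
  measurable_fun setT (fun w => X (dyadic_exit F t (X ^~ w)) w).
Proof.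
apply: measurable_fun_mx => i k.
apply: (@measurable_fun_cvg _ _ _ _ (fun n w => X (grid_exit F t n (X ^~ w)) w i k)) => // [n|w _].
  apply: (@measurable_at_exit_index (fun j w => X (grid t n j) w i k)) => j.
  exact: (measurableT_comp (measurable_mx_coord i k) (mX (grid_ge0 t0 n j))).
apply/cvgrPdist_lt => eps eps0.
have := @grid_exit_path_cvg _ _ F t (X ^~ w) t0 (@rcX w) eps eps0.
apply: filterS => n; apply: le_lt_trans.
have := coord_le_norm (X (dyadic_exit F t (X ^~ w)) w - X (grid_exit F t n (X ^~ w)) w) k.
by rewrite !mxE (ord1 i).
Qed.

End measurable_exit.

Section limit_mean.
Context (R : realType) (dO : measure_display) (Omega : measurableType dO).
Context (Q : probability Omega R).

Lemma prob_bounded_integrable (U : Omega -> R) (a : R) : measurable_fun setT U ->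
  (forall w, `|U w| <= a) -> Q.-integrable setT (EFin \o U).
Proof.
move=> mU Ua; apply: measurable_bounded_integrable => //.
  by rewrite (le_lt_trans (probability_le1 _ _))// ltry.
by apply/bounded_funP; exists a.
Qed.

Lemma prob_Rintegral_cst (c : R) : \int[Q]_w c = c.
Proof. rewrite Rintegral_cst//. by rewrite [X in fine X]probability_setT mulr1. Qed.

Lemma dominated_cvg_Rintegral (Z : nat -> Omega -> R) (U G : Omega -> R) :
  (forall n, measurable_fun setT (Z n)) -> measurable_fun setT U ->
  Q.-integrable setT (EFin \o G) -> (forall n w, `|Z n w| <= G w) ->
  (forall w, Z n w @[n --> \oo] --> U w) ->
  \int[Q]_w Z n w @[n --> \oo] --> \int[Q]_w U w.
Proof.
move=> mZ mU iG ZG ZU.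
have mE (f : Omega -> R) : measurable_fun setT f -> measurable_fun setT (EFin \o f).
  by move=> mf; exact/measurable_EFinP.
have cE : {ae Q, forall w, setT w -> (fun n => (EFin \o Z n) w) @ \oo --> (EFin \o U) w}.
  by apply: aeW => w _; apply: cvg_EFin; [exact: nearW|exact: ZU].
have dE : {ae Q, forall w n, setT w -> (`|(EFin \o Z n) w| <= (EFin \o G) w)%E}.
  by apply: aeW => w n _; rewrite lee_fin.
have [iU _ cv] := dominated_convergence measurableT (fun n => mE _ (mZ n)) (mE _ mU) cE iG dE.
by apply: fine_cvg; rewrite fineK//; exact: integrable_fin_num iU.
Qed.

(** [Y n] need not converge. The maximum of [Y n] and [U] does, to [U], and its mean is at least
    that of [Y n], which tends to 0. *)
Lemma limit_mean_ge0 (Y : nat -> Omega -> R) (U : Omega -> R) (a : R) :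
  (forall n, measurable_fun setT (Y n)) -> (forall n w, `|Y n w| <= a) ->
  measurable_fun setT U -> (forall w, `|U w| <= a) ->
  \int[Q]_w Y n w @[n --> \oo] --> (0 : R) ->
  (forall w eps, 0 < eps -> \forall n \near \oo, Y n w <= U w + eps) ->
  0 <= \int[Q]_w U w.
Proof.
move=> mY Ya mU Ua Y0 YU.
pose Z n w := Num.max (Y n w) (U w).
have mZ n : measurable_fun setT (Z n) by exact: measurable_maxr.
have Za n w : `|Z n w| <= a by rewrite /Z; case: (leP (Y n w) (U w)).
have ZU w : Z n w @[n --> \oo] --> U w.
  apply/cvgrPdist_le => eps eps0; have := YU w _ eps0; apply: filterS => n h.
  rewrite /Z; case: (leP (Y n w) (U w)) => [_|yu]; first by rewrite subrr normr0 ltW.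
  by rewrite ler_norml; apply/andP; split; lra.
have iU := prob_bounded_integrable mU Ua.
have iZ n := prob_bounded_integrable (mZ n) (Za n).
have iY n := prob_bounded_integrable (mY n) (Ya n).
have cZ : \int[Q]_w Z n w @[n --> \oo] --> \int[Q]_w U w.
  apply: (dominated_cvg_Rintegral (G := cst a)) => //.
  exact: finite_measure_integrable_cst.
apply: (ler_cvg_to Y0 cZ); near=> n.
by apply: le_Rintegral => // w _; rewrite le_max lexx.
Unshelve. all: by end_near. Qed.

End limit_mean.

Section exit_mean.
Context (R : realType) (d : nat) (dO : measure_display) (Omega : measurableType dO).
Context (X : R -> Omega -> 'rV[R]_d) (Q : probability Omega R) (x0 : 'rV[R]_d).
Context (F : set 'rV[R]_d) (t : R) (f g : 'rV[R]_d -> R).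
Hypothesis mX : forall t, 0 <= t -> measurable_fun setT (X t).
Hypothesis rcX : forall w u, 0 <= u -> X s w @[s --> u^'+] --> X u w.
Hypothesis X0 : forall B, measurable B -> Q (X 0 @^-1` B) = dirac x0 B.
Hypothesis clF : closed F.
Hypothesis t0 : 0 < t.
Hypothesis cf : continuous f.
Context (B : R).
Hypothesis fB : forall y, `|f y| <= B.
Hypothesis locg : forall r : R, exists C : R, forall y, `|y| <= r -> `|g y| <= C.
Let M s w := f (X s w) - f (X 0 w) - \int[@lebesgue_measure R]_(u in `[0, s]) g (X u w).
Hypothesis martM : martingale X Q M.
Context (lo hi : R).
Hypothesis gF : forall y, F y -> lo <= g y <= hi.

Let S w := dyadic_exit F t (X ^~ w).
Let sig n w := grid_exit F t n (X ^~ w).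

Let S_bounds w : 0 <= S w <= t.
Proof. by rewrite dyadic_exit_ge0//= dyadic_exit_le. Qed.

Let sig_S n w : S w <= sig n w. Proof. exact: dyadic_exit_le_grid. Qed.

Let f_cvg w : f (X (sig n w) w) @[n --> \oo] --> f (X (S w) w).
Proof.
apply: continuous_cvg; first exact: cf.
apply/cvgrPdist_lt => eps eps0.
exact: (@grid_exit_path_cvg _ _ F t (X ^~ w) t0 (@rcX w) eps eps0).
Qed.

(** Up to [S] the path is in [F], where [g] lies between [lo] and [hi]. Between [S] and the grid
    exit the path stays near its position at [S], where [g] is bounded, and this stretch shrinks to
    nothing. *)
Let stopped_bounds w eps : 0 < eps -> \forall n \near \oo,
  f (X (S w) w) - f (X 0 w) - hi * S w - eps <= stopped X F t M n w <=
  f (X (S w) w) - f (X 0 w) - lo * S w + eps.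
Proof.
move=> eps0; have /andP[S0 St] := S_bounds w.
have [del del0 hd] := @right_continuousP _ _ (X ^~ w) _ (@rcX w _ S0) _ ltr01.
have [C hC] := locg (`|X (S w) w| + 1).
have C0 : 0 <= C by apply: le_trans (hC (X (S w) w) _) => //; rewrite lerDl.
have e2 : 0 < eps / 2 by rewrite divr_gt0.
have eC : 0 < eps / 2 / (C + 1) by rewrite divr_gt0// ltr_wpDl.
have h1 : \forall n \near \oo, `|S w - sig n w| < del.
  by have /cvgrPdist_lt := @grid_exit_cvg _ _ F t (X ^~ w) t0; exact.
have h2 : \forall n \near \oo, `|S w - sig n w| < eps / 2 / (C + 1).
  by have /cvgrPdist_lt := @grid_exit_cvg _ _ F t (X ^~ w) t0; exact.
have h3 : \forall n \near \oo, `|f (X (S w) w) - f (X (sig n w) w)| < eps / 2.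
  by have /cvgrPdist_lt := @f_cvg w; exact.
near=> n.
have Ssig := sig_S n w.
have k1 : sig n w < S w + del.
  have : `|S w - sig n w| < del by near: n; exact: h1.
  by rewrite ltr_norml => /andP[? ?]; lra.
have k2 : C * (sig n w - S w) <= eps / 2.
  have : `|S w - sig n w| < eps / 2 / (C + 1) by near: n; exact: h2.
  rewrite distrC ger0_norm ?subr_ge0// => /ltW h.
  apply: le_trans (_ : (C + 1) * (sig n w - S w) <= _).
    by rewrite ler_wpM2r ?subr_ge0// lerDl.
  by rewrite mulrC -ler_pdivlMr// ltr_wpDl.
have k3 : `|f (X (S w) w) - f (X (sig n w) w)| < eps / 2 by near: n; exact: h3.
have gS u : 0 <= u < S w -> lo <= g (X u w) <= hi.
  by move=> /andP[u0 uS]; apply: gF; exact: (before_dyadic_exit t0 clF (@rcX w) u0 uS).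
have gC u : S w <= u <= sig n w -> `|g (X u w)| <= C.
  move=> /andP[Su us]; apply: hC.
  have := hd u; rewrite Su (le_lt_trans us k1) => /(_ isT)/ltW Xu.
  rewrite -[X u w](subKr (X (S w) w)) (le_trans (ler_normB _ _))// lerD//.
have /andP[i1 i2] := @le_stopped_Rintegral R (fun u => g (X u w)) (S w) (sig n w) lo hi C
  (introT andP (conj S0 Ssig)) gS gC.
move: k3; rewrite ltr_norml => /andP[f1 f2].
rewrite /stopped -/(sig n w) /M; apply/andP; split; lra.
Unshelve. all: by end_near. Qed.

Let EM : \int[Q]_w M t w = 0.
Proof.
have [_ _ /(_ 0 t (lexx 0) (ltW t0) setT (@filtrationT _ _ _ _ X 0)) e] := martM.
have M0 w : M 0 w = 0 by rewrite /M subrr set_itv1 Rintegral_set1 subrr.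
by rewrite /Rintegral e; under eq_integral do rewrite M0; rewrite integral0.
Qed.

(** [a - 1] bounds the limiting expressions, so on each path the truncation at level [a] is
    eventually inactive. *)
Let a : R := B + B + t * (`|lo| + `|hi|) + 1.

Let bound (c : R) w : `|c| <= `|lo| + `|hi| ->
  `|f (X (S w) w) - f (X 0 w) - c * S w| <= a - 1.
Proof.
move=> hc; have /andP[S0 St] := S_bounds w.
rewrite /a addrK (le_trans (ler_normB _ _))// lerD//.
  by rewrite (le_trans (ler_normB _ _))// lerD.
by rewrite normrM mulrC ler_pM// ger0_norm.
Qed.

Let near_bounded w : \forall n \near \oo, `|stopped X F t M n w| <= a.
Proof.
have := stopped_bounds w ltr01; apply: filterS => n /andP[h1 h2].
have := bound (c := hi) w; rewrite lerDr => /(_ (normr_ge0 _)).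
have := bound (c := lo) w; rewrite lerDl => /(_ (normr_ge0 _)).
rewrite !ler_norml => /andP[a1 a2] /andP[b1 b2].
by apply/andP; split; lra.
Qed.

(** The truncated stopped values have the same mean as the truncated [M t]; these are dominated by
    [|M t|] and converge to [M t], of mean 0. *)
Let trunc_mean0 : \int[Q]_w stopped_trunc X F t M n a w @[n --> \oo] --> (0 : R).
Proof.
rewrite (_ : (fun _ => _) = (fun n => \int[Q]_w final_trunc X F t M n a w)); last first.
  by apply/funext => n; rewrite /Rintegral (stopped_trunc_mean mX clF t0 martM).
rewrite -EM; have [_ iM _] := martM.
have iMt := iM t (ltW t0).
apply: (@dominated_cvg_Rintegral _ _ _ _ _ _ (fun w => `|M t w|)).
- by move=> n; exact: (measurable_final_trunc mX clF t0 martM).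
- by have /measurable_int/measurable_EFinP := iMt.
- exact: integrable_norm.
- by move=> n w; rewrite /final_trunc; case: ifP => //; rewrite normr0.
- move=> w; apply: cvg_near_cst; have := near_bounded w; apply: filterS => n h.
  by rewrite /final_trunc h.
Qed.

Let mfS : measurable_fun setT (fun w => f (X (S w) w)).
Proof.
by apply: (measurableT_comp (continuous_measurable_rV cf)); exact: measurable_at_dyadic_exit.
Qed.

Let mf0 : measurable_fun setT (fun w => f (X 0 w)).
Proof. by apply: (measurableT_comp (continuous_measurable_rV cf)); exact: mX. Qed.

Let mS : measurable_fun setT S. Proof. exact: measurable_dyadic_exit. Qed.

Let mexpr (c : R) : measurable_fun setT (fun w => f (X (S w) w) - f (X 0 w) - c * S w).
Proof.
apply: measurable_funB; first exact: measurable_funB.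
by apply: measurable_funM => //; exact: measurable_cst.
Qed.

Let Ef0 : \int[Q]_w f (X 0 w) = f x0.
Proof.
rewrite /Rintegral.
have mX0 : measurable_fun setT (X 0) by exact: mX.
have i0 := @prob_bounded_integrable _ _ _ Q _ B mf0 (fun w => fB (X 0 w)).
have mEf : measurable_fun setT (EFin \o f).
  by apply/measurable_EFinP; exact: continuous_measurable_rV.
have := @integral_pushforward _ _ _ _ R (X 0) mX0 Q setT (EFin \o f) mEf.
rewrite preimage_setT => /(_ i0 measurableT) <-.
transitivity (fine (\int[dirac x0]_y (f y)%:E)%E).
  by congr fine; apply: eq_measure_integral => A mA _; exact: X0.
by rewrite integral_dirac// diracT mul1e.
Qed.

Let Eexpr (c : R) : \int[Q]_w (f (X (S w) w) - f (X 0 w) - c * S w) =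
  \int[Q]_w f (X (S w) w) - f x0 - c * \int[Q]_w S w.
Proof.
have i1 := @prob_bounded_integrable _ _ _ Q _ B mfS (fun w => fB (X (S w) w)).
have i2 := @prob_bounded_integrable _ _ _ Q _ B mf0 (fun w => fB (X 0 w)).
have i3 : Q.-integrable setT (EFin \o S).
  apply: (@prob_bounded_integrable _ _ _ _ _ t mS) => w.
  by have /andP[S0 St] := S_bounds w; rewrite ger0_norm.
have i12 := integrableB measurableT i1 i2.
have ci3 := integrableZl measurableT c i3.
rewrite (RintegralB measurableT i12 ci3) (RintegralB measurableT i1 i2).
by rewrite RintegralZl// Ef0.
Qed.

(** Dynkin's formula as a pair of inequalities, where the integral of [g] along the path is replaced
    by its extreme rates on [F]. Each side is an instance of [limit_mean_ge0], with opposite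
    signs. *)
Lemma dyadic_exit_mean :
  lo * \int[Q]_w S w <= \int[Q]_w f (X (S w) w) - f x0 <= hi * \int[Q]_w S w.
Proof.
have bound_hi w : `|f (X (S w) w) - f (X 0 w) - hi * S w| <= a - 1.
  by apply: bound; rewrite lerDr.
have trunc_le n w : `|stopped_trunc X F t M n a w| <= a.
  rewrite /stopped_trunc; case: ifP => // _; rewrite normr0.
  by rewrite (le_trans (normr_ge0 _) (le_trans (bound_hi w) _))// gerBl.
apply/andP; split.
- rewrite -subr_ge0 -Eexpr; apply: (@limit_mean_ge0 _ _ _ _ (stopped_trunc X F t M ^~ a) _ a).
  + by move=> n; exact: (measurable_stopped_trunc mX clF t0 martM).
  + exact: trunc_le.
  + exact: mexpr.
  + by move=> w; apply: (@le_trans _ _ (a - 1)); [apply: bound; rewrite lerDl|rewrite gerBl].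
  + exact: trunc_mean0.
  + move=> w eps eps0; apply: filterS2 (stopped_bounds w eps0) (near_bounded w).
    by move=> n /andP[_ h1] h2; rewrite /stopped_trunc h2.
- rewrite -subr_le0 -Eexpr.
  have ihi := @prob_bounded_integrable _ _ _ Q _ (a - 1) (mexpr hi) (fun w => bound_hi w).
  have itr n := @prob_bounded_integrable _ _ _ Q _ a (measurable_stopped_trunc mX clF t0 martM n a)
    (trunc_le n).
  rewrite -oppr_ge0 -mulN1r -RintegralZl//.
  apply: (@limit_mean_ge0 _ _ _ _ (fun n w => -1 * stopped_trunc X F t M n a w) _ a).
  + move=> n; apply: measurable_funM => //.
    exact: (measurable_stopped_trunc mX clF t0 martM).
  + by move=> n w; rewrite mulN1r normrN.
  + by apply: measurable_funM => //; exact: mexpr.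
  + by move=> w; rewrite mulN1r normrN (le_trans (bound_hi w))// gerBl.
  + rewrite (_ : (fun _ => _) = (fun n => -1 * \int[Q]_w stopped_trunc X F t M n a w)).
      by rewrite -[0 in X in _ --> X](mulr0 (-1)); apply: cvgMr; exact: trunc_mean0.
    by apply/funext => n; rewrite RintegralZl.
  + move=> w eps eps0; apply: filterS2 (stopped_bounds w eps0) (near_bounded w).
    by move=> n /andP[h1 _] h2; rewrite /stopped_trunc h2; lra.
Qed.

End exit_mean.

(** * Bounds on the generator *)

Section density.
Context d (T : measurableType d) (R : realType) (mu : {measure set T -> \bar R}) (g : T -> R).
Local Open Scope ereal_scope.

(** The proofs about [g] are arguments of the definition so that the measure structure can be
    attached to it. *)
Definition density (mg : measurable_fun setT g) (g0 : forall x, (0 <= g x)%R) (A : set T) :=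
  \int[mu]_(x in A) (g x)%:E.

Context (mg : measurable_fun setT g) (g0 : forall x, (0 <= g x)%R).

Let mgE : measurable_fun setT (EFin \o g). Proof. exact/measurable_EFinP. Qed.

Let density0 : density mg g0 set0 = 0.
Proof. exact: integral_set0. Qed.

Let density_ge0 A : 0 <= density mg g0 A.
Proof. by apply: integral_ge0 => x _; rewrite lee_fin. Qed.

Let density_sigma_additive : semi_sigma_additive (density mg g0).
Proof.
move=> F mF tF mUF; rewrite /density ge0_integral_bigcup//; last 2 first.
- exact: measurable_funTS.
- by move=> x _; rewrite lee_fin.
by apply: is_cvg_nneseries => n _ _; exact: density_ge0.
Qed.

HB.instance Definition _ := isMeasure.Build _ _ _ (density mg g0)
  density0 density_ge0 density_sigma_additive.

(** True for indicators by definition, hence for simple functions, and monotone convergence on both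
    sides does the rest. *)
Lemma ge0_integral_density (f : T -> \bar R) : measurable_fun setT f -> (forall x, 0 <= f x) ->
  \int[density mg g0]_x f x = \int[mu]_x (f x * (g x)%:E).
Proof.
move=> mf f0.
pose f_ := nnsfun_approx measurableT mf.
have cf x : (f_ n x)%:E @[n --> \oo] --> f x.
  by apply: cvg_nnsfun_approx => // *; exact: f0.
transitivity (limn (fun n => \int[density mg g0]_x (f_ n x)%:E)).
  rewrite -monotone_convergence//.
  - by apply: eq_integral => y _; apply/esym/cvg_lim.
  - by move=> n; exact/measurable_EFinP/measurable_funP.
  - by move=> n y _; rewrite lee_fin.
  - by move=> y _ m n mn; rewrite lee_fin; exact/lefP/nd_nnsfun_approx.
transitivity (limn (fun n => \int[mu]_x ((f_ n x)%:E * (g x)%:E))); last first.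
  rewrite -monotone_convergence//.
  - apply: eq_integral => y _; apply/cvg_lim => //.
    apply: cvgeZr => //.
  - move=> n; apply: emeasurable_funM => //.
    by apply/measurable_EFinP/measurable_funP.
  - by move=> n y _; rewrite mule_ge0// lee_fin.
  - move=> y _ m n mn; rewrite lee_wpmul2r// lee_fin//; exact/lefP/nd_nnsfun_approx.
congr (lim (_ @ \oo)); apply/funext => n.
have mr r : measurable (f_ n @^-1` [set r]) by exact: measurable_sfunP.
have mi r : measurable_fun setT (fun x => (r * \1_(f_ n @^-1` [set r]) x)%:E).
  by apply/measurable_EFinP/measurable_funM => //; exact: measurable_indic.
under [LHS]eq_integral do rewrite fimfunE -fsumEFin//.
have e x : (f_ n x)%:E * (g x)%:E =
    \sum_(r \in range (f_ n)) ((r * \1_(f_ n @^-1` [set r]) x)%:E * (g x)%:E).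
  rewrite fimfunE -fsumEFin// ge0_mule_fsuml//.
  by move=> r; rewrite nnfun_muleindic_ge0.
under [RHS]eq_integral do rewrite e.
rewrite ge0_integral_fsum//; last first.
  by move=> r x _; rewrite nnfun_muleindic_ge0.
rewrite ge0_integral_fsum//; last 2 first.
- by move=> r; apply: emeasurable_funM.
- by move=> r x _; rewrite mule_ge0// ?nnfun_muleindic_ge0// lee_fin.
apply: eq_fsbigr => r; rewrite inE => -[y _ yr].
have r0 : (0 <= r)%R by rewrite -yr.
rewrite integralZl_indic_nnsfun// integral_indic// setIT.
under [RHS]eq_integral do rewrite EFinM -muleA.
rewrite ge0_integralZl//; last 2 first.
- by apply: emeasurable_funM => //; exact/measurable_EFinP/measurable_indic.
- by move=> x _; rewrite mule_ge0// lee_fin.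
congr (_ * _); rewrite [LHS]integral_mkcond; apply: eq_integral => x _.
by rewrite patchE indicE; case: ifPn => _; rewrite ?mul1e ?mul0e.
Qed.

End density.

(** * Outer regularity of finite Borel measures *)

Section regularity.
Context (R : realType) (n : nat) (m : {measure set 'rV[R]_n -> \bar R}).
Hypothesis mfin : (m setT < +oo)%E.

Let closed_mble (A : set 'rV[R]_n) : closed A -> measurable A.
Proof. exact: closed_measurable_rV. Qed.

Let small_tail (F : nat -> set 'rV[R]_n) (eps : R) : 0 < eps ->
  (forall k, measurable (F k)) -> \bigcap_k F k = set0 ->
  {homo F : a b / (a <= b)%N >-> (b <= a)%O} -> exists k, (m (F k) <= eps%:E)%E.
Proof.
move=> eps0 mF F0 ndF.
have := @nonincreasing_cvg_mu _ _ _ m F _ mF _ ndF.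
rewrite F0 measure0 => /(_ _ measurable0) h.
have {}h : (m \o F) k @[k --> \oo] --> 0%:E.
  by apply: h; apply: le_lt_trans mfin; apply: le_measure; rewrite ?inE.
have /fine_cvgP[_ /cvgrPdist_le/(_ _ eps0)[k _ /(_ k (leqnn _)) hk]] := h.
exists k; move: hk; rewrite /= sub0r normrN => /(le_trans (ler_norm _)) hk.
rewrite -[m (F k)]fineK ?lee_fin// ge0_fin_numE//.
by apply: le_lt_trans mfin; apply: le_measure; rewrite ?inE.
Qed.

(** Approximation from both sides at once makes the property symmetric under complement, hence fit
    for a sigma-algebra argument. *)
Let reg (A : set 'rV[R]_n) := forall eps, 0 < eps -> exists C U,
  [/\ closed C, open U, C `<=` A, A `<=` U & (m (U `\` C) <= eps%:E)%E].

(** Inside [A], the points whose ball of radius [1/(k+1)] stays in [A] form closed sets increasing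
    to [A]. *)
Let reg_open A : open A -> reg A.
Proof.
move=> oA eps eps0.
pose C k := [set x : 'rV[R]_n | ball x k.+1%:R^-1 `<=` A].
have C_A k : C k `<=` A.
  by move=> x; apply; apply: ballxx; rewrite invr_gt0.
have cC k : closed (C k).
  rewrite -[C k]setCK; apply: open_closedC.
  rewrite (_ : ~` C k = \bigcup_(y in ~` A) ball y k.+1%:R^-1).
    by apply: bigcup_open => y _; exact: open_ball_rV.
  apply/seteqP; split=> x.
    move=> /= /existsNP[y /not_implyP[xy Ay]]; exists y => //; exact: ball_sym.
  by move=> [y Ay /ball_sym yx] /(_ _ yx).
have [k|||k hk] := @small_tail (fun k => A `\` C k) eps eps0.
- by apply: measurableD; [exact: open_measurable_rV|exact: closed_mble].
- apply/seteqP; split => // x xA.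
  have Ax : A x by case: (xA 0%N I).
  have /nbhs_ballP[r /= r0 rA] : nbhs x A by exact: open_nbhs_nbhs.
  have [k kr] : exists k : nat, k.+1%:R^-1 < r :> R.
    have /cvgrPdist_lt/(_ _ r0) [k _ /(_ k (leqnn _))] := @cvg_harmonic R.
    by rewrite sub0r normrN /= ger0_norm// => ?; exists k.
  case: (xA k I) => _; apply; apply: subset_trans rA; exact: le_ball (ltW kr).
- move=> a b ab; apply/subsetPset => x [Ax nC]; split => // Cb; apply: nC.
  move=> y xy; apply: Cb; apply: le_ball xy.
  by rewrite lef_pV2 ?posrE// ler_nat ltnS.
by exists (C k), A; split => //; exact: C_A.
Qed.

Let reg_sigma : sigma_algebra setT reg.
Proof.
split.
- by apply: reg_open; exact: open0.
- move=> A rA eps eps0; have [C [U [cC oU CA AU mUC]]] := rA _ eps0.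
  exists (~` U), (~` C); split.
  + exact: open_closedC.
  + exact: closed_openC.
  + by rewrite setTD; exact: subsetC.
  + by rewrite setTD; exact: subsetC.
  + by rewrite setDE setCK setIC -setDE.
- move=> A rA eps eps0.
  have e0 i : 0 < eps / 2 / (2 ^ i.+1)%:R by rewrite !divr_gt0// ltr0n expn_gt0.
  have /choice[CU CUP] : forall i, exists CU : set 'rV[R]_n * set 'rV[R]_n,
      [/\ closed CU.1, open CU.2, CU.1 `<=` A i, A i `<=` CU.2 &
        (m (CU.2 `\` CU.1) <= (eps / 2 / (2 ^ i.+1)%:R)%:E)%E].
    by move=> i; have [C [U h]] := rA i _ (e0 i); exists (C, U).
  pose CC := \bigcup_i (CU i).1; pose UU := \bigcup_i (CU i).2.
  pose CN N := \bigcup_(i in `I_N) (CU i).1.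
  have cCN N : closed (CN N) by apply: closed_bigcup => // i _; have [] := CUP i.
  have oUU : open UU by apply: bigcup_open => i _; have [] := CUP i.
  have mC i : measurable (CU i).1 by apply: closed_mble; have [] := CUP i.
  have mU i : measurable (CU i).2 by apply: open_measurable_rV; have [] := CUP i.
  have mCC : measurable CC by exact: bigcupT_measurable.
  have mUU : measurable UU by exact: open_measurable_rV.
  have mCN N : measurable (CN N) by exact: closed_mble.
  have h1 : (m (UU `\` CC) <= (eps / 2)%:E)%E.
    apply: (@le_trans _ _ (\sum_(i <oo) m ((CU i).2 `\` (CU i).1))%E).
      apply: measure_sigma_subadditive.
      + by move=> i; exact: measurableD.
      + exact: measurableD.
      + by move=> x [[i _ Ui] nC]; exists i => //; split => // Ci; apply: nC; exists i.
    apply: le_trans (epsilon_trick0 xpredT (ltW _)); last by rewrite divr_gt0.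
    by apply: lee_nneseries => // i _; have [] := CUP i.
  (* The countable union of the inner closed sets need not be closed; finitely many are kept, and
     finiteness of [m] makes the rest small. *)
  have [|||N hN] := @small_tail (fun N => CC `\` CN N) (eps / 2) (divr_gt0 eps0 (ltr0n _ 2)).
  + by move=> N; exact: measurableD.
  + apply/seteqP; split => // x xA; have [[i _ Ci] _] := xA 0%N I.
    by have [_] := xA i.+1 I; apply; exists i => /=.
  + move=> a b ab; apply/subsetPset => x [Cx nC]; split => // -[i /= ia Ci].
    by apply: nC; exists i => //=; exact: leq_trans ia ab.
  exists (CN N), UU; split => //.
  + by move=> x [i _ Ci]; exists i => //; have [_ _ h _ _] := CUP i; exact: h.
  + by move=> x [i _ Ai]; exists i => //; have [_ _ _ h _] := CUP i; exact: h.
  rewrite (splitr eps) EFinD.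
  apply: (@le_trans _ _ (m ((UU `\` CC) `|` (CC `\` CN N)))).
    apply: le_measure; rewrite ?inE; [exact: measurableD| |].
      by apply: measurableU; exact: measurableD.
    by move=> x [Ux nC]; have [Cx|Cx] := pselect (CC x); [right|left].
  apply: (le_trans (measureU2 _ (measurableD mUU mCC) (measurableD mCC (mCN N)))).
  exact: leeD.
Qed.

Lemma outer_regular (A : set 'rV[R]_n) (eps : R) : measurable A -> 0 < eps ->
  exists U, [/\ open U, A `<=` U & (m (U `\` A) <= eps%:E)%E].
Proof.
move=> mA eps0.
have rA : reg A by move: A mA; apply: smallest_sub; [exact: reg_sigma|exact: reg_open].
have [C [U [cC oU CA AU mUC]]] := rA _ eps0; exists U; split => //.
apply: le_trans mUC; apply: le_measure; rewrite ?inE.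
- by apply: measurableD => //; exact: open_measurable_rV.
- by apply: measurableD; [exact: open_measurable_rV|exact: closed_mble].
- by move=> x [Ux nA]; split => // /CA.
Qed.

End regularity.

(** * Size of the generator on test functions *)

Section generator_bounds.
Context (R : realType) (d : nat) (alpha : R).
Hypothesis d_gt0 : (0 < d)%N.
Hypothesis alpha12 : 1 < alpha < 2.
Local Notation jk := (@jker R d alpha).
Local Notation mu := (lebesgue_rV R d).

Let alpha_gt0 : 0 < alpha. Proof. by case/andP: alpha12 => /(lt_trans ltr01). Qed.

Let dalpha_gt0 : 0 < d%:R + alpha.
Proof. by rewrite ltr_wpDl. Qed.

Lemma measurable_norm_rV : measurable_fun setT (fun z : 'rV[R]_d => `|z|).
Proof. by apply: continuous_measurable_rV => z; exact: norm_continuous. Qed.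

Lemma measurable_jker : measurable_fun setT jk.
Proof.
rewrite (_ : jker _ = (fun z => `|z| `^ (- (d%:R + alpha)))).
  exact: (measurableT_comp (measurable_powR _) measurable_norm_rV).
by apply/funext => z; rewrite powRN.
Qed.

Lemma jker0 : jk 0 = 0.
Proof. by rewrite /jker normr0 powR0 ?invr0// gt_eqF. Qed.

Definition elliptic_at (b : 'rV[R]_d -> 'rV[R]_d) (k : 'rV[R]_d -> 'rV[R]_d -> R) (Lam : R)
    (x : 'rV[R]_d) :=
  enorm (b x) <= Lam /\ forall z, Lam^-1 <= k x z <= Lam.

Context (Lam : R).
Hypothesis Lam0 : 0 < Lam.

Lemma kernel_le b k x z : elliptic_at b k Lam x ->
  0 <= k x z / enorm z `^ (d%:R + alpha) <= Lam * jk z.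
Proof.
move=> [_ /(_ z)/andP[k1 k2]].
have k0 : 0 <= k x z by apply: le_trans k1; rewrite invr_ge0 ltW.
rewrite divr_ge0 ?powR_ge0//=.
have [->|z0] := eqVneq z 0.
  rewrite jker0 mulr0 (_ : enorm 0 = 0) ?powR0 ?invr0 ?mulr0// ?gt_eqF//.
  by apply/eqP; rewrite eq_le enorm_ge0 andbT (le_trans (enorm_le_norm _))// normr0 mulr0.
have z1 : 0 < `|z| by rewrite normr_gt0.
rewrite ler_pM ?invr_ge0 ?powR_ge0// /jker lef_pV2 ?posrE ?powR_gt0//.
  by apply: ge0_ler_powR; rewrite ?nnegrE ?enorm_ge0 ?norm_le_enorm ?ltW.
by rewrite (lt_le_trans z1)// norm_le_enorm.
Qed.

(** The Euclidean norm is at most [d] times the max norm, whence the factor [d^(d+alpha)]. *)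
Lemma kernel_ge b k x z : elliptic_at b k Lam x ->
  Lam^-1 * ((d%:R `^ (d%:R + alpha))^-1 * jk z) <= k x z / enorm z `^ (d%:R + alpha).
Proof.
move=> ex; have [->|z0] := eqVneq z 0.
  by rewrite jker0 !mulr0; have /andP[] := kernel_le 0 ex.
have [_ /(_ z)/andP[k1 k2]] := ex.
have z1 : 0 < `|z| by rewrite normr_gt0.
have e1 : 0 < enorm z by rewrite (lt_le_trans z1)// norm_le_enorm.
rewrite ler_pM ?invr_ge0 ?(ltW Lam0) ?mulr_ge0 ?invr_ge0 ?powR_ge0 ?jker_ge0//.
rewrite -invfM -powRM// lef_pV2 ?posrE ?powR_gt0// ?mulr_gt0 ?ltr0n//.
by apply: ge0_ler_powR; rewrite ?nnegrE ?mulr_ge0 ?enorm_ge0 ?enorm_le_norm// ltW.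
Qed.

Let G1 s (z : 'rV[R]_d) : \bar R := ((fun z => (`|z| ^+ 2 * jk z)%:E) \_ (ball (0 : 'rV[R]_d) s)) z.
Let G2 (s : R) (z : 'rV[R]_d) : \bar R := ((fun z => (`|z| * jk z)%:E) \_ [set z | s <= `|z|]) z.

Let mball s : measurable (ball (0 : 'rV[R]_d) s).
Proof. by apply: open_measurable_rV; exact: open_ball_rV. Qed.

Let mG1 s : measurable_fun setT (G1 s).
Proof.
apply/measurable_restrict => //; rewrite setTI; apply: measurable_funTS.
apply/measurable_EFinP/measurable_funM; last exact: measurable_jker.
by apply: measurable_funX; exact: measurable_norm_rV.
Qed.

Let mG2 s : measurable_fun setT (G2 s).
Proof.
apply/measurable_restrict => //; first exact: measurable_normr_ge.
rewrite setTI; apply: measurable_funTS.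
by apply/measurable_EFinP/measurable_funM; [exact: measurable_norm_rV|exact: measurable_jker].
Qed.

Let G1_ge0 s z : (0 <= G1 s z)%E.
Proof. by rewrite /G1 patchE; case: ifP => //; rewrite lee_fin mulr_ge0 ?exprn_ge0 ?jker_ge0. Qed.

Let G2_ge0 s z : (0 <= G2 s z)%E.
Proof. by rewrite /G2 patchE; case: ifP => //; rewrite lee_fin mulr_ge0 ?jker_ge0. Qed.

(** The integral is split at [|z| = s]. Near 0 the second order remainder meets
    [near_integral_jker]; beyond, the increment and the gradient term are each of order [|z|] and
    meet [far_integral_jker]. The integrand is only sandwiched between multiples of these measurable
    bounds. *)
Lemma generator_bound : exists2 C, 0 < C &
  forall b k f (a1 a2 s : R) x, is_Cb2 f -> 0 <= a1 -> 0 <= a2 ->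
  (forall i y, `|partial i f y| <= a1) ->
  (forall i j y, `|partial j (partial i f) y| <= a2) ->
  0 < s -> d%:R * s <= 1 -> elliptic_at b k Lam x ->
  `|generator alpha b k f x| <= C * (a1 + a2 * (s ^+ 2 / s `^ alpha) + a1 * (s / s `^ alpha)).
Proof.
have [C1 C10 near_bd] := near_integral_jker d alpha12.
have [C2 C20 far_bd] := far_integral_jker d alpha12.
pose D := d%:R : R; have D0 : 0 < D by rewrite ltr0n.
exists (Lam * D + Lam * (D ^+ 2 * C1) + Lam * (2 * D * C2)).
  by rewrite !addr_gt0// !mulr_gt0// exprn_gt0.
move=> b k f a1 a2 s x fC a10 a20 f1 f2 s0 s1 ex.
have [fC1 fC2 _ _ _] := fC.
pose c1 := Lam * (a2 * D ^+ 2); pose c2 := Lam * (2 * D * a1).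
have c10 : 0 <= c1 by rewrite !mulr_ge0 ?sqr_ge0 ?(ltW Lam0).
have c20 : 0 <= c2 by rewrite !mulr_ge0 ?(ltW Lam0).
pose g z := (f (x + z) - f x - \1_[set z | enorm z <= 1] z * dot (grad f x) z) *
     (k x z / enorm z `^ (d%:R + alpha)).
pose G z := (c1%:E * G1 s z + c2%:E * G2 s z)%E.
have G0 z : (0 <= G z)%E by rewrite adde_ge0// mule_ge0.
have gG z : (`|(g z)%:E| <= G z)%E.
  have /andP[q0 q1] := kernel_le z ex; rewrite /g; set q := k x z / _ in q0 q1 *.
  rewrite abse_EFin normrM (ger0_norm q0) /G /G1 /G2 !patchE.
  have h1 : `|f (x + z) - f x| <= a1 * (D * `|z|) by exact: C1_lipschitz.
  have h2 : `|dot (grad f x) z| <= a1 * (D * `|z|) by rewrite dotC dot_grad_le.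
  have [zs|zs] := ltP `|z| s.
    rewrite mem_set; last by rewrite -ball_normE /= sub0r normrN.
    rewrite memNset; last by rewrite /= leNgt zs.
    (* The condition [d%:R * s <= 1] puts the whole cube below the Euclidean cut-off at 1, so the
       gradient term is present throughout. *)
    rewrite mule0 adde0 -EFinM lee_fin indicE mem_set; last first.
      rewrite /= (le_trans (enorm_le_norm _))// (le_trans _ s1)//.
      by rewrite ler_wpM2l// ltW.
    rewrite mul1r; have := C2_taylor x z a20 fC1 fC2 f2 => h.
    apply: le_trans (ler_pM _ _ h q1) _ => //.
    by rewrite le_eqVlt /c1 /D; apply/orP; left; apply/eqP; ring.
  rewrite memNset; last by rewrite -ball_normE /= sub0r normrN => h; move: zs; rewrite leNgt h.
  rewrite mem_set// mule0 add0e -EFinM lee_fin.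
  have h : `|f (x + z) - f x - \1_[set z | enorm z <= 1] z * dot (grad f x) z| <=
      2 * D * a1 * `|z|.
    apply: le_trans (ler_normB _ _) _.
    apply: le_trans (_ : a1 * (D * `|z|) + a1 * (D * `|z|) <= _); last first.
      by rewrite le_eqVlt; apply/orP; left; apply/eqP; ring.
    rewrite lerD// normrM; apply: le_trans h2; rewrite ler_piMl//.
    by rewrite indicE; case: (_ \in _); rewrite ?normr1 ?normr0.
  apply: le_trans (ler_pM _ _ h q1) _ => //.
  by rewrite le_eqVlt /c2; apply/orP; left; apply/eqP; ring.
have IG : (\int[mu]_z G z <= (c1 * (C1 * (s ^+ 2 / s `^ alpha)) + c2 * (C2 * (s / s `^ alpha)))%:E)%E.
  rewrite /G ge0_integralD//; last 4 first.
  - by move=> z _; rewrite mule_ge0.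
  - by apply: emeasurable_funM => //; exact: mG1.
  - by move=> z _; rewrite mule_ge0.
  - by apply: emeasurable_funM => //; exact: mG2.
  rewrite EFinD leeD//.
    rewrite ge0_integralZl// [leRHS]EFinM; apply: lee_wpmul2l; first by rewrite lee_fin.
    rewrite /G1 -integral_mkcond; exact: near_bd.
  rewrite ge0_integralZl// [leRHS]EFinM; apply: lee_wpmul2l; first by rewrite lee_fin.
  rewrite /G2 -integral_mkcond; exact: far_bd.
have h1 : (\int[mu]_z (g z)%:E <= \int[mu]_z G z)%E.
  by apply: le_lower_integral => z _; apply: le_trans (gG z); exact: lee_abs.
have h2 : (- (\int[mu]_z G z) <= \int[mu]_z (g z)%:E)%E.
  rewrite -integral_ge0N//; apply: le_lower_integral => z _.
  by rewrite leeNl; apply: le_trans (gG z); rewrite -abseN; exact: lee_abs.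
have hR : `|\int[mu]_z g z| <= c1 * (C1 * (s ^+ 2 / s `^ alpha)) + c2 * (C2 * (s / s `^ alpha)).
  rewrite /Rintegral; set I := (\int[mu]_z (g z)%:E)%E in h1 h2 *; set U := (_ + _ : R) in IG *.
  have i1 : (I <= U%:E)%E by exact: le_trans IG.
  have i2 : ((- U)%:E <= I)%E by apply: le_trans h2; rewrite EFinN leeN2.
  have If : I \is a fin_num by rewrite fin_numElt (lt_le_trans (ltNyr _) i2) (le_lt_trans i1 (ltry _)).
  by move: i1 i2; rewrite -(fineK If) !lee_fin ler_norml => -> ->.
rewrite /generator; apply: le_trans (ler_normD _ _) _.
have hb : `|dot (b x) (grad f x)| <= a1 * (D * Lam).
  apply: le_trans (dot_grad_le _ _ a10 f1) _; rewrite ler_wpM2l// ler_wpM2l//.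
  by have [h _] := ex; rewrite (le_trans (norm_le_enorm _)).
apply: le_trans (lerD hb hR) _; rewrite /c1 /c2.
have p0 : 0 <= s ^+ 2 / s `^ alpha by rewrite divr_ge0 ?powR_ge0 ?sqr_ge0.
have p1 : 0 <= s / s `^ alpha by rewrite divr_ge0 ?powR_ge0 ?ltW.
move: p0 p1; set P := s ^+ 2 / _; set P' := s / _ => p0 p1.
have l0 := ltW Lam0; have D0' := ltW D0; have C10' := ltW C10; have C20' := ltW C20.
(* The product of the two sums dominates termwise; what is left over is a sum of nonnegative
   products. *)
rewrite -subr_ge0 (_ : _ - _ = (Lam * (D ^+ 2 * C1) + Lam * (2 * D * C2)) * a1 +
  (Lam * D + Lam * (2 * D * C2)) * (a2 * P) + (Lam * D + Lam * (D ^+ 2 * C1)) * (a1 * P')).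
  have D20 : 0 <= D ^+ 2 by exact: sqr_ge0.
  by do ![apply: addr_ge0 => //|apply: mulr_ge0 => //].
by ring.
Qed.

End generator_bounds.

Section measure_comparison.
Context (R : realType) (n : nat).

(** Shrink an open neighbourhood of [A] on which [m2] exceeds [m2 A] by at most [eps], intersect it
    with [V], and apply the inequality there. *)
Lemma measure_le_of_open (m1 m2 : {measure set 'rV[R]_n -> \bar R}) (V : set 'rV[R]_n) :
  open V -> (m2 setT < +oo)%E ->
  (forall U, open U -> U `<=` V -> (m1 U <= m2 U)%E) ->
  forall A, measurable A -> (m1 (A `&` V) <= m2 A)%E.
Proof.
move=> oV m2fin h A mA.
have mV : measurable V by exact: open_measurable_rV.
apply/lee_addgt0Pr => eps eps0.
have [U [oU AU mU]] := outer_regular m2fin mA eps0.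
have mUs : measurable U by exact: open_measurable_rV.
apply: (@le_trans _ _ (m1 (U `&` V))).
  apply: le_measure; rewrite ?inE; [exact: measurableI|exact: measurableI|].
  by move=> x [Ax Vx]; split => //; exact: AU.
apply: le_trans (h _ (openI oU oV) _) _; first by move=> x [].
apply: (@le_trans _ _ (m2 (A `|` (U `\` A)))).
  apply: le_measure; rewrite ?inE; [exact: measurableI| |].
    by apply: measurableU => //; exact: measurableD.
  by move=> x [Ux _]; have [Ax|Ax] := pselect (A x); [left|right].
apply: (le_trans (measureU2 _ mA (measurableD mUs mA))).
by rewrite leeD2l.
Qed.

End measure_comparison.

Section jump_bounds.
Context (R : realType) (d : nat) (alpha : R).
Hypothesis d_gt0 : (0 < d)%N.
Hypothesis alpha12 : 1 < alpha < 2.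
Local Notation jk := (@jker R d alpha).
Local Notation mu := (lebesgue_rV R d).
Local Notation p := (d%:R + alpha).

Let alpha_gt0 : 0 < alpha. Proof. by case/andP: alpha12 => /(lt_trans ltr01). Qed.

Let p_gt0 : 0 < p. Proof. by rewrite ltr_wpDl. Qed.

Lemma jker_le_scale (c : R) (u v : 'rV[R]_d) : 0 < c -> 0 < `|u| -> `|u| <= c * `|v| ->
  jk v <= c `^ p * jk u.
Proof.
move=> c0 u0 uv; rewrite /jker.
have v0 : 0 < `|v| by rewrite -(pmulr_rgt0 _ c0) (lt_le_trans u0).
rewrite ler_pdivlMr ?powR_gt0// mulrC ler_pdivrMr ?powR_gt0// -powRM// ?(ltW c0)//.
by apply: ge0_ler_powR; rewrite ?nnegrE ?mulr_ge0// ltW.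
Qed.

Definition far_kernel (x0 : 'rV[R]_d) (r : R) (y : 'rV[R]_d) : R :=
  jk (y - x0) * \1_[set y | r < `|y - x0|] y.

Lemma far_kernel_ge0 x0 r y : 0 <= far_kernel x0 r y.
Proof. by rewrite mulr_ge0// jker_ge0. Qed.

Lemma open_far (x0 : 'rV[R]_d) (r : R) : open [set y | r < `|y - x0|].
Proof.
rewrite (_ : [set _ | _] = (fun y => `|y - x0|) @^-1` `]r, +oo[%classic); last first.
  by apply/seteqP; split=> y /=; rewrite in_itv/= andbT.
apply: open_comp; last exact: interval_open.
move=> y _; apply: continuous_comp; last exact: norm_continuous.
by apply: continuousB; [exact: cvg_id|exact: cst_continuous].
Qed.

Lemma measurable_subr_rV (x0 : 'rV[R]_d) : measurable_fun setT (fun y : 'rV[R]_d => y - x0).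
Proof. by under eq_fun do rewrite addrC; exact: measurable_addl_rV. Qed.

Lemma measurable_far_kernel x0 r : measurable_fun setT (far_kernel x0 r).
Proof.
apply: measurable_funM.
  exact: (measurableT_comp (measurable_jker _) (measurable_subr_rV x0)).
by apply: measurable_indic; apply: open_measurable_rV; exact: open_far.
Qed.

Definition kappa (x0 : 'rV[R]_d) (r : R) : {measure set 'rV[R]_d -> \bar R} :=
  density mu (measurable_far_kernel x0 r) (far_kernel_ge0 x0 r).

Lemma kappaE x0 r A : kappa x0 r A = (\int[mu]_(y in A) (far_kernel x0 r y)%:E)%E.
Proof. by []. Qed.

Lemma far_kernel_translation x0 r z : far_kernel x0 r (x0 + z) = far_kernel 0 r z.
Proof.
have e : x0 + z - x0 = z by rewrite addrAC subrr add0r.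
rewrite /far_kernel !indicE subr0 e; congr (_ * (nat_of_bool _)%:R).
by apply/idP/idP; rewrite !inE/= subr0 e.
Qed.

(** Where the kernel lives [1 <= |z| / r], so the first moment estimate [far_integral_jker] applies
    after a translation. *)
Lemma kappa_fin : exists2 C, 0 < C & forall x0 r, 0 < r ->
  (kappa x0 r setT <= (C * (r `^ alpha)^-1)%:E)%E.
Proof.
have [C C0 h] := far_integral_jker d alpha12.
exists C => // x0 r r0; rewrite kappaE.
rewrite -(ge0_integral_translation x0); last 2 first.
- by apply/measurable_EFinP; exact: measurable_far_kernel.
- by move=> y; rewrite lee_fin far_kernel_ge0.
under eq_integral do rewrite far_kernel_translation.
have r1 : 0 <= r^-1 by rewrite invr_ge0 ltW.
apply: (@le_trans _ _ (\int[mu]_z (((r^-1)%:E) * ((fun z => (`|z| * jk z)%:E) \_ [set z | (r <= `|z|)%R]) z))%E).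
  apply: ge0_le_lower_integral => z _; first by rewrite lee_fin far_kernel_ge0.
  have e0 : `|z - 0| = `|z| by rewrite subr0.
  rewrite patchE /far_kernel subr0 indicE; have [rz|rz] := ltP r `|z|.
    have m1 : z \in [set y : 'rV[R]_d | r < `|y - 0|] by rewrite inE /= e0.
    have m2 : z \in [set y : 'rV[R]_d | r <= `|y|] by rewrite inE /= ltW.
    rewrite m1 m2 -EFinM lee_fin mulr1 mulrA.
    by rewrite -[leLHS]mul1r ler_wpM2r ?jker_ge0// ler_pdivlMl// mulr1 ltW.
  have m1 : z \notin [set y : 'rV[R]_d | r < `|y - 0|].
    by rewrite notin_setE /= e0; apply/negP; rewrite -leNgt.
  rewrite (negbTE m1) mulr0 mule_ge0// ?lee_fin//; case: ifP => // _.
  by rewrite lee_fin mulr_ge0 ?jker_ge0.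
pose h1 := (fun z => (`|z| * jk z)%:E) \_ [set z : 'rV[R]_d | (r <= `|z|)%R].
have mh1 : measurable_fun setT h1.
  apply/measurable_restrict => //; first exact: measurable_normr_ge.
  rewrite setTI; apply: measurable_funTS; apply/measurable_EFinP/measurable_funM.
    exact: measurable_norm_rV.
  exact: measurable_jker.
have h10 z : (0 <= h1 z)%E.
  by rewrite /h1 patchE; case: ifP => // _; rewrite lee_fin mulr_ge0 ?jker_ge0.
rewrite (@ge0_integralZl _ _ _ mu setT measurableT h1)// ?lee_fin//.
rewrite -integral_mkcond.
apply: (@le_trans _ _ ((r^-1)%:E * (C * (r / r `^ alpha))%:E)%E).
  by apply: lee_wpmul2l; [rewrite lee_fin|exact: h].
rewrite -EFinM lee_fin le_eqVlt; apply/orP; left; apply/eqP.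
by field; rewrite !gt_eqF// powR_gt0.
Qed.

Context (b : 'rV[R]_d -> 'rV[R]_d) (k : 'rV[R]_d -> 'rV[R]_d -> R) (Lam : R).
Hypothesis Lam0 : 0 < Lam.

(** The three factors account for ellipticity, for the change from Euclidean to max norm, and for
    moving the pole of the kernel from [x] to [x0]. *)
Definition jump_lo : R := Lam^-1 * ((d%:R `^ p)^-1 * (2 `^ p)^-1).
Definition jump_hi : R := Lam * 2 `^ p.

Definition far_mean (f : 'rV[R]_d -> R) (x0 : 'rV[R]_d) (r : R) : R :=
  \int[mu]_y (f y * far_kernel x0 r y).

(** [f] vanishes near [x], so only the jump integral of [f (x + z)] remains. Where [f] may be
    nonzero the distance to [x0] exceeds [2 * s] while [x] is within [s] of [x0], so the distances
    to [x] and to [x0] agree up to a factor 2. *)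
Lemma generator_far (f : 'rV[R]_d -> R) (x0 x : 'rV[R]_d) (s : R) :
  is_Cb2 f -> (forall y, 0 <= f y) -> (forall y, `|y - x0| <= 2 * s -> f y = 0) ->
  0 < s -> `|x - x0| <= s -> elliptic_at b k Lam x ->
  jump_lo * far_mean f x0 (2 * s) <= generator alpha b k f x
    <= jump_hi * far_mean f x0 (2 * s).
Proof.
move=> fC f0 fz s0 xs ex; set m := far_mean f x0 (2 * s).
have [M M0 [fM _ _]] := is_Cb2_bound fC.
have s2 : s < 2 * s by lra.
have fx : f x = 0 by apply: fz; exact: le_trans xs (ltW s2).
have pf i : partial i f x = 0.
  rewrite /partial (_ : 0 = 'D_(delta_mx ord0 i) (cst 0 : 'rV[R]_d -> R) x); last by rewrite derive_cst.
  apply: near_eq_derive.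
  apply/nbhs_ballP; exists s => //= y; rewrite -ball_normE /= => xy.
  apply: fz; rewrite -(subrKA x) (le_trans (ler_normD _ _))// mulr2n mulrDl mul1r lerD//.
  by rewrite distrC ltW.
have gx : grad f x = 0 by apply/rowP => i; rewrite !mxE pf.
have d0 z : dot z (0 : 'rV[R]_d) = 0 by apply: big1 => i _; rewrite mxE mulr0.
rewrite /generator gx d0 add0r.
pose phi y := (f y * far_kernel x0 (2 * s) y)%:E.
have phi0 y : (0 <= phi y)%E by rewrite lee_fin mulr_ge0 ?far_kernel_ge0.
have mphi : measurable_fun setT phi.
  apply/measurable_EFinP/measurable_funM; first exact: is_Cb2_measurable.
  exact: measurable_far_kernel.
have tr : (\int[mu]_z phi (x + z)%R = \int[mu]_z phi z)%E by exact: ge0_integral_translation.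
have mfin : (\int[mu]_z phi z)%E \is a fin_num.
  rewrite ge0_fin_numE; last exact: integral_ge0.
  have [C _ hC] := kappa_fin.
  apply: (@le_lt_trans _ _ (\int[mu]_y (M%:E * (far_kernel x0 (2 * s) y)%:E))%E).
    apply: ge0_le_lower_integral => // y _; rewrite -EFinM lee_fin.
    by rewrite ler_wpM2r ?far_kernel_ge0// (le_trans (ler_norm _)).
  rewrite (@ge0_integralZl _ _ _ mu setT measurableT
    (fun y => (far_kernel x0 (2 * s) y)%:E)) ?lee_fin//; last 2 first.
  - by apply/measurable_EFinP; exact: measurable_far_kernel.
  - by move=> y _; rewrite lee_fin far_kernel_ge0.
  have := hC x0 (2 * s); rewrite kappaE => /(_ (mulr_gt0 (ltr0n _ 2) s0)) h.
  by apply: lte_mul_pinfty; [rewrite lee_fin|by []|exact: le_lt_trans h (ltry _)].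
pose g (z : 'rV[R]_d) := (f (x + z) - f x - \1_[set z | enorm z <= 1] z * dot 0 z) *
  (k x z / enorm z `^ p).
have gE (z : 'rV[R]_d) : g z = f (x + z) * (k x z / enorm z `^ p).
  by rewrite /g fx dotC d0 mulr0 !subr0.
have two0 : 0 < 2 `^ p :> R by exact: powR_gt0.
have gphi (z : 'rV[R]_d) : ((jump_lo)%:E * phi (x + z)%R <= (g z)%:E <= (jump_hi)%:E * phi (x + z)%R)%E.
  rewrite gE -!EFinM !lee_fin.
  have [h|h] := leP `|x + z - x0| (2 * s).
    by rewrite (fz _ h) !mul0r !mulr0 lexx.
  rewrite /far_kernel indicE mem_set//= mulr1.
  have e1 : x + z - x0 = z + (x - x0) by rewrite -addrA addrCA.
  have v2 : `|x + z - x0| <= `|z| + s.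
    by rewrite e1; apply: le_trans (ler_normD _ _) _; lra.
  have z2 : `|z| <= `|x + z - x0| + s.
    have ez : z = (x + z - x0) - (x - x0) by rewrite e1 addrK.
    by rewrite {1}ez; apply: le_trans (ler_normB _ _) _; lra.
  have z0 : 0 < `|z| by lra.
  have v0 : 0 < `|x + z - x0| by lra.
  have j1 : jk z <= 2 `^ p * jk (x + z - x0).
    by apply: jker_le_scale => //; lra.
  have j2 : jk (x + z - x0) <= 2 `^ p * jk z.
    by apply: jker_le_scale => //; lra.
  have /andP[k1 k2] := kernel_le alpha12 Lam0 z ex.
  have k3 := kernel_ge d_gt0 alpha12 Lam0 z ex.
  apply/andP; split.
    have -> : jump_lo * (f (x + z) * jk (x + z - x0)) =
        f (x + z) * (Lam^-1 * ((d%:R `^ p)^-1 * ((2 `^ p)^-1 * jk (x + z - x0)))).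
      by rewrite /jump_lo; ring.
    apply: ler_wpM2l => //; apply: le_trans k3.
    apply: ler_wpM2l; first by rewrite invr_ge0 ltW.
    apply: ler_wpM2l; first by rewrite invr_ge0 powR_ge0.
    by rewrite ler_pdivrMl.
  have -> : jump_hi * (f (x + z) * jk (x + z - x0)) =
      f (x + z) * (Lam * (2 `^ p * jk (x + z - x0))) by rewrite /jump_hi; ring.
  apply: ler_wpM2l => //; apply: le_trans k2 _.
  by apply: ler_wpM2l => //; exact: ltW.
have lo0 : 0 <= jump_lo.
  by rewrite /jump_lo !mulr_ge0 ?invr_ge0 ?powR_ge0 ?(ltW Lam0).
have hi0 : 0 <= jump_hi by rewrite mulr_ge0 ?powR_ge0 ?(ltW Lam0).
have mphix : measurable_fun setT (fun z => phi (x + z)%R).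
  exact: (measurableT_comp mphi (measurable_addl_rV x)).
have IZ c : 0 <= c -> (\int[mu]_z (c%:E * phi (x + z)%R) = (c * m)%:E)%E.
  by move=> c0; rewrite ge0_integralZl// tr EFinM fineK.
have h1 : ((jump_lo * m)%:E <= \int[mu]_z (g z)%:E)%E.
  by rewrite -IZ//; apply: le_lower_integral => z _; have /andP[] := gphi z.
have h2 : (\int[mu]_z (g z)%:E <= (jump_hi * m)%:E)%E.
  by rewrite -IZ//; apply: le_lower_integral => z _; have /andP[] := gphi z.
rewrite /Rintegral; set I := (\int[mu]_z (g z)%:E)%E in h1 h2 *.
have If : I \is a fin_num by rewrite fin_numElt (lt_le_trans (ltNyr _) h1) (le_lt_trans h2 (ltry _)).
by move: h1 h2; rewrite -{1 2}(fineK If) !lee_fin => -> ->.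
Qed.

End jump_bounds.

(** * Exit law of a box *)

Section exit_law.
Context (R : realType) (d : nat) (alpha : R).
Hypothesis d_gt0 : (0 < d)%N.
Hypothesis alpha12 : 1 < alpha < 2.
Context (b : 'rV[R]_d -> 'rV[R]_d) (k : 'rV[R]_d -> 'rV[R]_d -> R) (Lam : R).
Hypothesis Lam0 : 0 < Lam.
Context (dO : measure_display) (Omega : measurableType dO).
Context (X : R -> Omega -> 'rV[R]_d) (Q : probability Omega R) (x0 : 'rV[R]_d) (s t : R).
Hypothesis mX : forall t, 0 <= t -> measurable_fun setT (X t).
Hypothesis rcX : forall w u, 0 <= u -> X s w @[s --> u^'+] --> X u w.
Hypothesis X0 : forall B, measurable B -> Q (X 0 @^-1` B) = dirac x0 B.
Hypothesis martX : forall f, is_Cb2 f -> martingale X Q (fun t w =>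
  f (X t w) - f (X 0 w) -
  \int[@lebesgue_measure R]_(s in `[0, t]) generator alpha b k f (X s w)).
Hypothesis locX : forall r : R, exists2 L : R, 0 < L & forall y, `|y| <= r -> elliptic_at b k L y.
Hypothesis s0 : 0 < s.
Hypothesis t0 : 0 < t.
Hypothesis ellF : forall y, `|y - x0| <= s -> elliptic_at b k Lam y.

Definition box : set 'rV[R]_d := [set y | `|y - x0| <= s].
Definition exit_at w : R := dyadic_exit box t (X ^~ w).
Definition exit_pos w : 'rV[R]_d := X (exit_at w) w.
Let es : R := \int[Q]_w exit_at w.
Let far : set 'rV[R]_d := [set y | 2 * s < `|y - x0|].
Let kap := kappa alpha x0 (2 * s).

Lemma closed_box : closed box.
Proof.
rewrite -[box]setCK; apply: open_closedC.
rewrite (_ : ~` box = [set y | s < `|y - x0|]); first exact: open_far.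
by apply/seteqP; split=> y /=; [move/negP; rewrite -ltNge|move=> h; apply/negP; rewrite -ltNge].
Qed.

Lemma exit_at_bounds w : 0 <= exit_at w <= t.
Proof. by rewrite dyadic_exit_ge0//= dyadic_exit_le. Qed.

Lemma measurable_exit_at : measurable_fun setT exit_at.
Proof. exact: (measurable_dyadic_exit mX closed_box t0). Qed.

Lemma measurable_exit_pos : measurable_fun setT exit_pos.
Proof. exact: (measurable_at_dyadic_exit mX rcX closed_box t0). Qed.

Lemma exit_at_integrable : Q.-integrable setT (EFin \o exit_at).
Proof.
apply: (@prob_bounded_integrable _ _ _ _ _ t measurable_exit_at) => w.
by have /andP[h1 h2] := exit_at_bounds w; rewrite ger0_norm.
Qed.

Lemma mean_exit_ge0 : 0 <= \int[Q]_w exit_at w.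
Proof. by apply: Rintegral_ge0 => w _; have /andP[] := exit_at_bounds w. Qed.

Lemma generator_local_bound f : is_Cb2 f ->
  forall r : R, exists C : R, forall y, `|y| <= r -> `|generator alpha b k f y| <= C.
Proof.
move=> fC r; have [L L0 ell] := locX r; have [M M0 [_ f1 f2]] := is_Cb2_bound fC.
have [C C0 hC] := generator_bound d_gt0 alpha12 L0.
pose u : R := d%:R^-1; have u0 : 0 < u by rewrite invr_gt0 ltr0n.
have du : d%:R * u <= 1 by rewrite mulfV// pnatr_eq0 -lt0n.
exists (C * (M + M * (u ^+ 2 / u `^ alpha) + M * (u / u `^ alpha))) => y yr.
exact: (hC b k f M M u y fC M0 M0 f1 f2 u0 du (ell _ yr)).
Qed.

Lemma exit_mean f (lo hi : R) : is_Cb2 f ->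
  (forall y, `|y - x0| <= s -> lo <= generator alpha b k f y <= hi) ->
  lo * \int[Q]_w exit_at w <= \int[Q]_w f (exit_pos w) - f x0 <= hi * \int[Q]_w exit_at w.
Proof.
move=> fC gF; have [M _ [fM _ _]] := is_Cb2_bound fC.
exact: (@dyadic_exit_mean _ _ _ _ X Q x0 box t f (generator alpha b k f) mX rcX X0
  closed_box t0 (is_Cb2_continuous fC) M fM (generator_local_bound fC) (martX fC) lo hi gF).
Qed.

(** Apply [exit_mean] to test functions increasing to the indicator of [U]. They vanish at the
    starting point, so their mean at the exit is directly comparable to the mean exit time
    multiplied by their far mean. The limit is monotone on one side and dominated on the other. *)
Lemma exit_kappa_open U : open U -> U `<=` far ->
  ((jump_lo d alpha Lam * es)%:E * kap U <= Q (exit_pos @^-1` U) <=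
   (jump_hi d alpha Lam * es)%:E * kap U)%E.
Proof.
move=> oU Ufar; have [f [fC f01 fout fnd fcv]] := open_approximation oU.
have mU : measurable U by exact: open_measurable_rV.
have mk := measurable_far_kernel alpha x0 (2 * s).
have k0 y := far_kernel_ge0 alpha x0 (2 * s) y.
have s20 : 0 < 2 * s by rewrite mulr_gt0.
have kfin A : measurable A -> kap A \is a fin_num.
  move=> mA; rewrite ge0_fin_numE//.
  have [C _ hC] := kappa_fin d alpha12.
  apply: le_lt_trans (le_lt_trans (hC x0 _ s20) (ltry _)).
  by apply: le_measure; rewrite ?inE.
pose m n := far_mean alpha (f n) x0 (2 * s).
have mcv : m n @[n --> \oo] --> fine (kap U).
  have cv : (\int[lebesgue_rV R d]_y (f n y * far_kernel alpha x0 (2 * s) y)%:E)%E @[n --> \oo]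
      --> kap U.
    rewrite /kap kappaE integral_mkcond.
    have -> : (\int[lebesgue_rV R d]_y ((fun y => (far_kernel alpha x0 (2 * s) y)%:E) \_ U) y =
        \int[lebesgue_rV R d]_y (limn (fun n => (f n y * far_kernel alpha x0 (2 * s) y)%:E)))%E.
      apply: eq_integral => y _; apply/esym/cvg_lim => //.
      have -> : ((fun y => (far_kernel alpha x0 (2 * s) y)%:E) \_ U) y =
          (\1_U y * far_kernel alpha x0 (2 * s) y)%:E.
        by rewrite patchE indicE; case: ifP => _; rewrite ?mul1r ?mul0r.
      apply: cvg_EFin; first exact: nearW.
      by apply: cvgMl; exact: fcv.
    apply: cvg_monotone_convergence => //.
    - by move=> n; apply/measurable_EFinP/measurable_funM => //; exact: is_Cb2_measurable.
    - by move=> n y _; rewrite lee_fin mulr_ge0//; have /andP[] := f01 n y.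
    - by move=> y _ i j ij; rewrite lee_fin ler_wpM2r//; exact: fnd.
  by apply: fine_cvg; rewrite fineK ?kfin.
have mpre : measurable (exit_pos @^-1` U).
  by rewrite -[X in measurable X]setTI; exact: measurable_exit_pos.
have nucv : \int[Q]_w f n (exit_pos w) @[n --> \oo] --> fine (Q (exit_pos @^-1` U)).
  have -> : fine (Q (exit_pos @^-1` U)) = \int[Q]_w (\1_U (exit_pos w) : R).
    by rewrite /Rintegral (integral_indic _ measurableT mpre) setIT.
  apply: (@dominated_cvg_Rintegral _ _ _ Q _ _ (cst 1)).
  - by move=> n; exact: (measurableT_comp (is_Cb2_measurable (fC n)) measurable_exit_pos).
  - exact: (measurableT_comp (measurable_indic mU) measurable_exit_pos).
  - exact: finite_measure_integrable_cst.
  - by move=> n w; have /andP[h1 h2] := f01 n (exit_pos w); rewrite ger0_norm.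
  - by move=> w; exact: fcv.
have nufin : Q (exit_pos @^-1` U) \is a fin_num.
  by rewrite ge0_fin_numE// (le_lt_trans (probability_le1 _ mpre))// ltry.
have key n : jump_lo d alpha Lam * es * m n <= \int[Q]_w f n (exit_pos w) <=
    jump_hi d alpha Lam * es * m n.
  have fz y : `|y - x0| <= 2 * s -> f n y = 0.
    by move=> h; apply: fout => /Ufar; rewrite /far /= ltNge h.
  have fx0 : f n x0 = 0 by apply: fz; rewrite subrr normr0 ltW.
  have gF y : `|y - x0| <= s -> jump_lo d alpha Lam * m n <= generator alpha b k (f n) y <=
      jump_hi d alpha Lam * m n.
    have fn0 z : 0 <= f n z by have /andP[] := f01 n z.
    move=> ys; have := generator_far d_gt0 alpha12 Lam0 (fC n) fn0 fz s0 ys (ellF ys).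
    exact.
  by have := exit_mean (fC n) gF; rewrite fx0 subr0 !(mulrAC _ (m n)).
rewrite -(fineK nufin) -(fineK (kfin _ mU)) -!EFinM !lee_fin; apply/andP; split.
- apply: ler_cvg_to nucv _; first exact: cvgMr mcv.
  by apply: nearW => n; have /andP[] := key n.
- apply: (ler_cvg_to nucv); first exact: cvgMr mcv.
  by apply: nearW => n; have /andP[] := key n.
Qed.

(** The generated name selects the pushforward together with its measure structure. *)
Definition exit_dist : {measure set 'rV[R]_d -> \bar R} :=
  measure_function_pushforward__canonical__measure_function_Measure Q measurable_exit_pos.

Lemma exit_distE A : exit_dist A = Q (exit_pos @^-1` A). Proof. by []. Qed.

Let mfar : measurable far.
Proof. by apply: open_measurable_rV; exact: open_far. Qed.

Let kap_far A : kap A = kap (A `&` far).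
Proof.
rewrite /kap !kappaE integral_mkcond [RHS]integral_mkcond; apply: eq_integral => y _.
rewrite !patchE; case: ifPn => yA; case: ifPn => // yAf.
- rewrite /far_kernel indicE memNset ?mulr0//.
  by move=> yf; move/negP: yAf; apply; rewrite inE; split => //; rewrite inE in yA.
- by move: yAf; rewrite inE => -[/mem_set]; rewrite (negbTE yA).
Qed.

Let exit_dist_fin : (exit_dist setT < +oo)%E.
Proof. by rewrite exit_distE preimage_setT probability_setT ltry. Qed.

Let s20 : 0 < 2 * s. Proof. by rewrite mulr_gt0. Qed.

Let kap_finite : (kap setT < +oo)%E.
Proof.
have [C _ hC] := kappa_fin d alpha12.
exact: le_lt_trans (hC x0 _ s20) (ltry _).
Qed.

Lemma jump_lo_ge0 : 0 <= jump_lo d alpha Lam.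
Proof. by rewrite /jump_lo !mulr_ge0 ?invr_ge0 ?powR_ge0 ?(ltW Lam0). Qed.

Lemma jump_hi_ge0 : 0 <= jump_hi d alpha Lam.
Proof. by rewrite mulr_ge0 ?powR_ge0 ?(ltW Lam0). Qed.

(** The scaled kernel measure is carried by [far], so the comparison on open subsets extends to all
    Borel sets by regularity of the exit law, and then to integrals. *)
Lemma exit_kernel_ge (phi : 'rV[R]_d -> \bar R) : measurable_fun setT phi ->
  (forall y, (0 <= phi y)%E) ->
  ((jump_lo d alpha Lam * es)%:E *
     \int[lebesgue_rV R d]_y (phi y * (far_kernel alpha x0 (2 * s) y)%:E) <=
   \int[Q]_w phi (exit_pos w))%E.
Proof.
move=> mphi phi0.
have c0 : 0 <= jump_lo d alpha Lam * es by rewrite mulr_ge0 ?jump_lo_ge0 ?mean_exit_ge0.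
have -> : (\int[Q]_w phi (exit_pos w) = \int[exit_dist]_y phi y)%E.
  by rewrite (ge0_integral_pushforward measurable_exit_pos)// preimage_setT.
rewrite -(@ge0_integral_density _ _ _ (lebesgue_rV R d) _ (measurable_far_kernel alpha x0 (2 * s))
  (far_kernel_ge0 alpha x0 (2 * s)) phi mphi phi0).
have := @ge0_integral_mscale _ _ _ kap setT measurableT (NngNum c0) phi mphi (fun y _ => phi0 y).
move=> /= <-; apply: (@ge0_le_measure_integral _ _ _ (mscale (NngNum c0) kap) exit_dist) => // A mA.
have h U : open U -> U `<=` far -> (mscale (NngNum c0) kap U <= exit_dist U)%E.
  by move=> oU /(exit_kappa_open oU)/andP[].
have e : mscale (NngNum c0) kap A = mscale (NngNum c0) kap (A `&` far).
  by congr (_ * _)%E; exact: kap_far.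
rewrite [leLHS]e; exact: (@measure_le_of_open _ _ (mscale (NngNum c0) kap) exit_dist far
  (@open_far _ _ _ _) exit_dist_fin h A mA).
Qed.

(** Same scheme with the roles exchanged: the exit law restricted to [far] is written as a density,
    and the outer regularity used is that of the finite scaled kernel. *)
Lemma exit_kernel_le (phi : 'rV[R]_d -> \bar R) : measurable_fun setT phi ->
  (forall y, (0 <= phi y)%E) ->
  (\int[Q]_w (phi (exit_pos w) * (\1_[set y | (2 * s < `|y - x0|)%R] (exit_pos w))%:E) <=
  (jump_hi d alpha Lam * es)%:E *
     \int[lebesgue_rV R d]_y (phi y * (far_kernel alpha x0 (2 * s) y)%:E))%E.
Proof.
move=> mphi phi0.
have c0 : 0 <= jump_hi d alpha Lam * es by rewrite mulr_ge0 ?jump_hi_ge0 ?mean_exit_ge0.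
have m1 : measurable_fun setT (\1_far : 'rV[R]_d -> R) by exact: measurable_indic.
have i0 (y : 'rV[R]_d) : 0 <= (\1_far y : R) by [].
have mphi1 : measurable_fun setT (fun y => phi y * (\1_far y)%:E)%E.
  by apply: emeasurable_funM => //; exact/measurable_EFinP.
have -> : (\int[Q]_w (phi (exit_pos w) * (\1_far (exit_pos w))%:E) =
    \int[exit_dist]_y (phi y * (\1_far y)%:E))%E.
  rewrite (ge0_integral_pushforward measurable_exit_pos)// ?preimage_setT//.
  by move=> y _; rewrite mule_ge0// lee_fin.
rewrite -(@ge0_integral_density _ _ _ exit_dist _ m1 i0 phi mphi phi0)
 -(@ge0_integral_density _ _ _ (lebesgue_rV R d) _ (measurable_far_kernel alpha x0 (2 * s))
  (far_kernel_ge0 alpha x0 (2 * s)) phi mphi phi0).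
have := @ge0_integral_mscale _ _ _ kap setT measurableT (NngNum c0) phi mphi (fun y _ => phi0 y).
move=> /= <-; apply: (@ge0_le_measure_integral _ _ _ (density exit_dist m1 i0)
  (mscale (NngNum c0) kap)) => // A mA.
have densE B : measurable B -> density exit_dist m1 i0 B = exit_dist (B `&` far).
  by move=> mB; rewrite /density integral_indic// setIC.
have mfin : (mscale (NngNum c0) kap setT < +oo)%E.
  by rewrite /mscale; apply: lte_mul_pinfty => //; rewrite ?lee_fin.
have h U : open U -> U `<=` far -> (density exit_dist m1 i0 U <= mscale (NngNum c0) kap U)%E.
  move=> oU Uf; rewrite densE; last exact: open_measurable_rV.
  by have /andP[_] := exit_kappa_open oU Uf; rewrite setIidl.
have e : density exit_dist m1 i0 A = density exit_dist m1 i0 (A `&` far).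
  by rewrite !densE// -?setIA ?setIid//; exact: measurableI.
rewrite [leLHS]e; exact: (@measure_le_of_open _ _ (density exit_dist m1 i0)
  (mscale (NngNum c0) kap) far (@open_far _ _ _ _) mfin h A mA).
Qed.

End exit_law.

Section process_from.
Context (R : realType) (d : nat) (alpha : R).
Context (b : 'rV[R]_d -> 'rV[R]_d) (k : 'rV[R]_d -> 'rV[R]_d -> R).
Context (dO : measure_display) (Omega : measurableType dO).
Context (X : R -> Omega -> 'rV[R]_d) (Q : probability Omega R) (x0 : 'rV[R]_d).

(** Collects what the estimates use about one process started at [x0], so that constants can be
    quantified before coefficients, process and point. *)
Definition process_from :=
  [/\ forall t : R, 0 <= t -> measurable_fun setT (X t),
    forall w (u : R), 0 <= u -> X s w @[s --> u^'+] --> X u w,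
    forall B, measurable B -> Q (X 0 @^-1` B) = dirac x0 B,
    forall f, is_Cb2 f -> martingale X Q (fun t w => f (X t w) - f (X 0 w) -
      \int[@lebesgue_measure R]_(s in `[0, t]) generator alpha b k f (X s w)) &
    forall r : R, exists2 L : R, 0 < L & forall y, `|y| <= r -> elliptic_at b k L y].

End process_from.

(** * Mean exit time from a box *)

Section mean_exit_bounds.
Context (R : realType) (d : nat) (alpha : R).
Hypothesis d_gt0 : (0 < d)%N.
Hypothesis alpha12 : 1 < alpha < 2.
Local Notation mu := (lebesgue_rV R d).
Local Notation p := (d%:R + alpha).

Let alpha_gt0 : 0 < alpha. Proof. by case/andP: alpha12 => /(lt_trans ltr01). Qed.

Let p_gt0 : 0 < p. Proof. by rewrite ltr_wpDl. Qed.

Lemma far_kernel_lower (x0 y : 'rV[R]_d) (r r' : R) : 0 < r -> r < `|y - x0| -> `|y - x0| <= r' ->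
  (r' `^ p)^-1 <= far_kernel alpha x0 r y.
Proof.
move=> r0 ry yr; rewrite /far_kernel indicE mem_set//= mulr1 /jker.
have y0 : 0 < `|y - x0| by exact: lt_trans ry.
have r'0 : 0 < r' by exact: lt_le_trans yr.
rewrite lef_pV2 ?posrE ?powR_gt0//.
by apply: ge0_ler_powR; rewrite ?nnegrE// ltW.
Qed.

Lemma integral_far_kernel_ge (phi : 'rV[R]_d -> R) (x0 : 'rV[R]_d) (r r' c : R) (A : set 'rV[R]_d) :
  0 < r -> 0 <= c -> measurable A -> (forall y, 0 <= phi y) ->
  (forall y, A y -> [/\ r < `|y - x0|, `|y - x0| <= r' & c <= phi y]) ->
  ((c * (r' `^ p)^-1)%:E * mu A <=
    \int[mu]_y ((phi y)%:E * (far_kernel alpha x0 r y)%:E))%E.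
Proof.
move=> r0 c0 mA phi0 hA.
have cc : 0 <= c * (r' `^ p)^-1 by rewrite mulr_ge0 ?invr_ge0 ?powR_ge0.
have m1 : measurable_fun setT (fun y : 'rV[R]_d => (\1_A y : R)%:E).
  by apply/measurable_EFinP; exact: measurable_indic.
have -> : ((c * (r' `^ p)^-1)%:E * mu A =
    \int[mu]_y ((c * (r' `^ p)^-1)%:E * (\1_A y : R)%:E))%E.
  by rewrite (@ge0_integralZl _ _ _ mu setT measurableT _ m1)// ?lee_fin//
    integral_indic// setIT.
apply: ge0_le_lower_integral => y _; first by rewrite mule_ge0// lee_fin.
rewrite -!EFinM lee_fin indicE; case: (boolP (y \in A)); last first.
  by rewrite mulr0 mulr_ge0 ?far_kernel_ge0.
rewrite inE mulr1 => /hA[h1 h2 h3].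
by rewrite ler_pM ?invr_ge0 ?powR_ge0// far_kernel_lower.
Qed.

(** Displacing all coordinates by [3 * s] yields a cube of half-side [s] at distance between [2 * s]
    and [4 * s] from [x0]. *)
Definition shell_center (x0 : 'rV[R]_d) (s : R) : 'rV[R]_d := x0 + const_mx (3 * s).

Lemma shell_ball x0 (s : R) y : ball (shell_center x0 s) s y ->
  2 * s < `|y - x0| <= 4 * s.
Proof.
move=> [s0 h].
have hi i : 2 * s < (y - x0) ord0 i < 4 * s.
  have := h ord0 i; rewrite /ball /= !mxE ltr_distlC => /andP[h1 h2].
  by apply/andP; split; lra.
apply/andP; split.
  have /andP[h1 h2] := hi (Ordinal d_gt0).
  apply: (lt_le_trans h1); apply: le_trans (coord_le_norm (y - x0) (Ordinal d_gt0)).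
  exact: ler_norm.
rewrite [leLHS]/Num.norm /= mx_normrE; apply/bigmax_leP; split => [|[i j] _ /=].
  by rewrite mulr_ge0// ltW.
by rewrite (ord1 i) ler_norml; have /andP[h1 h2] := hi j; apply/andP; split; lra.
Qed.

Context (Lam : R).
Hypothesis Lam0 : 0 < Lam.

(** The exit law has mass 1, and the cube at [shell_center] receives at least a multiple of the mean
    exit time times [s^-alpha]. The bound is uniform in the cap [t], which later allows the caps to
    grow. *)
Lemma mean_exit_le : exists2 C : R, 0 < C & forall b k dO (Omega : measurableType dO)
    (X : R -> Omega -> 'rV[R]_d) (Q : probability Omega R) x0 (s t : R),
  process_from alpha b k X Q x0 -> 0 < s -> 0 < t ->
  (forall y, `|y - x0| <= s -> elliptic_at b k Lam y) ->
  \int[Q]_w exit_at X x0 s t w <= C * s `^ alpha.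
Proof.
pose J := jump_lo d alpha Lam.
have J0 : 0 < J.
  by rewrite /J /jump_lo !mulr_gt0 ?invr_gt0 ?powR_gt0 ?ltr0n.
exists (J^-1 * (4 `^ p / 2 ^+ d)).
  by rewrite !mulr_gt0 ?invr_gt0 ?powR_gt0 ?exprn_gt0.
move=> b k dO Omega X Q x0 s t [mX rcX X0 martX locX] s0 t0 ell.
set es := \int[Q]_w _.
have s20 : 0 < 2 * s by rewrite mulr_gt0.
have es0 : 0 <= es by exact: mean_exit_ge0.
have := exit_kernel_ge d_gt0 alpha12 Lam0 mX rcX X0 martX locX s0 t0 ell
  (measurable_cst (1%:E : \bar R)) (fun=> lee01).
rewrite [X in (_ <= X)%E](_ : _ = 1%E); last first.
  by rewrite integral_cst// mul1e; exact: probability_setT.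
have shell y : ball (shell_center x0 s) s y ->
    [/\ 2 * s < `|y - x0|, `|y - x0| <= 4 * s & 1 <= (cst 1 y : R)].
  by move=> /shell_ball/andP[? ?]; split.
have := @integral_far_kernel_ge (cst 1) x0 (2 * s) (4 * s) 1 (ball (shell_center x0 s) s)
  s20 ler01 (open_measurable_rV (@open_ball_rV _ _ _ _)) (fun=> ler01) shell.
rewrite lebesgue_rV_ball// mul1r -EFinM => h1 h2.
have {}h2 : ((J * es)%:E * ((4 * s) `^ p)^-1%:E * ((2 * s) ^+ d)%:E <= 1)%E.
  rewrite -muleA; apply: le_trans h2; apply: lee_wpmul2l; last by rewrite -EFinM.
  by rewrite lee_fin mulr_ge0// ltW.
move: h2; rewrite -!EFinM lee_fin => h2.
rewrite -mulrA -ler_pdivrMl ?invr_gt0// invrK.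
have P0 : 0 < (4 * s) `^ p by rewrite powR_gt0// mulr_gt0.
rewrite -(ler_pdivlMr _ _ (exprn_gt0 _ s20)) ler_pdivrMr// in h2.
apply: le_trans h2 _; rewrite le_eqVlt; apply/orP; left; apply/eqP.
rewrite powRM ?(ltW s0)// [s `^ p]powRD; last by rewrite (gt_eqF s0) implybT.
rewrite (powR_mulrn _ (ltW s0)) exprMn.
by field; rewrite !expf_neq0// gt_eqF.
Qed.

(** The squared distance grows at rate at most [hi], so up to time [t] its mean is at most
    [hi * t = 1/4]; leaving early forces it above [1/2]. Hence exit before [t] is unlikely and the
    mean exit time is at least [t / 2]. *)
Lemma mean_exit_ge : exists2 c : R, 0 < c & forall b k dO (Omega : measurableType dO)
    (X : R -> Omega -> 'rV[R]_d) (Q : probability Omega R) x0 (s : R),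
  process_from alpha b k X Q x0 -> 0 < s -> s <= 1 -> d%:R * s <= 1 ->
  (forall y, `|y - x0| <= s -> elliptic_at b k Lam y) ->
  exists2 t, 0 < t & c * s `^ alpha <= \int[Q]_w exit_at X x0 s t w.
Proof.
have [C C0 hC] := generator_bound d_gt0 alpha12 Lam0.
exists (80 * C)^-1; first by rewrite invr_gt0 mulr_gt0.
move=> b k dO Omega X Q x0 s [mX rcX X0 martX locX] s0 s1 ds ell.
have sa0 : 0 < s `^ alpha by rewrite powR_gt0.
(* The rate [hi] is [10 * C / s^alpha] with [10 = 1 + 8 + 1] from the three terms of
   [generator_bound]; the factor 4 more makes [hi * t] equal to [1/4]. *)
pose t := s `^ alpha / (40 * C); have t0 : 0 < t by rewrite divr_gt0// mulr_gt0.
exists t => //.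
set es := \int[Q]_w _.
(* This absorbs the drift: its contribution [s^-1] is at most [s^-alpha] for [s <= 1]. *)
have sa_le : s `^ alpha <= s.
  rewrite -[leRHS](powRr1 (ltW s0)) ger_powR ?s0//.
  by have /andP[/ltW] := alpha12.
pose hi := 10 * C / s `^ alpha.
have [fC f1 f2] := sqdist_Cb2 x0 s0.
have gen_le y : `|y - x0| <= s -> - hi <= generator alpha b k (sqdist x0 s) y <= hi.
  move=> ys; rewrite -ler_norml.
  have si0 : 0 <= s^-1 by rewrite invr_ge0 ltW.
  have si2 : 0 <= 8 * s^-1 ^+ 2 by rewrite mulr_ge0 ?sqr_ge0.
  apply: le_trans (hC b k _ _ _ s y fC si0 si2 f1 f2 s0 ds (ell _ ys)) _.
  have -> : 8 * s^-1 ^+ 2 * (s ^+ 2 / s `^ alpha) = 8 * (s `^ alpha)^-1.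
    by field; rewrite !gt_eqF.
  have -> : s^-1 * (s / s `^ alpha) = (s `^ alpha)^-1 by field; rewrite !gt_eqF.
  have : s^-1 <= (s `^ alpha)^-1 by rewrite lef_pV2 ?posrE.
  move: (s^-1) (s `^ alpha)^-1 @hi => u v hi uv.
  rewrite /hi -mulrA [10 * _]mulrCA ler_wpM2l ?(ltW C0)//; lra.
have /andP[_ up] := exit_mean d_gt0 alpha12 mX rcX X0 martX locX t0 fC gen_le.
rewrite -/es sqdistxx subr0 in up.
have m1 := measurable_exit_at x0 s mX t0.
have i1 := exit_at_integrable Q x0 s mX t0.
have est : es <= t.
  rewrite -(prob_Rintegral_cst Q t); apply: le_Rintegral => //.
    exact: finite_measure_integrable_cst.
  by move=> w _; have /andP[] := exit_at_bounds X x0 s t0 w.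
pose If := \int[Q]_w sqdist x0 s (exit_pos X x0 s t w).
have If_le : If <= 4^-1.
  apply: le_trans up _; apply: le_trans (_ : hi * t <= _).
    by rewrite ler_wpM2l// /hi divr_ge0 ?(ltW sa0)// mulr_ge0 ?(ltW C0).
  rewrite le_eqVlt; apply/orP; left; apply/eqP; rewrite /hi /t.
  by field; rewrite !gt_eqF.
have mf : measurable_fun setT (fun w => sqdist x0 s (exit_pos X x0 s t w)).
  apply: (measurableT_comp (is_Cb2_measurable fC)).
  exact: measurable_exit_pos.
have [M _ [fM _ _]] := is_Cb2_bound fC.
have iF := @prob_bounded_integrable _ _ _ Q _ M mf (fun w => fM _).
(* A pointwise form of Chebyshev's inequality: without early exit the time is [t]; otherwise
   [sqdist] is at least [1/2] and the left side is at most 0. *)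
have pw w : t - 2 * t * sqdist x0 s (exit_pos X x0 s t w) <= exit_at X x0 s t w.
  have /andP[S0 St] := exit_at_bounds X x0 s t0 w.
  have f0 := sqdist_ge0 x0 s (exit_pos X x0 s t w).
  move: St; rewrite le_eqVlt => /predU1P[->|St].
    rewrite gerBl; apply: mulr_ge0 => //; apply: mulr_ge0 => //; exact: ltW.
  have h : ~ ball x0 s (exit_pos X x0 s t w).
    apply: (@dyadic_exit_lt_max _ _ (box x0 s) t (X ^~ w) t0 (@rcX w) _ _ _ St).
    - exact: open_ball_rV.
    - by move=> y; rewrite -ball_normE /box /= distrC => /ltW.
  have : 2^-1 <= sqdist x0 s (exit_pos X x0 s t w).
    apply: sqdist_far => //; rewrite leNgt; apply/negP => h1; apply: h.
    by rewrite -ball_normE /= distrC.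
  move: (sqdist _ _ _) => u hu; apply: le_trans S0.
  rewrite subr_le0 (_ : 2 * t * u = t * (2 * u)); last by ring.
  by rewrite ler_peMr ?(ltW t0)//; lra.
have iC : Q.-integrable setT (EFin \o cst t) by exact: finite_measure_integrable_cst.
have iZ := integrableZl measurableT (2 * t) iF.
have e : \int[Q]_w (t - 2 * t * sqdist x0 s (exit_pos X x0 s t w)) = t - 2 * t * If.
  by rewrite (RintegralB measurableT iC iZ) prob_Rintegral_cst RintegralZl.
have : t - 2 * t * If <= es.
  rewrite -e; apply: le_Rintegral => //.
  exact: (integrableB measurableT iC iZ).
apply: le_trans.
have -> : (80 * C)^-1 * s `^ alpha = t / 2 by rewrite /t; field; rewrite gt_eqF.
have : t * If <= t * 4^-1 by rewrite ler_wpM2l// ltW.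
by lra.
Qed.

End mean_exit_bounds.

(** * Exit from a ball *)

Section exit_time.
Context (R : realType) (d : nat) (dO : measure_display) (Omega : measurableType dO).
Context (X : R -> Omega -> 'rV[R]_d).
Implicit Types (G : set 'rV[R]_d) (w : Omega).

Lemma exit_time_eq G w (u : R) : 0 <= u -> (forall v, 0 <= v < u -> G (X v w)) ->
  ~ G (X u w) -> exit_time X G w = u%:E.
Proof.
move=> u0 h nG; apply/eqP; rewrite eq_le; apply/andP; split.
  by apply: ereal_inf_lbound; exists u.
apply: le_ereal_inf_tmp => _ [v [v0 nv] <-]; rewrite lee_fin leNgt; apply/negP => vu.
by apply: nv; apply: h; rewrite v0.
Qed.

Lemma exit_time_ge0 G w : (0 <= exit_time X G w)%E.
Proof. by apply: le_ereal_inf_tmp => _ [v [v0 _] <-]; rewrite lee_fin. Qed.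

Lemma before_exit_time G w (v : R) : 0 <= v -> (v%:E < exit_time X G w)%E -> G (X v w).
Proof.
move=> v0 vt; apply: contrapT => nG; move: vt; rewrite ltNge => /negP; apply.
by apply: ereal_inf_lbound; exists v.
Qed.

End exit_time.

Section exit_ball.
Context (R : realType) (d : nat) (dO : measure_display) (Omega : measurableType dO).
Context (X : R -> Omega -> 'rV[R]_d) (x0 : 'rV[R]_d).
Hypothesis rcX : forall w (u : R), 0 <= u -> X s w @[s --> u^'+] --> X u w.

(** Until the exit from the smaller box the path is inside the ball, so landing outside the ball at
    that moment is the first exit from it. *)
Lemma exit_time_inner_box (r s t : R) w : r < s -> 0 < t ->
  ~ ball x0 s (exit_pos X x0 r t w) ->
  exit_time X (ball x0 s) w = (exit_at X x0 r t w)%:E.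
Proof.
move=> rs t0 nG; apply: exit_time_eq => //.
  by have /andP[] := exit_at_bounds X x0 r t0 w.
move=> v /andP[v0 vS].
have : box x0 r (X v w).
  by apply: (@before_dyadic_exit _ _ _ t (X ^~ w) t0 (closed_box (x0:=x0) (s:=r)) (@rcX w)).
by rewrite -ball_normE /box /= distrC => /le_lt_trans; apply.
Qed.

(** The open ball and the closed box of the same radius differ by the boundary; landing strictly
    beyond it makes both exits coincide, provided the cap has not been reached. *)
Lemma exit_at_exit_time (s t u : R) w : 0 < s -> u < t ->
  exit_time X (ball x0 s) w = u%:E -> s < `|X u w - x0| -> exit_at X x0 s t w = u.
Proof.
move=> s0 ut e far.
have u0 : 0 <= u by rewrite -lee_fin -e exit_time_ge0.
have t0 : 0 < t by exact: le_lt_trans ut.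
have /andP[S0 St] := exit_at_bounds X x0 s t0 w.
apply/eqP; rewrite eq_le; apply/andP; split; rewrite leNgt; apply/negP => h.
  have := @before_dyadic_exit _ _ _ t (X ^~ w) t0 (closed_box (x0:=x0) (s:=s)) (@rcX w) _ u0 h.
  by rewrite /box /= leNgt far.
apply: (@dyadic_exit_lt_max _ _ (box x0 s) t (X ^~ w) t0 (@rcX w) (ball x0 s)).
- exact: open_ball_rV.
- by move=> y; rewrite -ball_normE /box /= distrC => /ltW.
- exact: lt_trans ut.
- by apply: before_exit_time => //; rewrite e lte_fin.
Qed.

End exit_ball.

Section limn_einf.
Context (R : realType).
Local Open Scope ereal_scope.
Implicit Types (u : (\bar R)^nat) (c : \bar R).

Lemma limn_einf_sup_einfs u : limn_einf u = ereal_sup (range (einfs u)).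
Proof. by rewrite limn_einf_lim; apply/cvg_lim => //; exact: cvg_einfs_sup. Qed.

Lemma limn_einf_ge u c N : (forall n, (N <= n)%N -> c <= u n) -> c <= limn_einf u.
Proof.
move=> h; rewrite limn_einf_sup_einfs.
apply: le_trans (_ : einfs u N <= _); last by apply: ereal_sup_ubound; exists N.
by apply: le_ereal_inf_tmp => _ [n /= Nn <-]; exact: h.
Qed.

Lemma limn_einf_le u c : (forall n, u n <= c) -> limn_einf u <= c.
Proof.
move=> h; rewrite limn_einf_sup_einfs; apply: ge_ereal_sup => _ [n _ <-].
by apply: le_trans (h n); apply: ereal_inf_lbound; exists n => /=.
Qed.

Lemma measurable_limn_einf d (T : measurableType d) (f : (T -> \bar R)^nat) :
  (forall n, measurable_fun setT (f n)) -> measurable_fun setT (fun x => limn_einf (f ^~ x)).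
Proof.
move=> mf; apply: measurableT_comp => //.
by apply: measurable_fun_limn_esup => n; exact: measurableT_comp.
Qed.

End limn_einf.

Section ball_exit_bounds.
Context (R : realType) (d : nat) (alpha : R).
Hypothesis d_gt0 : (0 < d)%N.
Hypothesis alpha12 : 1 < alpha < 2.
Context (Lam : R).
Hypothesis Lam0 : 0 < Lam.
Local Notation mu := (lebesgue_rV R d).
Local Notation p := (d%:R + alpha).

Let alpha_gt0 : 0 < alpha. Proof. by case/andP: alpha12 => /(lt_trans ltr01). Qed.
Let jlo0 : 0 < jump_lo d alpha Lam.
Proof. by rewrite /jump_lo !mulr_gt0 ?invr_gt0 ?powR_gt0 ?ltr0n. Qed.

Section mean_value.
Context (dO : measure_display) (Omega : measurableType dO).
Context (X : R -> Omega -> 'rV[R]_d) (Q : probability Omega R).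

(** Extended by 0 where the exit time is infinite, so that the mean value property becomes an
    integral over the whole sample space. *)
Definition exit_value (h : 'rV[R]_d -> R) (x0 : 'rV[R]_d) (s : R) (w : Omega) : \bar R :=
  ((fun w => (h (X (fine (exit_time X (ball x0 s) w)) w))%:E) \_
    [set w | (exit_time X (ball x0 s) w < +oo)%E]) w.

Lemma exit_value_fin h x0 (s u : R) w : exit_time X (ball x0 s) w = u%:E ->
  exit_value h x0 s w = (h (X u w))%:E.
Proof. by move=> e; rewrite /exit_value /patch mem_set /= e ?ltry. Qed.

Lemma exit_value_ge0 h x0 s w : (forall y, 0 <= h y) -> (0 <= exit_value h x0 s w)%E.
Proof. by move=> h0; rewrite /exit_value /patch; case: ifP => // _; rewrite lee_fin. Qed.

Lemma exit_value_le h x0 s w c : (0 <= c)%E ->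
  (forall u : R, exit_time X (ball x0 s) w = u%:E -> ((h (X u w))%:E <= c)%E) ->
  (exit_value h x0 s w <= c)%E.
Proof.
move=> c0 hc; case e : (exit_time X (ball x0 s) w) => [u||].
- by rewrite (exit_value_fin h e); exact: hc.
- by rewrite /exit_value /patch memNset //= e ltxx.
- by have := exit_time_ge0 X (ball x0 s) w; rewrite e.
Qed.

End mean_value.

(** Only the paths that jump from the inner box straight out of the ball are counted; for them the
    exit position is the measurable one of the box. *)
Lemma exit_value_lower : exists2 c : R, 0 < c & forall b k dO (Omega : measurableType dO)
    (X : R -> Omega -> 'rV[R]_d) (Q : probability Omega R) x0 (s : R) (h : 'rV[R]_d -> R),
  process_from alpha b k X Q x0 -> 0 < s -> s <= 1 -> d%:R * s <= 1 ->
  (forall y, `|y - x0| <= s -> elliptic_at b k Lam y) ->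
  measurable_fun setT h -> (forall y, 0 <= h y) ->
  ((c * s `^ alpha)%:E * \int[mu]_y ((h y)%:E * (far_kernel alpha x0 s y)%:E) <=
   \int[Q]_w exit_value X h x0 s w)%E.
Proof.
have [c c0 hc] := mean_exit_ge d_gt0 alpha12 Lam0.
exists (jump_lo d alpha Lam * (c * 2^-1 `^ alpha)).
  by apply: mulr_gt0 => //; apply: mulr_gt0 => //; rewrite powR_gt0.
move=> b k dO Omega X Q x0 s h pr s0 s1 ds ell mh h0.
(* With half the radius, the far region of the inner box begins exactly at distance [s]. *)
pose r := 2^-1 * s; have r0 : 0 < r by rewrite mulr_gt0.
have rs : r < s by rewrite /r; lra.
have er : 2 * r = s by rewrite /r mulrA divff ?mul1r// pnatr_eq0.
have d0 : 0 <= d%:R :> R by [].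
have [||y ys|t t0 ht] := hc b k dO Omega X Q x0 r pr r0.
- by rewrite /r; lra.
- by apply: le_trans ds; rewrite ler_wpM2l// ltW.
- by apply: ell; exact: le_trans ys (ltW rs).
have [mX rcX X0 martX locX] := pr.
pose phi (y : 'rV[R]_d) : \bar R := ((h y)%:E * (\1_[set y : 'rV[R]_d | s < `|y - x0|] y)%:E)%E.
have mphi : measurable_fun setT phi.
  apply: emeasurable_funM; apply/measurable_EFinP => //.
  by apply: measurable_indic; apply: open_measurable_rV; exact: open_far.
have phi0 y : (0 <= phi y)%E by rewrite mule_ge0 ?lee_fin.
have ellr y : `|y - x0| <= r -> elliptic_at b k Lam y.
  by move=> yr; apply: ell; exact: le_trans yr (ltW rs).
have := exit_kernel_ge d_gt0 alpha12 Lam0 mX rcX X0 martX locX r0 t0 ellr mphi phi0.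
rewrite er => h1.
apply: le_trans (_ : (jump_lo d alpha Lam * \int[Q]_w exit_at X x0 r t w)%:E *
  \int[mu]_y (phi y * (far_kernel alpha x0 s y)%:E) <= _)%E.
  rewrite [X in (_ * X <= _)%E](_ : _ = \int[mu]_y (phi y * (far_kernel alpha x0 s y)%:E))%E.
    apply: lee_wpmul2r.
      by apply: integral_ge0 => y _; rewrite mule_ge0// lee_fin far_kernel_ge0.
    rewrite lee_fin -mulrA ler_pM2l//; apply: le_trans ht.
    by rewrite -mulrA -powRM ?(ltW s0) ?invr_ge0.
  apply: eq_integral => y _; rewrite /phi -muleA; congr (_ * _)%E; rewrite -EFinM; congr EFin.
  by rewrite /far_kernel mulrCA; congr (_ * _); rewrite indicE; case: (_ \in _);
    rewrite ?mulr1 ?mul0r.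
apply: le_trans h1 _; apply: ge0_le_lower_integral => w _ //.
rewrite /phi indicE; case: (boolP (_ \in _)); last by rewrite mule0 exit_value_ge0.
rewrite inE /= => far; rewrite mule1.
rewrite (exit_value_fin h (exit_time_inner_box rcX rs t0 _))// -ball_normE /= distrC.
by apply/negP; rewrite -leNgt ltW.
Qed.

(** At the exit either the jump goes beyond [2 * s], which the kernel estimate pays for, or [h] is
    at most [M], improved to [m] when the path jumps from the inner box into [A]. The latter has
    probability at least [q] at every scale. *)
Lemma exit_value_upper : exists2 C : R, 0 < C & exists2 q : R, 0 < q < 1 &
  forall b k dO (Omega : measurableType dO)
    (X : R -> Omega -> 'rV[R]_d) (Q : probability Omega R) x0 (s : R) (h : 'rV[R]_d -> R)
    (A : set 'rV[R]_d) (m M : R),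
  process_from alpha b k X Q x0 -> 0 < s -> s <= 1 -> d%:R * s <= 1 ->
  (forall y, `|y - x0| <= s -> elliptic_at b k Lam y) ->
  measurable_fun setT h -> (forall y, 0 <= h y) ->
  measurable A -> A `<=` ball (shell_center x0 (2^-1 * s)) (2^-1 * s) ->
  ((2^-1 * s ^+ d)%:E <= mu A)%E ->
  (forall y, A y -> h y <= m) -> 0 <= m -> m <= M ->
  (forall y, `|y - x0| <= 2 * s -> h y <= M) ->
  (\int[Q]_w exit_value X h x0 s w <= (M * (1 - q) + m * q)%:E +
   (C * s `^ alpha)%:E * \int[mu]_y ((h y)%:E * (far_kernel alpha x0 (2 * s) y)%:E))%E.
Proof.
have [c c0 hc] := mean_exit_ge d_gt0 alpha12 Lam0.
have [C C0 hC] := mean_exit_le d_gt0 alpha12 Lam0.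
(* Long jumps cost [jump_hi] times the mean exit time; the maximum with 1 secures positivity. *)
exists (Num.max 1 (jump_hi d alpha Lam * C)); first by rewrite lt_max ltr01.
(* Jump rate, mean exit time from the half box, kernel at distance [2 * s] and volume of [A]: the
   powers of [s] cancel, leaving this number. *)
pose q0 := jump_lo d alpha Lam * (c * 2^-1 `^ alpha) * ((2 `^ p)^-1 * 2^-1).
have q00 : 0 < q0 
  by apply: mulr_gt0; [apply: mulr_gt0 => //; apply: mulr_gt0|apply: mulr_gt0];
    rewrite ?invr_gt0 ?powR_gt0.
pose q := Num.min q0 2^-1.
have qq0 : q <= q0 by rewrite ge_min lexx.
exists q; first by rewrite lt_min q00 gt_min; apply/andP; split; lra.
move=> b k dO Omega X Q x0 s h A m M pr s0 s1 ds ell mh h0 mA Ash Abig Am m0 mM hM.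
have [mX rcX X0 martX locX] := pr.
have M0 : 0 <= M by exact: le_trans mM.
pose r := 2^-1 * s; have r0 : 0 < r by rewrite mulr_gt0.
have rs : r < s by rewrite /r; lra.
have er : 2 * r = s by rewrite /r mulrA divff ?mul1r// pnatr_eq0.
have er4 : 4 * r = 2 * s by rewrite /r; lra.
have ellr y : `|y - x0| <= r -> elliptic_at b k Lam y.
  by move=> yr; apply: ell; exact: le_trans yr (ltW rs).
have [||t t0 ht] := hc b k dO Omega X Q x0 r pr r0 _ _ ellr.
- by rewrite /r; lra.
- by apply: le_trans ds; rewrite ler_wpM2l// ltW.
pose B := exit_pos X x0 r t @^-1` A.
have mB : measurable B.
  by rewrite -[B]setTI; apply: (measurable_exit_pos x0 r mX rcX t0).
have Ashell y : A y -> s < `|y - x0| <= 2 * s.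
  by move=> /Ash /(shell_ball d_gt0); rewrite -/r er er4.
have QB : (q%:E <= Q B)%E.
  have mI : measurable_fun setT (fun y => (\1_A y)%:E : \bar R).
    by apply/measurable_EFinP; exact: measurable_indic.
  have := exit_kernel_ge d_gt0 alpha12 Lam0 mX rcX X0 martX locX r0 t0 ellr mI
    (fun y => ltac:(by rewrite lee_fin)).
  have -> : (\int[Q]_w (\1_A (exit_pos X x0 r t w))%:E = Q B)%E.
    by rewrite -[B in RHS]setIT -(integral_indic Q measurableT mB).
  apply: le_trans.
  have lowA : (((1 * ((2 * s) `^ p)^-1)%:E * mu A) <=
      \int[mu]_y ((\1_A y)%:E * (far_kernel alpha x0 (2 * r) y)%:E))%E.
    apply: integral_far_kernel_ge => //; first by rewrite er.
    by move=> y Ay; rewrite er; have /andP[-> ->] := Ashell _ Ay; rewrite indicE mem_set.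
  apply: le_trans (_ : (q0%:E <= _)%E); first by rewrite lee_fin.
  apply: le_trans (lee_wpmul2l _ lowA); last first.
    by rewrite lee_fin mulr_ge0 ?mean_exit_ge0// ltW.
  have P0 : 0 < (2 * s) `^ p by rewrite powR_gt0// mulr_gt0.
  apply: le_trans (_ : (jump_lo d alpha Lam * (c * r `^ alpha))%:E *
    ((((2 * s) `^ p)^-1)%:E * (2^-1 * s ^+ d)%:E) <= _)%E; last first.
    apply: lee_pmul.
    - rewrite lee_fin; apply: mulr_ge0; first exact: ltW.
      by rewrite mulr_ge0 ?powR_ge0// ltW.
    - by rewrite -EFinM lee_fin !mulr_ge0 ?invr_ge0 ?powR_ge0 ?exprn_ge0// ltW.
    - by rewrite lee_fin ler_pM2l.
    - by rewrite mul1r lee_wpmul2l// lee_fin invr_ge0 ltW.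
  rewrite -!EFinM lee_fin le_eqVlt; apply/orP; left; apply/eqP.
  rewrite /q0 /r !powRM ?invr_ge0 ?(ltW s0)// [s `^ p]powRD; last by rewrite (gt_eqF s0) implybT.
  rewrite (powR_mulrn _ (ltW s0)).
  by field; rewrite !expf_neq0 ?gt_eqF ?powR_gt0.
(* The exit time from the ball may be non-measurable: the long jumps are
   dominated through Fatou's lemma by the capped exits, the passage through [A]
   by the measurable event [B]. *)
pose phi (y : 'rV[R]_d) : \bar R := ((h y)%:E * (\1_[set y : 'rV[R]_d | 2 * s < `|y - x0|] y)%:E)%E.
have mphi : measurable_fun setT phi.
  apply: emeasurable_funM; apply/measurable_EFinP => //.
  by apply: measurable_indic; apply: open_measurable_rV; exact: open_far.
have phi0 y : (0 <= phi y)%E by rewrite mule_ge0 ?lee_fin.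
pose F (n : nat) w := phi (exit_pos X x0 s n.+1%:R w).
have mF n : measurable_fun setT (F n).
  exact: (measurableT_comp mphi (measurable_exit_pos x0 s mX rcX _)).
have F0 n w : (0 <= F n w)%E by exact: phi0.
pose Lf w := limn_einf (F ^~ w).
have mLf : measurable_fun setT Lf by exact: measurable_limn_einf.
have Lf0 w : (0 <= Lf w)%E by exact: (@limn_einf_ge _ _ _ 0).
set I := (\int[mu]_y _)%E.
have I0 : (0 <= I)%E.
  by apply: integral_ge0 => y _; rewrite mule_ge0 ?lee_fin// far_kernel_ge0.
have intLf : (\int[Q]_w Lf w <= (Num.max 1 (jump_hi d alpha Lam * C) * s `^ alpha)%:E * I)%E.
  apply: le_trans (fatou Q measurableT mF (fun n w _ => F0 n w)) _.
  apply: limn_einf_le => n.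
  have n0 : 0 < n.+1%:R :> R by [].
  have mhE : measurable_fun setT (fun y => (h y)%:E) by exact/measurable_EFinP.
  apply: le_trans (exit_kernel_le d_gt0 alpha12 Lam0 mX rcX X0 martX locX s0 n0 ell mhE
    (fun y => ltac:(by rewrite lee_fin))) _.
  apply: lee_wpmul2r => //; rewrite lee_fin.
  apply: le_trans (_ : jump_hi d alpha Lam * (C * s `^ alpha) <= _).
    by rewrite ler_wpM2l ?jump_hi_ge0//; exact: (hC b k dO Omega X Q x0 s n.+1%:R).
  by rewrite mulrA ler_wpM2r ?powR_ge0// le_max lexx orbT.
have nB : (Q B <= 1)%E by exact: probability_le1.
have QBf : Q B \is a fin_num by rewrite ge0_fin_numE// (le_lt_trans nB) ?ltry.
pose g w : R := M - (M - m) * \1_B w.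
have g0 w : 0 <= g w.
  rewrite /g indicE; case: (_ \in _); rewrite ?mulr1 ?mulr0 ?subr0//.
  by rewrite opprB addrC subrK.
have mg : measurable_fun setT g.
  by apply: measurable_funB => //; apply: measurable_funM => //; exact: measurable_indic.
have bound w : (exit_value X h x0 s w <= (g w)%:E + Lf w)%E.
  apply: exit_value_le => [|u e]; first by rewrite adde_ge0// lee_fin.
  have u0 : 0 <= u by rewrite -lee_fin -e exit_time_ge0.
  have [far|near] := ltP (2 * s) `|X u w - x0|.
    rewrite -[leLHS]add0e; apply: leeD; first by rewrite lee_fin.
    (* Once the cap [n.+1] exceeds the exit time [u], the capped exit is the true one, so the lower
       limit dominates [h] at the exit. *)
    apply: (@limn_einf_ge _ _ _ (Num.truncn u)) => n un.
    have ult : u < n.+1%:R.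
      have /andP[_ /lt_le_trans] := truncn_itv u0; apply.
      by rewrite ler_nat ltnS.
    have fs : s < `|X u w - x0| by apply: lt_trans far; lra.
    rewrite /F /exit_pos (exit_at_exit_time rcX s0 ult e fs) /phi indicE mem_set//.
    by rewrite mule1.
  rewrite -[leLHS]adde0; apply: leeD => //; rewrite lee_fin /g indicE.
  case: (boolP (w \in B)) => [|_]; last by rewrite mulr0 subr0 hM.
  rewrite inE => wB; rewrite mulr1 opprB addrC subrK.
  have /andP[sA _] := Ashell _ wB.
  have nb : ~ ball x0 s (exit_pos X x0 r t w).
    by rewrite -ball_normE /= distrC; apply/negP; rewrite -leNgt ltW.
  by have := exit_time_inner_box rcX rs t0 nb; rewrite e => -[->]; exact: Am.
apply: (@le_trans _ _ (\int[Q]_w ((g w)%:E + Lf w))%E).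
  by apply: ge0_le_lower_integral => w _ //; exact: exit_value_ge0.
rewrite ge0_integralD//; last 2 first.
- by move=> w _; rewrite lee_fin.
- exact/measurable_EFinP.
apply: leeD => //.
have iB : Q.-integrable setT (EFin \o (\1_B : Omega -> R)) by exact: integrable_indic.
have iM : Q.-integrable setT (EFin \o (cst M : Omega -> R)).
  exact: finite_measure_integrable_cst.
have -> : (\int[Q]_w (g w)%:E = (M - (M - m) * fine (Q B))%:E)%E.
  have ig : Q.-integrable setT (EFin \o g).
    apply: (@prob_bounded_integrable _ _ _ _ _ M mg) => w; rewrite ger0_norm ?g0//.
    by rewrite /g gerBl mulr_ge0// subr_ge0.
  rewrite -[LHS]fineK; last exact: integrable_fin_num.
  congr EFin; rewrite -/(Rintegral _ _ _).
  rewrite (RintegralB measurableT iM (integrableZl measurableT (M - m) iB)).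
  rewrite prob_Rintegral_cst RintegralZl//; congr (_ - _ * _).
  by rewrite /Rintegral integral_indic// setIT.
have : q <= fine (Q B) by rewrite -lee_fin fineK.
rewrite lee_fin => qB.
have : (M - m) * q <= (M - m) * fine (Q B) by rewrite ler_wpM2l// subr_ge0.
by lra.
Qed.

End ball_exit_bounds.

(** * Weighted integrals and the Harnack inequality *)

Section weight.
Context (R : realType) (d : nat) (alpha : R).
Hypothesis d_gt0 : (0 < d)%N.
Hypothesis alpha12 : 1 < alpha < 2.
Local Notation mu := (lebesgue_rV R d).
Local Notation p := (d%:R + alpha).

Let p_gt0 : 0 < p.
Proof. by case/andP: alpha12 => /(lt_trans ltr01) a0 _; rewrite ltr_wpDl. Qed.

(** Comparable to the far kernel of every point of a bounded set, so a single weighted integral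
    serves all starting points. *)
Definition weight (z : 'rV[R]_d) : R := ((1 + `|z|) `^ p)^-1.

Lemma weight_ge0 z : 0 <= weight z. Proof. by rewrite invr_ge0 powR_ge0. Qed.

Lemma measurable_weight : measurable_fun setT weight.
Proof.
have -> : weight = (fun z => (1 + `|z|) `^ (- p)).
  by apply/funext => z; rewrite powRN.
apply: (measurableT_comp (measurable_powR _)).
by apply: measurable_funD => //; exact: measurable_norm_rV.
Qed.

Lemma inv_powR_le_scale (c u v : R) : 0 < c -> 0 < u -> 0 < v -> u <= c * v ->
  (v `^ p)^-1 <= c `^ p * (u `^ p)^-1.
Proof.
move=> c0 u0 v0 uv.
rewrite ler_pdivlMr ?powR_gt0// mulrC ler_pdivrMr ?powR_gt0// -powRM ?(ltW c0) ?(ltW v0)//.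
by apply: ge0_ler_powR => //; rewrite ?nnegrE ?mulr_ge0 ?(ltW c0) ?(ltW u0) ?(ltW v0) ?(ltW p_gt0).
Qed.

(** With [v = |z - x| > r], the quantity [1 + |z|] is at most [(1 + Rad) + v], and [r <= 2] turns
    this into [(3 + Rad) * v / r]. *)
Lemma far_kernel_le_weight (Rad r : R) (x z : 'rV[R]_d) : `|x| <= Rad -> 0 < r -> r <= 2 ->
  far_kernel alpha x r z <= ((3 + Rad) / r) `^ p * weight z.
Proof.
move=> xR r0 r2; rewrite /far_kernel indicE; case: (boolP (_ \in _)); last first.
  by rewrite mulr0 mulr_ge0 ?powR_ge0 ?weight_ge0.
rewrite inE /= mulr1 => far.
have R0 : 0 <= Rad by exact: le_trans xR.
apply: inv_powR_le_scale.
- by rewrite divr_gt0// ltr_pwDl.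
- by rewrite ltr_pwDl.
- exact: lt_trans far.
have h1 : `|z| <= `|z - x| + Rad.
  by rewrite -[X in `|X| <= _](subrK x); apply: le_trans (ler_normD _ _) _; lra.
apply: (@le_trans _ _ ((1 + Rad) + `|z - x|)); first lra.
move: far; move: (`|z - x|) => v rv.
rewrite mulrAC ler_pdivlMr// mulrDl [leRHS]mulrDl.
have : (1 + Rad) * r <= (1 + Rad) * v by rewrite ler_wpM2l ?addr_ge0// ltW.
have : v * r <= v * 2 by rewrite ler_wpM2l// (le_trans (ltW r0)) ?(ltW rv).
have : 0 <= Rad * v by rewrite mulr_ge0// (le_trans (ltW r0)) ?(ltW rv).
lra.
Qed.

Lemma weight_le_far_kernel (Rad r : R) (x z : 'rV[R]_d) : `|x| <= Rad -> 0 < r ->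
  r < `|z - x| -> weight z <= (1 + Rad) `^ p * far_kernel alpha x r z.
Proof.
move=> xR r0 far; rewrite /far_kernel indicE mem_set// mulr1.
have R0 : 0 <= Rad by exact: le_trans xR.
apply: inv_powR_le_scale.
- by rewrite ltr_pwDl.
- exact: lt_trans far.
- by rewrite ltr_pwDl.
apply: le_trans (ler_normB _ _) _; rewrite mulrDr mulr1 mulrDl mul1r.
have : 0 <= Rad * `|z| by rewrite mulr_ge0.
lra.
Qed.

Lemma weight_ge (Rad : R) (z : 'rV[R]_d) : `|z| <= Rad -> ((1 + Rad) `^ p)^-1 <= weight z.
Proof.
move=> zR; have R0 : 0 <= Rad by exact: le_trans zR.
rewrite lef_pV2 ?posrE ?powR_gt0 ?ltr_pwDl//.
by apply: ge0_ler_powR; rewrite ?(ltW p_gt0) ?nnegrE ?addr_ge0 ?lerD2l.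
Qed.

Context (D : set 'rV[R]_d).

(** With [upper_bound_on] below, this is the interface to probability: the rest of the argument
    concerns a function [h] satisfying both. *)
Definition lower_bound_on (h : 'rV[R]_d -> R) (c : R) := forall x (s : R),
  0 < s -> s <= 1 -> d%:R * s <= 1 -> (forall y, `|y - x| <= s -> D y) ->
  ((c * s `^ alpha)%:E * \int[mu]_y ((h y)%:E * (far_kernel alpha x s y)%:E) <= (h x)%:E)%E.

Definition upper_bound_on (h : 'rV[R]_d -> R) (C q : R) := forall x (s : R) A (m M : R),
  0 < s -> s <= 1 -> d%:R * s <= 1 -> (forall y, `|y - x| <= s -> D y) ->
  measurable A -> A `<=` ball (shell_center x (2^-1 * s)) (2^-1 * s) ->
  ((2^-1 * s ^+ d)%:E <= mu A)%E ->
  (forall y, A y -> h y <= m) -> 0 <= m -> m <= M ->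
  (forall y, `|y - x| <= 2 * s -> h y <= M) ->
  ((h x)%:E <= (M * (1 - q) + m * q)%:E +
   (C * s `^ alpha)%:E * \int[mu]_y ((h y)%:E * (far_kernel alpha x (2 * s) y)%:E))%E.

Let mhw (h : 'rV[R]_d -> R) : measurable_fun setT h ->
  measurable_fun setT (fun z => (h z * weight z)%:E).
Proof.
by move=> mh; apply/measurable_EFinP; apply: measurable_funM => //; exact: measurable_weight.
Qed.

(** Mass away from [y] is controlled by [h y] directly. Mass near [y] is far mass as seen from any
    [z] of an intermediate ball, so it bounds [h z] from below on that ball, and the ball in turn
    bounds [h y]. *)
Lemma lower_bound_weight (c s Rad : R) : 0 < c -> 0 < s -> s <= 1 -> d%:R * s <= 1 -> 0 <= Rad ->
  exists2 K : R, 0 < K & forall (h : 'rV[R]_d -> R) (y : 'rV[R]_d), measurable_fun setT h -> (forall z, 0 <= h z) ->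
    lower_bound_on h c -> `|y| <= Rad -> (forall z, `|z - y| <= 5 * s -> D z) ->
    (\int[mu]_z (h z * weight z)%:E <= (K * h y)%:E)%E.
Proof.
move=> c0 s0 s1 ds R0.
have sa0 : 0 < s `^ alpha by rewrite powR_gt0.
(* The intermediate points are within [4 * s <= 4] of [y], so [Rad + 4] bounds their norm. *)
pose K1 := (1 + (Rad + 4)) `^ p / (c * s `^ alpha).
have K10 : 0 < K1 by rewrite divr_gt0 ?mulr_gt0 ?powR_gt0// ltr_pwDl// addr_ge0.
(* Obtained by solving for the near mass [n] the inequality that bounds [h y] below by the integral
   over the intermediate ball. *)
pose K2 := K1 * (4 * s) `^ p / (2 * s) ^+ d / (c * s `^ alpha).
have P0 : 0 < (4 * s) `^ p by rewrite powR_gt0 ?mulr_gt0.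
have S0 : 0 < (2 * s) ^+ d by rewrite exprn_gt0 ?mulr_gt0.
have K20 : 0 < K2.
  apply: divr_gt0; last exact: mulr_gt0.
  by apply: divr_gt0 => //; apply: mulr_gt0.
exists (K1 + K2); first by rewrite addr_gt0.
move=> h y mh h0 low yR yD.
have far_part x (F : set 'rV[R]_d) : measurable F -> `|x| <= Rad + 4 ->
    (forall z, F z -> s < `|z - x|) -> (forall z, `|z - x| <= s -> D z) ->
    (\int[mu]_(z in F) (h z * weight z)%:E <= (K1 * h x)%:E)%E.
  move=> mF xR Fs xD; have := low x s s0 s1 ds xD.
  set I := (\int[_]_ _ _)%E => hI.
  apply: le_trans (_ : ((1 + (Rad + 4)) `^ p)%:E * I <= _)%E.
    rewrite -ge0_integralZl//; last 3 first.
    - by apply: emeasurable_funM; apply/measurable_EFinP => //; exact: measurable_far_kernel.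
    - by move=> z _; rewrite mule_ge0 ?lee_fin// far_kernel_ge0.
    - by rewrite lee_fin powR_ge0.
    rewrite [leLHS]integral_mkcond; apply: ge0_le_lower_integral => z _.
      by rewrite /patch; case: ifP => // _; rewrite lee_fin mulr_ge0 ?weight_ge0.
    rewrite /patch; case: ifPn => [|_]; last first.
      by rewrite !mule_ge0 ?lee_fin ?powR_ge0 ?far_kernel_ge0.
    rewrite inE => Fz; rewrite -!EFinM lee_fin mulrCA ler_wpM2l//.
    exact: (weight_le_far_kernel xR s0 (Fs _ Fz)).
  have -> : (1 + (Rad + 4)) `^ p = K1 * (c * s `^ alpha).
    by rewrite /K1 divfK// mulf_neq0// gt_eqF.
  by rewrite EFinM -muleA [leRHS]EFinM lee_wpmul2l// lee_fin ltW.
pose Nr := [set z : 'rV[R]_d | `|z - y| <= s].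
have cNr : ~` Nr = [set z | s < `|z - y|].
  by apply/seteqP; split=> z; rewrite /Nr /= ltNge => /negP.
have mNr : measurable Nr.
  by rewrite -[Nr]setCK cNr; apply: measurableC; apply: open_measurable_rV; exact: open_far.
have mNrC : measurable (~` Nr) by exact: measurableC.
have hw0 z : (0 <= (h z * weight z)%:E)%E by rewrite lee_fin mulr_ge0 ?weight_ge0.
rewrite -(setUv Nr) ge0_integral_setU//; last 2 first.
- by rewrite setUv; exact: mhw.
- by rewrite disj_set2E setICr.
rewrite mulrDl EFinD addeC; apply: leeD.
  apply: far_part => //.
  - by apply: le_trans yR _; rewrite lerDl.
  - by move=> z; rewrite cNr.
  - by move=> z zs; apply: yD; apply: le_trans zs _; rewrite ler_peMl ?(ltW s0)//; lra.
(* Such [z] is farther than [2 * s] from [y], hence farther than [s] from all of [Nr]; its own ball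
   of radius [s] lies within [5 * s] of [y]. *)
have shell z : ball (shell_center y s) s z ->
    (\int[mu]_(v in Nr) (h v * weight v)%:E <= (K1 * h z)%:E)%E.
  move=> /(shell_ball d_gt0)/andP[z1 z2].
  apply: far_part => //.
  - rewrite -[z](subrK y); apply: le_trans (ler_normD _ _) _; lra.
  - move=> v vy; have := ler_normD (z - v) (v - y).
    by rewrite addrA subrK (distrC z v); move: vy; rewrite /Nr /=; lra.
  - move=> v vz; apply: yD; rewrite -[v](subrK z) -addrA.
    by apply: le_trans (ler_normD _ _) _; lra.
have Nfin : (\int[mu]_(v in Nr) (h v * weight v)%:E)%E \is a fin_num.
  rewrite ge0_fin_numE; last exact: integral_ge0.
  apply: le_lt_trans (shell (shell_center y s) (ballxx _ s0)) _; exact: ltry.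
rewrite -(fineK Nfin) lee_fin; set n := fine _.
have n0 : 0 <= n by rewrite fine_ge0// integral_ge0.
have {}shell z : ball (shell_center y s) s z ->
    [/\ s < `|z - y|, `|z - y| <= 4 * s & K1^-1 * n <= h z].
  move=> zb; have := shell z zb; rewrite -(fineK Nfin) lee_fin => hz.
  have /andP[z1 z2] := shell_ball d_gt0 zb; split => //; first by lra.
  by rewrite ler_pdivrMl.
have K1n : 0 <= K1^-1 * n by rewrite mulr_ge0// invr_ge0 ltW.
have ys : forall z, `|z - y| <= s -> D z.
  by move=> z zs; apply: yD; apply: le_trans zs _; rewrite ler_peMl ?(ltW s0)//; lra.
have := @integral_far_kernel_ge _ _ _ alpha12 h y s (4 * s) _ _ s0 K1n
  (open_measurable_rV (@open_ball_rV _ _ _ _)) h0 shell.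
rewrite lebesgue_rV_ball// -EFinM => h1.
have cs0 : (0 <= (c * s `^ alpha)%:E)%E by rewrite lee_fin mulr_ge0// ltW.
have := le_trans (lee_wpmul2l cs0 h1) (low y s s0 s1 ds ys).
rewrite -EFinM lee_fin => h2.
have := ler_wpM2l (ltW K20) h2; congr (_ <= _).
by rewrite /K2; field; rewrite !gt_eqF.
Qed.

End weight.

Section weighted_sup.
Context (R : realType) (d : nat) (alpha : R).
Hypothesis d_gt0 : (0 < d)%N.
Hypothesis alpha12 : 1 < alpha < 2.
Local Notation mu := (lebesgue_rV R d).
Local Notation p := (d%:R + alpha).

Lemma bernoulli_sub (x : R) n : 0 <= x <= 1 -> 1 - n%:R * x <= (1 - x) ^+ n.
Proof.
move=> /andP[x0 x1]; elim: n => [|n IH]; first by rewrite mul0r subr0 expr0.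
rewrite exprS; have y0 : 0 <= 1 - x by lra.
apply: le_trans (ler_wpM2l y0 IH); rewrite -natr1.
have : 0 <= n%:R * x * x by rewrite !mulr_ge0.
by lra.
Qed.

(** The weighted supremum [N] is compared with itself at scale [s = kap * rho x]: a point where [h]
    is small on half of the shell gains the factor [1 - q / 4], any other point is already
    controlled by [W]. *)
Lemma upper_bound_weight (C q eps Rad : R) (D : set 'rV[R]_d) :
  0 < C -> 0 < q < 1 -> 0 < eps -> eps <= 1 -> 0 <= Rad -> (forall z, D z -> `|z| <= Rad) ->
  exists2 K : R, 0 < K & forall (h : 'rV[R]_d -> R) (x0 : 'rV[R]_d) (W : R),
    measurable_fun setT h -> (forall z, 0 <= h z) -> (exists B, forall z, h z <= B) ->
    upper_bound_on alpha D h C q -> (forall z, `|z - x0| <= eps -> D z) ->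
    (\int[mu]_z (h z * weight alpha z)%:E = W%:E)%E -> h x0 <= K * W.
Proof.
move=> C0 /andP[q0 q1] e0 e1 R0 DR.
have d0 : 0 < d%:R :> R by rewrite ltr0n.
have d1 : 1 <= d%:R :> R by rewrite ler1n.
(* Chosen so that [2 * d * kap = q / 4]: replacing [rho x] by [(1 - 2 * kap) * rho x] in the power
   [d] then costs less than the gain [q]. *)
pose kap := q / (8 * d%:R); have kap0 : 0 < kap by rewrite divr_gt0 ?mulr_gt0.
have dkap : d%:R * kap = q / 8 by rewrite /kap; field; rewrite gt_eqF.
have kap8 : kap <= 8^-1.
  by have : kap * 1 <= kap * d%:R; [rewrite ler_wpM2l// ltW|rewrite mulr1 [kap * _]mulrC dkap; lra].
have kapd0 : 0 < kap ^+ d by rewrite exprn_gt0.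
clearbody kap.
pose K1 := (kap ^+ d)^-1 * (C * ((3 + Rad) / 2) `^ p + 4 * (1 + Rad) `^ p).
have R10 : 0 < 1 + Rad by lra.
have R30 : 0 < (3 + Rad) / 2 by lra.
have w10 : 0 < (1 + Rad) `^ p by rewrite powR_gt0.
have w30 : 0 < ((3 + Rad) / 2) `^ p by rewrite powR_gt0.
have K10 : 0 < K1 by apply: mulr_gt0; [rewrite invr_gt0|apply: addr_gt0; exact: mulr_gt0].
have ed0 : 0 < eps ^+ d by rewrite exprn_gt0.
exists (4 * K1 / q / eps ^+ d).
  by rewrite divr_gt0// divr_gt0// mulr_gt0.
move=> h x0 W mh h0 [B hB] up x0D hW.
have W0 : 0 <= W.
  by rewrite -lee_fin -hW; apply: integral_ge0 => z _; rewrite lee_fin mulr_ge0 ?weight_ge0.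
pose rho (x : 'rV[R]_d) := eps - `|x - x0|.
pose V := [set h x * rho x ^+ d | x in [set x | 0 < rho x]].
have rho_le x : rho x <= eps by rewrite /rho gerBl.
have Vx0 : V (h x0 * eps ^+ d).
  by exists x0 => /=; rewrite /rho subrr normr0 subr0.
(* The bound [B] only ensures that [N] is a finite supremum; it does not enter [K]. *)
have ubV : ubound V `|B|.
  move=> _ [x /= rx <-]; rewrite -[`|B|]mulr1; apply: ler_pM => //.
  - by rewrite exprn_ge0// ltW.
  - by apply: le_trans (hB x) (ler_norm _).
  - by rewrite exprn_ile1 ?(ltW rx)// (le_trans (rho_le x)).
have supV : has_sup V by split; [exists (h x0 * eps ^+ d)|exists `|B|].
set N := sup V.
have VN x : 0 < rho x -> h x * rho x ^+ d <= N.
  by move=> rx; apply: ub_le_sup; [exact: supV.2|exists x].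
have N0 : 0 <= N.
  by apply: le_trans (ub_le_sup supV.2 Vx0); rewrite mulr_ge0// ltW.
have step x : 0 < rho x -> h x * rho x ^+ d <= (1 - q / 4) * N + K1 * W.
  move=> rx; have [s sE] : exists s, s = kap * rho x by exists (kap * rho x).
  have s0 : 0 < s by rewrite sE mulr_gt0.
  have rx1 : rho x <= 1 by exact: le_trans (rho_le x) e1.
  have s8 : s <= 8^-1 * rho x by rewrite sE ler_wpM2r// ltW.
  have s1 : s <= 1 by lra.
  have ds : d%:R * s <= 1.
    rewrite sE mulrA dkap -[leRHS]mulr1; apply: ler_pM => //; last lra; first lra.
    exact: ltW.
  have rdist y : rho x - `|y - x| <= rho y.
    have := ler_normD (y - x) (x - x0); rewrite addrA subrK /rho; lra.
  have inD y : `|y - x| <= 2 * s -> D y.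
    move=> ys; apply: x0D; have := rdist y; rewrite /rho.
    by move: s8 rx; rewrite /rho; lra.
  have sD y : `|y - x| <= s -> D y by move=> ys; apply: inD; lra.
  have xD : D x by apply: inD; rewrite subrr normr0; lra.
  have xR := DR _ xD.
  have rd0 : 0 < rho x ^+ d by rewrite exprn_gt0.
  have sd0 : 0 < s ^+ d by rewrite exprn_gt0.
  have erd : rho x ^+ d = (kap ^+ d)^-1 * s ^+ d.
    by rewrite sE exprMn mulKf// gt_eqF.
  have s20 : 0 < 2^-1 * s by rewrite mulr_gt0.
  pose S := ball (shell_center x (2^-1 * s)) (2^-1 * s).
  have mS : measurable S by apply: open_measurable_rV; exact: open_ball_rV.
  have muS : mu S = (s ^+ d)%:E.
    by rewrite lebesgue_rV_ball// mulrA divff ?mul1r// pnatr_eq0.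
  pose L := [set y | h y <= 2^-1 * h x].
  have mL : measurable L.
    have -> : L = h @^-1` `]-oo, 2^-1 * h x]%classic.
      by apply/seteqP; split=> y; rewrite /L /= in_itv.
    by rewrite -[X in measurable X]setTI; exact: mh.
  have shellS y : S y -> `|y - x| <= 2 * s.
    by move=> /(shell_ball d_gt0)/andP[_]; rewrite mulrA; lra.
  have split_S : (mu (S `&` L) + mu (S `\` L) = (s ^+ d)%:E)%E.
    by rewrite -muS (measureDI mu mS mL) addeC.
  have hx0 : 0 <= 2^-1 * h x by rewrite mulr_ge0.
  have [small|big] := leP (2^-1 * s ^+ d)%:E (mu (S `&` L)).
    (* Within [2 * s] of [x] the function [rho] is at least [(1 - 2 * kap) * rho x], so the
       definition of [N] bounds [h] by [M] there. *)
    pose M := N / ((1 - 2 * kap) * rho x) ^+ d.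
    have k2 : 0 < 1 - 2 * kap by lra.
    have k2r : 0 < (1 - 2 * kap) * rho x by rewrite mulr_gt0.
    have hM y : `|y - x| <= 2 * s -> h y <= M.
      move=> ys; have ry : (1 - 2 * kap) * rho x <= rho y.
        by apply: le_trans (rdist y); rewrite mulrBl mul1r -mulrA; move: ys; rewrite sE; lra.
      rewrite ler_pdivlMr ?exprn_gt0//; apply: le_trans (VN y (lt_le_trans k2r ry)).
      by rewrite ler_wpM2l// lerXn2r// nnegrE ltW// (lt_le_trans k2r).
    have hxM : 2^-1 * h x <= M.
      by apply: le_trans (hM x _); [have := h0 x; lra|rewrite subrr normr0; lra].
    have mSL : measurable (S `&` L) by exact: measurableI.
    have hL y : (S `&` L) y -> h y <= 2^-1 * h x by case.
    have := up x s (S `&` L) _ M s0 s1 ds sD mSL (@subIsetl _ S L) small hL hx0 hxM hM.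
    have hI : (\int[mu]_y ((h y)%:E * (far_kernel alpha x (2 * s) y)%:E) <=
        (((3 + Rad) / (2 * s)) `^ p * W)%:E)%E.
      rewrite EFinM -hW -ge0_integralZl//; last 3 first.
      - by apply/measurable_EFinP/measurable_funM => //; exact: measurable_weight.
      - by move=> y _; rewrite lee_fin mulr_ge0 ?weight_ge0.
      - by rewrite lee_fin powR_ge0.
      apply: ge0_le_lower_integral => y _; first by rewrite mule_ge0 ?lee_fin ?far_kernel_ge0.
      rewrite -!EFinM lee_fin [leRHS]mulrCA ler_wpM2l//.
      by apply: far_kernel_le_weight => //; lra.
    have cs0 : (0 <= (C * s `^ alpha)%:E)%E by rewrite lee_fin mulr_ge0 ?powR_ge0// ltW.
    move=> /le_trans/(_ (leeD2l _ (lee_wpmul2l cs0 hI))).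
    rewrite -!EFinM -EFinD lee_fin => h1.
    have eW : C * s `^ alpha * (((3 + Rad) / (2 * s)) `^ p * W) * rho x ^+ d =
        (kap ^+ d)^-1 * (C * ((3 + Rad) / 2) `^ p) * W.
      have -> : (3 + Rad) / (2 * s) = (3 + Rad) / 2 * s^-1 by rewrite invfM mulrA.
      have -> : ((3 + Rad) / 2 * s^-1) `^ p = ((3 + Rad) / 2) `^ p * (s `^ p)^-1.
        by rewrite powRM ?invr_ge0 ?(ltW s0) ?(ltW R30)// -(powR_inv1 (ltW s0)) -powRrM mulN1r powRN.
      rewrite erd [s `^ p]powRD; last by rewrite (gt_eqF s0) implybT.
      rewrite (powR_mulrn _ (ltW s0)).
      by field; rewrite !gt_eqF// powR_gt0.
    have := ler_wpM2r (ltW rd0) h1; rewrite mulrDl eW [X in _ <= X + _]mulrDl.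
    have eM : M * (1 - q) * rho x ^+ d = (1 - q) / (1 - 2 * kap) ^+ d * N.
      rewrite /M exprMn; field; rewrite !gt_eqF ?exprn_gt0//.
    (* By Bernoulli the denominator is at least [1 - q / 4], and
       [(1 - 3 / 4 * q) * (1 - q / 4) >= 1 - q]. Adding the share [q / 2] of [m = h x / 2] gives
       [1 - q / 4]. *)
    have M1 : (1 - q) / (1 - 2 * kap) ^+ d * N <= (1 - 3 / 4 * q) * N.
      rewrite ler_wpM2r// ler_pdivrMr ?exprn_gt0//.
      have /(@bernoulli_sub _ d) : 0 <= 2 * kap <= 1 by apply/andP; split; lra.
      rewrite mulrCA dkap => b1; have q34 : 0 <= 1 - 3 / 4 * q by lra.
      apply: le_trans (ler_wpM2l q34 b1); have : 0 <= q * q by rewrite mulr_ge0// ltW.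
      lra.
    have M2 : 2^-1 * h x * q * rho x ^+ d <= 2^-1 * q * N.
      rewrite (_ : 2^-1 * h x * q * rho x ^+ d = 2^-1 * q * (h x * rho x ^+ d)); last by ring.
      by apply: ler_wpM2l (VN x rx); rewrite mulr_ge0 ?invr_ge0// ltW.
    rewrite eM /K1 mulrDr mulrDl.
    have : 0 <= (kap ^+ d)^-1 * (4 * (1 + Rad) `^ p) * W.
      by rewrite !mulr_ge0 ?invr_ge0// ltW.
    lra.
  have big' : ((2^-1 * s ^+ d)%:E <= mu (S `\` L))%E.
    rewrite leNgt; apply/negP => sm; have := lteD big sm.
    by rewrite split_S -EFinD lte_fin; lra.
  (* On half of the shell [h] exceeds [h x / 2], and the weight is bounded below on [D]; the two
     halves make the factor 4 in [K1]. *)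
  have hw1 : ((2^-1 * h x * ((1 + Rad) `^ p)^-1 * (2^-1 * s ^+ d))%:E <= W%:E)%E.
    have c0 : 0 <= 2^-1 * h x * ((1 + Rad) `^ p)^-1.
      by rewrite mulr_ge0// invr_ge0 ltW.
    apply: (@le_trans _ _ ((2^-1 * h x * ((1 + Rad) `^ p)^-1)%:E * mu (S `\` L))%E).
      by rewrite EFinM lee_wpmul2l// lee_fin.
    rewrite -integral_cst; last exact: measurableD.
    rewrite -hW [leLHS]integral_mkcond; apply: ge0_le_lower_integral => y _.
      by rewrite /patch; case: ifP => // _; rewrite lee_fin.
    rewrite /patch; case: ifPn => [|_]; last by rewrite lee_fin mulr_ge0 ?weight_ge0.
    rewrite inE => -[Sy nL]; rewrite lee_fin; apply: ler_pM => //.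
    - by rewrite invr_ge0 ltW.
    - by move/negP : nL; rewrite -ltNge => /ltW.
    - by apply: (weight_ge alpha12); apply/DR/inD/shellS.
  rewrite lee_fin in hw1.
  have := ler_wpM2l (_ : 0 <= (kap ^+ d)^-1 * (4 * (1 + Rad) `^ p)) hw1.
  rewrite mulr_ge0 ?invr_ge0 ?(ltW kapd0) ?mulr_ge0 ?(ltW w10)// => /(_ isT).
  rewrite (_ : _ * (2^-1 * h x * ((1 + Rad) `^ p)^-1 * (2^-1 * s ^+ d)) = h x * rho x ^+ d);
    last by rewrite erd; field; rewrite !gt_eqF.
  move=> /le_trans; apply; rewrite /K1 mulrDr mulrDl.
  have : 0 <= (kap ^+ d)^-1 * (C * ((3 + Rad) / 2) `^ p) * W.
    by rewrite !mulr_ge0 ?invr_ge0// ltW.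
  have : 0 <= (1 - q / 4) * N by rewrite mulr_ge0//; lra.
  by lra.
(* The estimate is uniform in [x], so it passes to the supremum, and finiteness of [N] lets
   [q / 4 * N] be isolated. *)
have NW : N <= (1 - q / 4) * N + K1 * W.
  by apply: ge_sup; [exists (h x0 * eps ^+ d)|move=> _ [x /= rx <-]; exact: step].
have := ub_le_sup supV.2 Vx0; rewrite -/N => hN.
rewrite -ler_pdivlMr// in hN; apply: le_trans hN _.
have NK : N <= 4 * K1 / q * W.
  rewrite mulrAC ler_pdivlMr//; move: NW; set t := K1 * W.
  by rewrite -mulrA -/t; lra.
by rewrite mulrAC ler_wpM2r// invr_ge0 ltW.
Qed.

End weighted_sup.

(** * Domains, harmonic functions and conclusion *)

Section domains.
Context (R : realType) (d : nat).
Implicit Types (D K : set 'rV[R]_d) (x : 'rV[R]_d).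

Lemma bounded_rV_le D : bounded_set D -> exists2 r : R, 0 < r & forall z, D z -> `|z| <= r.
Proof. by move=> /pinfty_ex_gt0[r r0 hr]; exists r. Qed.

(** Makes balls admissible in the mean value property; connectedness comes from the segments issuing
    from the centre. *)
Lemma bounded_domain_ball x (s : R) : 0 < s -> bounded_domain (ball x s).
Proof.
move=> s0; split; last first.
  exists (`|x| + s); split; first exact: num_real.
  move=> r hr y; rewrite -ball_normE /= => xy; apply: le_trans (ltW hr).
  rewrite -[y](subrK x) addrC; apply: le_trans (ler_normD _ _) _.
  by rewrite distrC lerD2l ltW.
split; [exact: open_ball_rV| |by exists x; exact: ballxx].
rewrite (_ : ball x s = \bigcup_(y in ball x s) ((fun t : R => x + t *: (y - x)) @` `[0, 1])).
  apply: bigcup_connected.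
    exists x => y _ /=; exists 0; first by rewrite /= in_itv /= lexx ler01.
    by rewrite scale0r addr0.
  move=> y _; apply: connected_continuous_connected; first exact: segment_connected.
  apply: continuous_subspaceT => t; apply: cvgD; first exact: cvg_cst.
  by apply: cvgZr_tmp; exact: cvg_id.
apply/seteqP; split=> [y xy|_ [y xy [t /= t01 <-]]].
  by exists y => //=; exists 1; rewrite ?in_itv /= ?lexx ?ler01// scale1r addrC subrK.
move: t01; rewrite in_itv /= => /andP[t0 t1]; move: xy; rewrite -ball_normE /=.
rewrite opprD addrA subrr add0r normrN normrZ ger0_norm// distrC; apply: le_lt_trans.
by rewrite ler_piMl.
Qed.

(** Small enough radii work near each point of [K], and the near-covering form of compactness makes
    the choice uniform. *)
Lemma compact_uniform_nbhs D K : open D -> compact K -> K `<=` D ->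
  exists2 eps : R, 0 < eps & forall x, K x -> forall z, `|z - x| <= eps -> D z.
Proof.
move=> oD cK KD.
have [e /= e0 he] : \forall e \near 0^'+, K `<=` (fun x => forall z, `|z - x| <= e -> D z).
  apply: ((compact_near_coveringP K).1 cK R (0^'+)
    (fun e x => forall z, `|z - x| <= e -> D z)) => x /KD Dx.
  have /nbhs_ballP[e /= e0 eD] : nbhs x D by exact: open_nbhs_nbhs.
  have e20 : 0 < e / 2 by rewrite divr_gt0.
  exists (ball x (e / 2), [set i | i < e / 2]).
    by split => /=; [exact: nbhsx_ballx|exact: nbhs_right_lt].
  move=> [x' i] [/= xx' ie] z zx'; apply: eD; rewrite -ball_normE /=.
  move: xx'; rewrite -ball_normE /= => xx'.
  rewrite -(subrK x' x) -addrA; apply: le_lt_trans (ler_normD _ _) _.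
  rewrite (distrC x' z); lra.
exists (e / 2); first by rewrite divr_gt0.
move=> x Kx; apply: (he (e / 2)) => //=; last by rewrite divr_gt0.
by rewrite sub0r normrN gtr0_norm ?divr_gt0//; lra.
Qed.

End domains.

Section harmonic.
Context (R : realType) (d : nat) (alpha : R) (lambda : R -> R).
Hypothesis d_gt0 : (0 < d)%N.
Hypothesis alpha12 : 1 < alpha < 2.
Context (D : set 'rV[R]_d).
Hypothesis domD : bounded_domain D.
Context (b : 'rV[R]_d -> 'rV[R]_d) (k : 'rV[R]_d -> 'rV[R]_d -> R).

(** The maximum with 1 is positive before any operator is at hand, and enlarging the constant only
    weakens ellipticity. *)
Definition ellipticity (G : set 'rV[R]_d) : R := Num.max (lambda_dom lambda G) 1.

Lemma ellipticity_gt0 G : 0 < ellipticity G.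
Proof. by rewrite lt_max ltr01 orbT. Qed.

Hypothesis bk : class_L lambda b k.

Lemma class_L_elliptic G y : bounded_domain G -> G y -> elliptic_at b k (ellipticity G) y.
Proof.
move=> domG Gy; have [_ _ k0 h] := bk; have [hb hk] := h G domG y Gy.
have l0 : 0 < lambda_dom lambda G.
  by have /andP[_] := hk 0; apply: lt_le_trans.
have lE : lambda_dom lambda G <= ellipticity G by rewrite le_max lexx.
split; first exact: le_trans lE.
move=> z; have /andP[k1 k2] := hk z; rewrite (le_trans k2 lE) andbT; apply: le_trans k1.
by rewrite lef_pV2 ?posrE ?ellipticity_gt0.
Qed.

Context (dO : measure_display) (Omega : measurableType dO).
Context (X : R -> Omega -> 'rV[R]_d) (P : probability 'rV[R]_d R -> probability Omega R).
Hypothesis XP : strong_markov_process_for X P (generator alpha b k).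

Lemma process_from_strong_markov x : process_from alpha b k X (P_ P x) x.
Proof.
have [mX cX _ aX] := XP; split.
- exact: mX.
- by move=> w u u0; apply: (cX w).1.
- by move=> B mB; rewrite (aX (dirac x)).1.
- by move=> f fC; exact: (aX (dirac x)).2.
- move=> r; exists (ellipticity (ball 0 (`|r| + 1))); first exact: ellipticity_gt0.
  move=> y yr; apply: class_L_elliptic.
    by apply: bounded_domain_ball; rewrite ltr_wpDl.
  rewrite -ball_normE /= sub0r normrN; apply: le_lt_trans yr _.
  by rewrite (le_lt_trans (ler_norm r))// ltrDl.
Qed.

Context (h : 'rV[R]_d -> R).
Hypothesis hD : harmonic_for X P h D.

Lemma harmonic_exit_value x (s : R) : 0 < s -> (forall y, `|y - x| <= s -> D y) ->
  ((h x)%:E = \int[P_ P x]_w exit_value X h x s w)%E.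
Proof.
move=> s0 xD; have GD : ball x s `<=` D.
  by move=> y; rewrite -ball_normE /= distrC => /ltW; exact: xD.
have := hD.2 _ (bounded_domain_ball x s0) GD x (ballxx _ s0).
by rewrite integral_mkcond.
Qed.

End harmonic.

Theorem theorem4p1 (R : realType) (d : nat) (alpha theta : R) (lambda : R -> R)
    (D K : set 'rV[R]_d)
    (d_gt0 : (0 < d)%N)
    (alpha12 : 1 < alpha < 2)
    (lambda_gt0 : forall r : R, 0 <= r -> 0 < lambda r)
    (lambda_nd : forall r s : R, 0 <= r -> r <= s -> lambda r <= lambda s)
    (theta01 : 0 < theta < 1)
    (domD : bounded_domain D) (cptK : compact K) (KD : K `<=` D) :
  exists C_H : R,
  forall (b : 'rV[R]_d -> 'rV[R]_d) (k : 'rV[R]_d -> 'rV[R]_d -> R),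
    class_Lsym lambda b k \/ class_I alpha theta lambda b k ->
  forall (dO : measure_display) (Omega : measurableType dO)
         (X : R -> Omega -> 'rV[R]_d)
         (P : probability 'rV[R]_d R -> probability Omega R),
    strong_markov_process_for X P (generator alpha b k) ->
  forall h : 'rV[R]_d -> R,
    bounded_fun h -> (forall x, 0 <= h x) -> harmonic_for X P h D ->
  forall x y, K x -> K y -> h x <= C_H * h y.
Proof.
have Lam0 := ellipticity_gt0 lambda D.
have [[oD _ _] bD] := domD.
have [Rad Rad0 DRad] := bounded_rV_le bD.
have [e e0 KeD] := compact_uniform_nbhs oD cptK KD.
have d1 : 1 <= d%:R :> R by rewrite ler1n.
pose eps := Num.min e 1.
have eps0 : 0 < eps by rewrite lt_min e0 ltr01.
have eps1 : eps <= 1 by rewrite ge_min lexx orbT.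
have epse : eps <= e by rewrite ge_min lexx.
(* The factor 5 is the reach of the chain of balls in [lower_bound_weight]; dividing by [d] ensures
   [d%:R * s <= 1]. *)
pose s := eps / (5 * d%:R).
have s5 : d%:R * s = eps / 5 by rewrite /s; field; rewrite pnatr_eq0 -lt0n.
have s0 : 0 < s by rewrite divr_gt0// mulr_gt0// ltr0n.
have sd : s <= d%:R * s by rewrite ler_peMl// ltW.
(* From here to the choice of [C_H] all constants are fixed from [D], [K] and [lambda] together with
   [d] and [alpha], before the operator and the process. *)
have [c c0 lower] := exit_value_lower d_gt0 alpha12 Lam0.
have [C C0 [q q01 upper]] := exit_value_upper d_gt0 alpha12 Lam0.
have [||K1 K10 hK1] := @lower_bound_weight _ _ _ d_gt0 alpha12 D c s Rad c0 s0 _ _ (ltW Rad0).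
- lra.
- lra.
have [K2 K20 hK2] :=
  upper_bound_weight d_gt0 alpha12 C0 q01 eps0 eps1 (ltW Rad0) DRad.
exists (K2 * K1) => b k cls dO Omega X P XP h bh h0 hD x y Kx Ky.
have bk : class_L lambda b k by case: cls => -[].
have pr z := process_from_strong_markov bk XP z.
have ell z (r : R) : (forall y, `|y - z| <= r -> D y) ->
    forall y, `|y - z| <= r -> elliptic_at b k (ellipticity lambda D) y.
  by move=> zD v vz; apply: class_L_elliptic => //; exact: zD.
have mh := hD.1.
have low : lower_bound_on alpha D h c.
  move=> z r r0 r1 dr zD; rewrite (harmonic_exit_value hD r0 zD).
  exact: (lower b k _ _ _ _ z r h (pr z) r0 r1 dr (ell z r zD) mh h0).
have up : upper_bound_on alpha D h C q.
  move=> z r A m M r0 r1 dr zD mA Ash Am hm m0 mM hM.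
  rewrite (harmonic_exit_value hD r0 zD).
  exact: (upper b k _ _ _ _ z r h A m M (pr z) r0 r1 dr (ell z r zD) mh h0 mA Ash Am hm m0 mM hM).
have Wy : (\int[lebesgue_rV R d]_z (h z * weight alpha z)%:E <= (K1 * h y)%:E)%E.
  apply: hK1 => //; first exact/DRad/KD.
  by move=> z zy; apply: (KeD y Ky); lra.
(* The lower bound at [y] also proves that the weighted integral is finite, as required by the upper
   bound at [x]. *)
have Wfin : (\int[lebesgue_rV R d]_z (h z * weight alpha z)%:E)%E \is a fin_num.
  rewrite ge0_fin_numE ?(le_lt_trans Wy) ?ltry//.
  by apply: integral_ge0 => z _; rewrite lee_fin mulr_ge0 ?weight_ge0.
have [B hB] := (bounded_funP h).1 bh.
have hx := hK2 h x _ mh h0 (ex_intro _ B (fun z => le_trans (ler_norm _) (hB z))) up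
  (fun z zx => KeD x Kx z (le_trans zx epse)) (esym (fineK Wfin)).
apply: le_trans hx _; rewrite -mulrA ler_pM2l//.
by rewrite -lee_fin fineK.
Qed.
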